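(* Let $n,m$ be coprime positive integers. For any positive integer $r\le 3$, $$[\mathcal M^{irr}_r]=\frac{[\mathcal R^{irr}_r]}{[\mathrm{PGL}_r(\mathbb C)]}=\frac{[\mathcal R^{irr}_r]}{q^{r-1}(q^r-1)(q^r-q)\cdots(q^r-q^{r-2})}$$ in the localization of $K_0(\mathrm{Var}_{\mathbb C})$ by $q$ and $q^i-1$ for $i=1,\dots,r$.
   Context: $K_0(\mathrm{Var}_{\mathbb C})$ is the Grothendieck ring of complex varieties and $q$ is the class of the affine line. Let $\Gamma_{n,m}=\langle x,y\mid x^n=y^m\rangle$, let $\mathcal R_r=\{(A,B)\in\mathrm{GL}_r(\mathbb C)^2:A^n=B^m\}$ be its $\mathrm{GL}_r$-representation variety, and let $\mathcal R^{irr}_r\subset\mathcal R_r$ be the subvariety of pairs whose associated representation on $\mathbb C^r$ is irreducible. $\mathcal M^{irr}_r=\mathcal R^{irr}_r/\mathrm{PGL}_r(\mathbb C)$ is the quotient by simultaneous conjugation, i.e. the moduli space of irreducible $r$-dimensional representations of $\Gamma_{n,m}$. For $r=1$ the denominator is $1$. *)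

(* Defs.v *)
From HB Require Import structures.
From mathcomp Require Import all_boot all_order all_algebra.
From mathcomp Require Import boolp classical_sets reals.
From mathcomp Require Import complex mpoly ring.

Set Implicit Arguments.
Unset Strict Implicit.
Unset Printing Implicit Defensive.

Import GRing.Theory.
Local Open Scope ring_scope.
Local Open Scope classical_set_scope.
Local Open Scope quotient_scope.

(* A topology on [T] with a sheaf of k-algebras of k-valued functions.  A
   function on an open set [U] is represented by a total function on [T] whose
   values outside [U] are irrelevant: [reg_glue] with [V] = [U] makes [reg U]
   insensitive to them. *)
Record fstruct (k : fieldType) (T : Type) := FStruct {
  fopen : set (set T);
  reg : set T -> set (T -> k);
  fopenT : fopen setT;
  fopenI : forall U V, fopen U -> fopen V -> fopen (U `&` V);
  fopen_bigcup : forall F : set (set T),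
    F `<=` fopen -> fopen (\bigcup_(U in F) U);
  reg_cst : forall U (a : k), fopen U -> reg U (fun=> a);
  reg_add : forall U f g, fopen U -> reg U f -> reg U g ->
    reg U (fun x => f x + g x);
  reg_mul : forall U f g, fopen U -> reg U f -> reg U g ->
    reg U (fun x => f x * g x);
  reg_res : forall U V f, fopen U -> fopen V -> V `<=` U ->
    reg U f -> reg V f;
  reg_glue : forall U f, fopen U ->
    (forall x, U x -> exists V g, [/\ fopen V, V x, V `<=` U, reg V g
                                   & forall y, V y -> f y = g y]) ->
    reg U f
}.

Record fspace (k : fieldType) := FSpace {
  points :> Type;
  fspace_struct : fstruct k points
}.

Section Spaces.
Variable k : fieldType.

Definition isopen (X : fspace k) : set (set X) := fopen (fspace_struct X).
Definition isclosed (X : fspace k) (Z : set X) : Prop := isopen (~` Z).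
Definition regular (X : fspace k) : set X -> set (X -> k) :=
  reg (fspace_struct X).

Definition morphism (X Y : fspace k) (phi : X -> Y) : Prop :=
  forall U : set Y, isopen U ->
    isopen (phi @^-1` U) /\
    forall f : Y -> k, regular U f -> regular (phi @^-1` U) (f \o phi).

Definition isomorphic (X Y : fspace k) : Prop :=
  exists (phi : X -> Y) (psi : Y -> X),
    [/\ morphism phi, morphism psi, cancel phi psi & cancel psi phi].

Section Affine.
Variable N : nat.

Definition zariski_open : set (set ('I_N -> k)) :=
  [set U | exists P : set {mpoly k[N]},
     U = [set x | exists2 p, P p & p.@[x] != 0]].

Definition locally_fraction (U : set ('I_N -> k)) : set (('I_N -> k) -> k) :=
  [set f | forall x, U x -> exists p q : {mpoly k[N]},
     q.@[x] != 0 /\ forall y, U y -> q.@[y] != 0 -> f y = p.@[y] / q.@[y]].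

Lemma zariski_openT : zariski_open setT.
Proof.
exists [set 1]; apply/seteqP; split=> x // _; exists 1 => //.
by rewrite rmorph1 oner_eq0.
Qed.

Lemma zariski_openI U V :
  zariski_open U -> zariski_open V -> zariski_open (U `&` V).
Proof.
move=> [P ->] [Q ->]; exists [set p * q | p in P & q in Q].
apply/seteqP; split=> x /=.
  move=> [[p Pp px] [q Qq qx]]; exists (p * q); first by exists p => //; exists q.
  by rewrite rmorphM mulf_neq0.
move=> [_ [p Pp [q Qq <-]]]; rewrite rmorphM mulf_eq0 negb_or => /andP[px qx].
by split; [exists p | exists q].
Qed.

Lemma zariski_open_bigcup (F : set (set ('I_N -> k))) :
  F `<=` zariski_open -> zariski_open (\bigcup_(U in F) U).
Proof.
move=> FO; exists [set p | exists2 U, F U & forall x, p.@[x] != 0 -> U x].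
apply/seteqP; split=> x /=.
  move=> [U FU Ux]; have [P UE] := FO U FU; move: (Ux); rewrite UE => -[p Pp px].
  by exists p => //; exists U => // y py; rewrite UE; exists p.
by move=> [p [U FU pU] px]; exists U => //; apply: pU.
Qed.

Lemma locally_fraction_cst U (a : k) : locally_fraction U (fun=> a).
Proof.
move=> x Ux; exists a%:MP, 1; rewrite rmorph1 oner_eq0; split=> // y _ _.
by rewrite mevalC rmorph1 divr1.
Qed.

Lemma locally_fraction_add U f g :
  locally_fraction U f -> locally_fraction U g ->
  locally_fraction U (fun x => f x + g x).
Proof.
move=> hf hg x Ux; have [p [q [qx fE]]] := hf x Ux.
have [p' [q' [qx' gE]]] := hg x Ux.
exists (p * q' + p' * q), (q * q'); rewrite rmorphM mulf_neq0 //; split=> // y Uy.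
rewrite !(rmorphM, rmorphD) mulf_eq0 negb_or => /andP[qy qy'].
by rewrite fE // gE // addf_div.
Qed.

Lemma locally_fraction_mul U f g :
  locally_fraction U f -> locally_fraction U g ->
  locally_fraction U (fun x => f x * g x).
Proof.
move=> hf hg x Ux; have [p [q [qx fE]]] := hf x Ux.
have [p' [q' [qx' gE]]] := hg x Ux.
exists (p * p'), (q * q'); rewrite rmorphM mulf_neq0 //; split=> // y Uy.
rewrite !rmorphM mulf_eq0 negb_or => /andP[qy qy'].
by rewrite fE // gE // mulf_div.
Qed.

Lemma locally_fraction_res U V f : V `<=` U ->
  locally_fraction U f -> locally_fraction V f.
Proof.
move=> VU hf x Vx; have [p [q [qx fE]]] := hf x (VU x Vx).
by exists p, q; split=> // y Vy; apply: fE; apply: VU.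
Qed.

Lemma locally_fraction_glue U f :
  (forall x, U x -> exists V g, [/\ zariski_open V, V x, V `<=` U,
     locally_fraction V g & forall y, V y -> f y = g y]) ->
  locally_fraction U f.
Proof.
move=> hU x Ux; have [V [g [[P VE] Vx VU gV fg]]] := hU x Ux.
have [p [q [qx gE]]] := gV x Vx.
move: (Vx); rewrite VE => -[s Ps sx].
exists (p * s), (q * s); rewrite rmorphM mulf_neq0 //; split=> // y Uy.
rewrite !rmorphM mulf_eq0 negb_or => /andP[qy sy].
have Vy : V y by rewrite VE; exists s.
by rewrite fg // gE // -mulf_div divff // mulr1.
Qed.

Definition affine_struct : fstruct k ('I_N -> k) :=
  FStruct zariski_openT zariski_openI zariski_open_bigcup
    (fun U a _ => @locally_fraction_cst U a)
    (fun U f g _ => @locally_fraction_add U f g)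
    (fun U f g _ => @locally_fraction_mul U f g)
    (fun U V f _ _ => @locally_fraction_res U V f)
    (fun U f _ => @locally_fraction_glue U f).

Definition affine_space : fspace k := FSpace affine_struct.

End Affine.

(* For the inclusion of a subset this is the subspace topology, with the
   functions that locally extend to regular functions on the ambient space. *)
Section Induced.
Variables (X : fspace k) (T : Type) (phi : T -> X).

Definition induced_open : set (set T) :=
  [set V | exists2 U, isopen U & V = phi @^-1` U].

Definition induced_reg (V : set T) : set (T -> k) :=
  [set f | forall t, V t -> exists U g, [/\ isopen U, U (phi t), regular U g
     & forall s, V s -> U (phi s) -> f s = g (phi s)]].

Lemma induced_openT : induced_open setT.
Proof. by exists setT => //; apply: fopenT. Qed.

Lemma induced_openI U V :
  induced_open U -> induced_open V -> induced_open (U `&` V).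
Proof.
by move=> [U' oU ->] [V' oV ->]; exists (U' `&` V') => //; apply: fopenI.
Qed.

Lemma induced_open_bigcup (F : set (set T)) :
  F `<=` induced_open -> induced_open (\bigcup_(U in F) U).
Proof.
move=> FO.
exists (\bigcup_(U in [set U | isopen U /\ F (phi @^-1` U)]) U).
  by apply: fopen_bigcup => U [].
apply/seteqP; split=> t /=.
  move=> [V FV Vt]; have [U oU VE] := FO V FV; exists U; last by rewrite VE in Vt.
  by split=> //; rewrite -VE.
by move=> [U [oU FU] Ut]; exists (phi @^-1` U).
Qed.

Lemma induced_reg_cst U (a : k) : induced_reg U (fun=> a).
Proof.
move=> t Ut; exists setT, (fun=> a); split=> //; first exact: fopenT.
by apply: reg_cst; apply: fopenT.
Qed.

Lemma induced_reg_op (op : k -> k -> k) :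
  (forall U (f g : X -> k), isopen U -> regular U f -> regular U g ->
     regular U (fun x => op (f x) (g x))) ->
  forall V f g, induced_reg V f -> induced_reg V g ->
  induced_reg V (fun x => op (f x) (g x)).
Proof.
move=> hop V f g hf hg t Vt; have [U [f' [oU Ut rf fE]]] := hf t Vt.
have [U' [g' [oU' Ut' rg gE]]] := hg t Vt.
have oUU' : isopen (U `&` U') by apply: fopenI.
exists (U `&` U'), (fun x => op (f' x) (g' x)); split=> //.
  apply: hop => //; first by apply: reg_res rf => // x [].
  by apply: reg_res rg => // x [].
by move=> s Vs [Us Us']; rewrite fE // gE.
Qed.

Lemma induced_reg_add V f g : induced_reg V f -> induced_reg V g ->
  induced_reg V (fun x => f x + g x).
Proof. by apply: (induced_reg_op (op := +%R)) => U f' g'; apply: reg_add. Qed.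

Lemma induced_reg_mul V f g : induced_reg V f -> induced_reg V g ->
  induced_reg V (fun x => f x * g x).
Proof. by apply: (induced_reg_op (op := *%R)) => U f' g'; apply: reg_mul. Qed.

Lemma induced_reg_res U V f : V `<=` U -> induced_reg U f -> induced_reg V f.
Proof.
move=> VU hf t Vt; have [W [g [oW Wt rg fE]]] := hf t (VU t Vt).
by exists W, g; split=> // s Vs; apply: fE; apply: VU.
Qed.

Lemma induced_reg_glue U f :
  (forall x, U x -> exists V g, [/\ induced_open V, V x, V `<=` U,
     induced_reg V g & forall y, V y -> f y = g y]) ->
  induced_reg U f.
Proof.
move=> hU t Ut; have [V [g [[V' oV' VE] Vt VU rg fg]]] := hU t Ut.
have [W [h [oW Wt rh gE]]] := rg t Vt.
have oVW : isopen (V' `&` W) by apply: fopenI.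
exists (V' `&` W), h; split=> //.
- by split=> //; rewrite VE in Vt.
- by apply: reg_res rh => // x [].
- by move=> s Us [Vs Ws]; have Vs' : V s by [rewrite VE]; rewrite fg // gE.
Qed.

Definition induced_struct : fstruct k T :=
  FStruct induced_openT induced_openI induced_open_bigcup
    (fun U a _ => @induced_reg_cst U a)
    (fun U f g _ => @induced_reg_add U f g)
    (fun U f g _ => @induced_reg_mul U f g)
    (fun U V f _ _ => @induced_reg_res U V f)
    (fun U f _ => @induced_reg_glue U f).

Definition induced_space : fspace k := FSpace induced_struct.

End Induced.

Definition subspace (X : fspace k) (A : set X) : fspace k :=
  induced_space (val : A -> X).

(* The points are the equivalence classes, the topology is the quotient
   topology, and the regular functions are those whose pull-back is regular
   (for the orbits of a group, the invariant regular functions). *)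
Section Quotient.
Variables (X : fspace k) (E : X -> set X).

Definition classes : Type := range E.

Definition class_of (x : X) : classes :=
  SigSub (mem_set (imageT E x) : E x \in range E).

Definition quot_open : set (set classes) :=
  [set U | isopen (class_of @^-1` U)].

Definition quot_reg (U : set classes) : set (classes -> k) :=
  [set f : classes -> k | regular (class_of @^-1` U) (f \o class_of)].

Lemma quot_openT : quot_open setT.
Proof. exact: fopenT. Qed.

Lemma quot_openI U V : quot_open U -> quot_open V -> quot_open (U `&` V).
Proof. exact: fopenI. Qed.

Lemma quot_open_bigcup (F : set (set classes)) :
  F `<=` quot_open -> quot_open (\bigcup_(U in F) U).
Proof.
move=> FO; rewrite /quot_open /= preimage_bigcup.
have := @fopen_bigcup _ _ (fspace_struct X) [set class_of @^-1` U | U in F].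
by rewrite bigcup_image; apply=> _ [U FU <-]; apply: FO.
Qed.

Lemma quot_reg_glue U f : quot_open U ->
  (forall x, U x -> exists V g, [/\ quot_open V, V x, V `<=` U,
     quot_reg V g & forall y, V y -> f y = g y]) ->
  quot_reg U f.
Proof.
move=> oU hU; apply: reg_glue => // x Ux.
have [V [g [oV Vx VU rg fg]]] := hU _ Ux.
exists (class_of @^-1` V), (g \o class_of); split=> // y Vy; first exact: VU.
exact: fg.
Qed.

Definition quot_struct : fstruct k classes :=
  @FStruct k classes quot_open quot_reg
    quot_openT quot_openI quot_open_bigcup
    (fun U a oU => reg_cst a oU)
    (fun U f g oU => @reg_add _ _ _ _ _ _ oU)
    (fun U f g oU => @reg_mul _ _ _ _ _ _ oU)
    (fun U V f oU oV VU => @reg_res _ _ _ _ _ _ oU oV (fun x => VU _))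
    quot_reg_glue.

Definition quot_space : fspace k := FSpace quot_struct.

End Quotient.

(* Reduced but possibly reducible or empty; [k] is meant to be algebraically
   closed. *)

Definition is_affine (X : fspace k) : Prop :=
  exists (N : nat) (P : set {mpoly k[N]}),
    isomorphic X
      (@subspace (affine_space N) [set x | forall p, P p -> p.@[x] = 0]).

Definition is_prevariety (X : fspace k) : Prop :=
  exists (s : nat) (U : 'I_s -> set X),
    (forall i, isopen (U i) /\ is_affine (subspace (U i))) /\
    forall x, exists i, U i x.

Definition is_separated (X : fspace k) : Prop :=
  forall (Z : fspace k) (f g : Z -> X), is_affine Z ->
    morphism f -> morphism g -> isclosed [set z | f z = g z].

Definition is_variety (X : fspace k) : Prop :=
  is_prevariety X /\ is_separated X.

Definition is_product (X Y P : fspace k) : Prop :=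
  exists (p1 : P -> X) (p2 : P -> Y),
    [/\ morphism p1, morphism p2 &
     forall (Z : fspace k) (f : Z -> X) (g : Z -> Y),
       is_variety Z -> morphism f -> morphism g ->
       exists! h : Z -> P, [/\ morphism h, p1 \o h = f & p2 \o h = g]].

(* A variety has a finite cover by subsets of affine spaces, hence at most as
   many points as [seq k].  So every variety is isomorphic to one whose points
   form a subset of [seq k]; only these are used as generators, since varieties
   with points in an arbitrary [Type] are too large to generate a
   [comPzRingType]. *)
Record svariety := SVariety {
  spoints : set (seq k);
  sstruct : fstruct k spoints;
  svarietyP : is_variety (FSpace sstruct)
}.

Definition sspace (X : svariety) : fspace k := FSpace (sstruct X).

(* The commutative ring generated by the classes [X], with the relations
   [X] = [Y] for X isomorphic to Y, [X] = [Z] + [X \ Z] for Z closed in X,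
   [X x Y] = [X][Y], and 1 the class of the point. *)
Inductive K0term :=
  | KGen of svariety
  | KZero
  | KOne
  | KOpp of K0term
  | KAdd of K0term & K0term
  | KMul of K0term & K0term.

Inductive K0eq : K0term -> K0term -> Prop :=
  | K0eq_refl a : K0eq a a
  | K0eq_sym a b : K0eq a b -> K0eq b a
  | K0eq_trans b a c : K0eq a b -> K0eq b c -> K0eq a c
  | K0eq_opp a b : K0eq a b -> K0eq (KOpp a) (KOpp b)
  | K0eq_add a b c d : K0eq a b -> K0eq c d -> K0eq (KAdd a c) (KAdd b d)
  | K0eq_mul a b c d : K0eq a b -> K0eq c d -> K0eq (KMul a c) (KMul b d)
  | K0eq_addA a b c : K0eq (KAdd a (KAdd b c)) (KAdd (KAdd a b) c)
  | K0eq_addC a b : K0eq (KAdd a b) (KAdd b a)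
  | K0eq_add0 a : K0eq (KAdd KZero a) a
  | K0eq_addN a : K0eq (KAdd (KOpp a) a) KZero
  | K0eq_mulA a b c : K0eq (KMul a (KMul b c)) (KMul (KMul a b) c)
  | K0eq_mulC a b : K0eq (KMul a b) (KMul b a)
  | K0eq_mul1 a : K0eq (KMul KOne a) a
  | K0eq_mulD a b c : K0eq (KMul (KAdd a b) c) (KAdd (KMul a c) (KMul b c))
  | K0eq_iso (X Y : svariety) :
      isomorphic (sspace X) (sspace Y) -> K0eq (KGen X) (KGen Y)
  | K0eq_scissor (X Z U : svariety) (A : set (sspace X)) :
      isclosed A ->
      isomorphic (sspace Z) (subspace A) ->
      isomorphic (sspace U) (subspace (~` A)) ->
      K0eq (KGen X) (KAdd (KGen Z) (KGen U))
  | K0eq_prod (X Y P : svariety) :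
      is_product (sspace X) (sspace Y) (sspace P) ->
      K0eq (KGen P) (KMul (KGen X) (KGen Y))
  | K0eq_point (X : svariety) :
      isomorphic (sspace X) (affine_space 0) -> K0eq (KGen X) KOne.

HB.instance Definition _ := gen_eqMixin K0term.
HB.instance Definition _ := gen_choiceMixin K0term.

Definition K0eqb (a b : K0term) : bool := `[< K0eq a b >].

Lemma K0eqb_refl : reflexive K0eqb.
Proof. by move=> a; apply/asboolP; apply: K0eq_refl. Qed.

Lemma K0eqb_sym : ssrbool.symmetric K0eqb.
Proof.
by move=> a b; apply/asboolP/asboolP; apply: K0eq_sym.
Qed.

Lemma K0eqb_trans : transitive K0eqb.
Proof.
move=> b a c /asboolP ab /asboolP bc; apply/asboolP; exact: K0eq_trans ab bc.
Qed.

Canonical K0eqb_equiv := EquivRel K0eqb K0eqb_refl K0eqb_sym K0eqb_trans.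

Definition K0 : Type := {eq_quot K0eqb}.
HB.instance Definition _ := Choice.on K0.

Local Notation cl := (\pi_{eq_quot K0eqb}%qT : K0term -> K0).

Lemma K0P a b : cl a = cl b <-> K0eq a b.
Proof. by split=> [/eqmodP/asboolP|ab]; last by apply/eqmodP/asboolP. Qed.

Lemma K0_ind (P : K0 -> Prop) : (forall a, P (cl a)) -> forall x, P x.
Proof. by move=> h x; rewrite -[x](@reprK _ {eq_quot K0eqb}). Qed.

Lemma K0_repr a : K0eq (repr (cl a)) a.
Proof. by apply/K0P; exact: (@reprK _ {eq_quot K0eqb}). Qed.

Definition K0zero : K0 := cl KZero.
Definition K0one : K0 := cl KOne.
Definition K0opp (x : K0) : K0 := cl (KOpp (repr x)).
Definition K0add (x y : K0) : K0 := cl (KAdd (repr x) (repr y)).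
Definition K0mul (x y : K0) : K0 := cl (KMul (repr x) (repr y)).

Lemma K0oppE a : K0opp (cl a) = cl (KOpp a).
Proof. by apply/K0P; apply: K0eq_opp; apply: K0_repr. Qed.

Lemma K0addE a b : K0add (cl a) (cl b) = cl (KAdd a b).
Proof. by apply/K0P; apply: K0eq_add; apply: K0_repr. Qed.

Lemma K0mulE a b : K0mul (cl a) (cl b) = cl (KMul a b).
Proof. by apply/K0P; apply: K0eq_mul; apply: K0_repr. Qed.

Lemma K0addA : associative K0add.
Proof.
elim/K0_ind=> a; elim/K0_ind=> b; elim/K0_ind=> c.
by rewrite !K0addE; apply/K0P; apply: K0eq_addA.
Qed.

Lemma K0addC : commutative K0add.
Proof.
elim/K0_ind=> a; elim/K0_ind=> b.
by rewrite !K0addE; apply/K0P; apply: K0eq_addC.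
Qed.

Lemma K0add0 : left_id K0zero K0add.
Proof. by elim/K0_ind=> a; rewrite K0addE; apply/K0P; apply: K0eq_add0. Qed.

Lemma K0addN : left_inverse K0zero K0opp K0add.
Proof.
by elim/K0_ind=> a; rewrite K0oppE K0addE; apply/K0P; apply: K0eq_addN.
Qed.

Lemma K0mulA : associative K0mul.
Proof.
elim/K0_ind=> a; elim/K0_ind=> b; elim/K0_ind=> c.
by rewrite !K0mulE; apply/K0P; apply: K0eq_mulA.
Qed.

Lemma K0mulC : commutative K0mul.
Proof.
elim/K0_ind=> a; elim/K0_ind=> b.
by rewrite !K0mulE; apply/K0P; apply: K0eq_mulC.
Qed.

Lemma K0mul1 : left_id K0one K0mul.
Proof. by elim/K0_ind=> a; rewrite K0mulE; apply/K0P; apply: K0eq_mul1. Qed.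

Lemma K0mulD : left_distributive K0mul K0add.
Proof.
elim/K0_ind=> a; elim/K0_ind=> b; elim/K0_ind=> c.
by rewrite !(K0addE, K0mulE); apply/K0P; apply: K0eq_mulD.
Qed.

HB.instance Definition _ :=
  GRing.isZmodule.Build K0 K0addA K0addC K0add0 K0addN.
HB.instance Definition _ :=
  GRing.Zmodule_isComPzRing.Build K0 K0mulA K0mulC K0mul1 K0mulD.

(* All copies of [X] with points in [seq k] have the same class; the value is 0
   if [X] is not a variety. *)
Definition K0class (X : fspace k) : K0 :=
  xget 0 [set a | exists2 S : svariety,
                    isomorphic (sspace S) X & a = cl (KGen S)].

End Spaces.

Section Localization.
Variables (A : comPzRingType) (S : set A).

Inductive mult_closure : A -> Prop :=
  | mult_closure1 : mult_closure 1
  | mult_closureM s t : S s -> mult_closure t -> mult_closure (s * t).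

Lemma mult_closure_mul s t :
  mult_closure s -> mult_closure t -> mult_closure (s * t).
Proof.
move=> hs ht; elim: hs => [|u v Su _ IH]; first by rewrite mul1r.
by rewrite -mulrA; constructor.
Qed.

Definition denominators : set A := mult_closure.

Definition fracpair : Type := (A * denominators)%type.
HB.instance Definition _ := Choice.on fracpair.

Implicit Types x y z : fracpair.

Definition fnum x : A := x.1.
Definition fden x : A := val x.2.

Lemma fdenP x : mult_closure (fden x).
Proof. exact: set_valP. Qed.

Definition mkfrac (a s : A) (hs : mult_closure s) : fracpair :=
  (a, SigSub (mem_set hs : s \in denominators)).

(* The extra factor u is needed because A may have zero divisors. *)
Definition fraceq x y : bool :=
  `[< exists2 u, mult_closure u &
        u * (fnum x * fden y) = u * (fnum y * fden x) >].

Lemma fraceq_refl : reflexive fraceq.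
Proof. by move=> x; apply/asboolP; exists 1 => //; constructor. Qed.

Lemma fraceq_sym : ssrbool.symmetric fraceq.
Proof. by move=> x y; apply/asboolP/asboolP => -[u hu e]; exists u. Qed.

Lemma fraceq_trans : transitive fraceq.
Proof.
move=> y x z /asboolP[u hu e] /asboolP[v hv e']; apply/asboolP.
exists (u * v * fden y).
  by do !apply: mult_closure_mul => //; apply: fdenP.
have -> : u * v * fden y * (fnum x * fden z) =
  v * fden z * (u * (fnum x * fden y)) by ring.
rewrite e.
have -> : v * fden z * (u * (fnum y * fden x)) =
  u * fden x * (v * (fnum y * fden z)) by ring.
by rewrite e'; ring.
Qed.

Canonical fraceq_equiv := EquivRel fraceq fraceq_refl fraceq_sym fraceq_trans.

Definition localization : Type := {eq_quot fraceq}.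
HB.instance Definition _ := Choice.on localization.

Local Notation cl := (\pi_{eq_quot fraceq}%qT : fracpair -> localization).

Lemma locP x y : cl x = cl y <-> exists2 u, mult_closure u &
  u * (fnum x * fden y) = u * (fnum y * fden x).
Proof. by split=> [/eqmodP/asboolP|xy]; last by apply/eqmodP/asboolP. Qed.

Lemma loc_ind (P : localization -> Prop) :
  (forall x, P (cl x)) -> forall a, P a.
Proof. by move=> h a; rewrite -[a](@reprK _ {eq_quot fraceq}). Qed.

Lemma loc_repr x : exists2 u, mult_closure u &
  u * (fnum (repr (cl x)) * fden x) = u * (fnum x * fden (repr (cl x))).
Proof. by apply/locP; exact: (@reprK _ {eq_quot fraceq}). Qed.

Lemma loc_eq x y : fnum x * fden y = fnum y * fden x -> cl x = cl y.
Proof. by move=> e; apply/locP; exists 1; [constructor | rewrite e]. Qed.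

Definition fopp x := mkfrac (- fnum x) (fdenP x).
Definition fadd x y := mkfrac (fnum x * fden y + fnum y * fden x)
  (mult_closure_mul (fdenP x) (fdenP y)).
Definition fmul x y := mkfrac (fnum x * fnum y)
  (mult_closure_mul (fdenP x) (fdenP y)).

Definition loc_zero : localization := cl (mkfrac 0 mult_closure1).
Definition loc_one : localization := cl (mkfrac 1 mult_closure1).
Definition loc_opp (a : localization) : localization := cl (fopp (repr a)).
Definition loc_add (a b : localization) : localization :=
  cl (fadd (repr a) (repr b)).
Definition loc_mul (a b : localization) : localization :=
  cl (fmul (repr a) (repr b)).

Lemma fnum_mkfrac a s hs : fnum (@mkfrac a s hs) = a. Proof. by []. Qed.
Lemma fden_mkfrac a s hs : fden (@mkfrac a s hs) = s. Proof. by []. Qed.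
Let fracE := (fnum_mkfrac, fden_mkfrac).

Lemma loc_oppE x : loc_opp (cl x) = cl (fopp x).
Proof.
rewrite /loc_opp; case: (loc_repr x) => u hu; move: (repr _) => x' e.
apply/locP; exists u => //; rewrite !fracE !(mulNr, mulrN).
by rewrite e.
Qed.

Lemma loc_addE x y : loc_add (cl x) (cl y) = cl (fadd x y).
Proof.
rewrite /loc_add; case: (loc_repr x) => u hu; move: (repr _) => x' e.
case: (loc_repr y) => v hv; move: (repr _) => y' e'.
apply/locP; exists (u * v); first exact: mult_closure_mul.
rewrite !fracE.
transitivity (u * (fnum x' * fden x) * (v * fden y * fden y') +
              v * (fnum y' * fden y) * (u * fden x * fden x')); first by ring.
by rewrite e e'; ring.
Qed.

Lemma loc_mulE x y : loc_mul (cl x) (cl y) = cl (fmul x y).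
Proof.
rewrite /loc_mul; case: (loc_repr x) => u hu; move: (repr _) => x' e.
case: (loc_repr y) => v hv; move: (repr _) => y' e'.
apply/locP; exists (u * v); first exact: mult_closure_mul.
rewrite !fracE.
transitivity (u * (fnum x' * fden x) * (v * (fnum y' * fden y))); first by ring.
by rewrite e e'; ring.
Qed.

Lemma loc_addA : associative loc_add.
Proof.
elim/loc_ind=> x; elim/loc_ind=> y; elim/loc_ind=> z.
by rewrite !loc_addE; apply: loc_eq; rewrite !fracE; ring.
Qed.

Lemma loc_addC : commutative loc_add.
Proof.
elim/loc_ind=> x; elim/loc_ind=> y.
by rewrite !loc_addE; apply: loc_eq; rewrite !fracE; ring.
Qed.

Lemma loc_add0 : left_id loc_zero loc_add.
Proof.
elim/loc_ind=> x.
by rewrite loc_addE; apply: loc_eq; rewrite !fracE; ring.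
Qed.

Lemma loc_addN : left_inverse loc_zero loc_opp loc_add.
Proof.
elim/loc_ind=> x.
by rewrite loc_oppE loc_addE; apply: loc_eq; rewrite !fracE; ring.
Qed.

Lemma loc_mulA : associative loc_mul.
Proof.
elim/loc_ind=> x; elim/loc_ind=> y; elim/loc_ind=> z.
by rewrite !loc_mulE; apply: loc_eq; rewrite !fracE; ring.
Qed.

Lemma loc_mulC : commutative loc_mul.
Proof.
elim/loc_ind=> x; elim/loc_ind=> y.
by rewrite !loc_mulE; apply: loc_eq; rewrite !fracE; ring.
Qed.

Lemma loc_mul1 : left_id loc_one loc_mul.
Proof.
elim/loc_ind=> x.
by rewrite loc_mulE; apply: loc_eq; rewrite !fracE; ring.
Qed.

Lemma loc_mulD : left_distributive loc_mul loc_add.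
Proof.
elim/loc_ind=> x; elim/loc_ind=> y; elim/loc_ind=> z.
rewrite !(loc_addE, loc_mulE).
by apply: loc_eq; rewrite !fracE; ring.
Qed.

HB.instance Definition _ :=
  GRing.isZmodule.Build localization loc_addA loc_addC loc_add0 loc_addN.
HB.instance Definition _ := GRing.Zmodule_isComPzRing.Build localization
  loc_mulA loc_mulC loc_mul1 loc_mulD.

Definition to_loc (a : A) : localization := cl (mkfrac a mult_closure1).

End Localization.

(* MathComp's [unitRingType] excludes the zero ring, and nontriviality of the
   localizations considered here is not immediate; hence these notions for
   commutative rings that may be zero. *)
Definition invertible (A : comPzRingType) (x : A) : Prop :=
  exists y, x * y = 1.

Definition ring_div (A : comPzRingType) (x y : A) : A :=
  x * xget 0 [set z | y * z = 1].

Section Representations.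
Variables (k : fieldType) (r : nat).

Definition mx_space : fspace k :=
  @induced_space k (affine_space k (r * r)) 'M[k]_r (fun A i => mxvec A 0 i).

Definition mxpair_space : fspace k :=
  @induced_space k (affine_space k (r * r + r * r)) ('M[k]_r * 'M[k]_r)%type
    (fun X i => row_mx (mxvec X.1) (mxvec X.2) 0 i).

Definition GL_space : fspace k :=
  @subspace k mx_space [set A : 'M[k]_r | A \in unitmx].

Definition PGL_space : fspace k :=
  @quot_space k GL_space
    (fun A => [set B | exists2 c : k, c != 0 & val B = c *: val A]).

(* A subspace stable under two invertible matrices is stable under their
   inverses, for reasons of dimension, hence under the whole group.  The
   condition r > 0 is left to the statements. *)
Definition irreducible_pair (X : 'M[k]_r * 'M[k]_r) : Prop :=
  forall U : {vspace 'cV[k]_r},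
    (forall v, v \in U -> X.1 *m v \in U) ->
    (forall v, v \in U -> X.2 *m v \in U) ->
    U = 0%VS \/ U = fullv.

Definition rep_variety (n m : nat) : set ('M[k]_r * 'M[k]_r) :=
  [set X | [/\ X.1 \in unitmx, X.2 \in unitmx & X.1 ^+ n = X.2 ^+ m]].

Definition Rirr (n m : nat) : fspace k :=
  @subspace k mxpair_space (rep_variety n m `&` irreducible_pair).

(* PGL_r acts by conjugation through GL_r, so it has the same orbits. *)
Definition Mirr (n m : nat) : fspace k :=
  @quot_space k (Rirr n m)
    (fun X => [set Y | exists2 P : 'M[k]_r, P \in unitmx
       & val Y = (P *m (val X).1 *m invmx P, P *m (val X).2 *m invmx P)]).

End Representations.

(* Main.v *)
(* An irreducible pair (A, B) with A^n = B^m has A^n = omega scalar by Schur.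
   As r <= 3 and n, m are coprime, r is coprime to the exponent e of one of the
   two matrices, say a; then s = det(a)^u / omega^v with u r = v e + 1 is a
   regular invariant e-th root of omega, so the eigenvalues of a / s are e-th
   roots of unity and its spectral projectors are regular functions of (A, B).
   For r <= 3 one of these projectors, or its complement, has rank one.

   Let p be such a projector and v span its image.  A tuple of words w_1, ..., w_r
   in A, B for which w_1 v, ..., w_r v is a basis gives a frame of k^r that is
   equivariant and well defined up to a scalar, that is, an equivariant map to
   PGL_r.  In this frame A and B are H^-1 H_A and H^-1 H_B, where the entries of
   the matrices H, H_A, H_B are invariants of the form tr (p w' X w).  Hence the
   representation variety is covered by finitely many invariant affine open sets
   that are products of PGL_r with an affine slice, and the invariants tr (p w)
   separate orbits.  The quotient is therefore a variety and the map to it a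
   Zariski-locally trivial fibration, so that [R] = [PGL_r] [M].

   The same fibration principle applied to the first column GL_(r+1) -> k^(r+1) \ 0
   and to GL_r -> PGL_r computes the class of PGL_r. *)

From HB Require Import structures.
Require Import Defs.
From mathcomp Require Import all_boot all_order all_algebra.
From mathcomp Require Import boolp classical_sets reals.
From mathcomp Require Import perm complex mpoly ring.

Set Implicit Arguments.
Unset Strict Implicit.
Unset Printing Implicit Defensive.

Import GRing.Theory.
Local Open Scope ring_scope.
Local Open Scope classical_set_scope.

(** * Spaces with functions *)

Section SpacesWithFunctions.
Variable k : fieldType.
Implicit Types X Y Z : fspace k.

(** [Mirr] is defined only as a space with functions, and [K0class] would return 0 if it were not a
    variety. So no quotient theorem is quoted: the local slices yield at once the charts of the
    quotient, their affineness and the triviality of the map over them. Irreducible pairs do not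
    form a closed set; the construction therefore runs inside the larger affine set of pairs with
    [A^n = B^m] scalar, where the idempotents are already regular. There the rank-one condition and
    the invertibility of [H] amount to the nonvanishing of one function, and together they force
    irreducibility. Extracting an [e]-th root of omega would in general need an etale cover and give
    no Zariski-local trivialization; the Bezout relation [u r = v e + 1] builds the root from a
    determinant instead. A frame depends on an auxiliary vector, but only through a scalar factor,
    which is why it defines a point of PGL rather than of GL. Finally, [K0] may have zero divisors,
    so [PGL] is identified with the explicit denominator only after localizing, by cancelling
    [q - 1] from two expressions of [GL]. *)

Lemma isopenT X : isopen (@setT X).
Proof. exact: fopenT. Qed.

Lemma isopenI X (U V : set X) : isopen U -> isopen V -> isopen (U `&` V).
Proof. exact: fopenI. Qed.

Lemma isopen_bigcup X (F : set (set X)) :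
  F `<=` @isopen k X -> isopen (\bigcup_(U in F) U).
Proof. exact: fopen_bigcup. Qed.

Lemma isopen_local X (V : set X) :
  (forall x, V x -> exists W, [/\ isopen W, W x & W `<=` V]) -> isopen V.
Proof.
move=> h; have -> : V = \bigcup_(W in [set W | isopen W /\ W `<=` V]) W.
  apply/seteqP; split=> [x Vx|x [W [_ WV] /WV //]].
  by have [W [oW Wx WV]] := h x Vx; exists W.
by apply: isopen_bigcup => W [].
Qed.

Lemma isopenU X (U V : set X) : isopen U -> isopen V -> isopen (U `|` V).
Proof.
move=> oU oV; apply: isopen_local => x [Ux|Vx].
  by exists U; split=> // y; left.
by exists V; split=> // y; right.
Qed.

Lemma isopen0 X : isopen (@set0 X).
Proof. by apply: isopen_local. Qed.

Lemma regular_res X (U V : set X) f : isopen U -> isopen V -> V `<=` U ->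
  regular U f -> regular V f.
Proof. exact: reg_res. Qed.

Lemma regular_local X (U : set X) f : isopen U ->
  (forall x, U x -> exists V g, [/\ isopen V, V x, regular V g
                                 & forall y, U y -> V y -> f y = g y]) ->
  regular U f.
Proof.
move=> oU h; apply: reg_glue => // x Ux.
have [V [g [oV Vx rg fg]]] := h x Ux.
exists (U `&` V), g; split=> //; [exact: isopenI| |by move=> y []; apply: fg].
by apply: regular_res rg => //; exact: isopenI.
Qed.

Lemma regular_ext X (U : set X) f g : isopen U ->
  (forall y, U y -> f y = g y) -> regular U g -> regular U f.
Proof. by move=> oU fg rg; apply: regular_local => // x Ux; exists U, g; split=> // y _; apply: fg. Qed.

Lemma regular_cst X (U : set X) (a : k) : isopen U -> regular U (fun=> a).
Proof. exact: reg_cst. Qed.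

Lemma regularD X (U : set X) f g : isopen U -> regular U f -> regular U g ->
  regular U (fun x => f x + g x).
Proof. exact: reg_add. Qed.

Lemma regularM X (U : set X) f g : isopen U -> regular U f -> regular U g ->
  regular U (fun x => f x * g x).
Proof. exact: reg_mul. Qed.

Lemma regularN X (U : set X) f : isopen U -> regular U f ->
  regular U (fun x => - f x).
Proof.
move=> oU rf; apply: (@regular_ext _ _ _ (fun x => -1 * f x)) => //.
  by move=> y _; rewrite mulN1r.
by apply: regularM => //; apply: regular_cst.
Qed.

Lemma regularB X (U : set X) f g : isopen U -> regular U f -> regular U g ->
  regular U (fun x => f x - g x).
Proof. by move=> oU rf rg; apply: regularD => //; apply: regularN. Qed.

Lemma regular_sum X (U : set X) (I : Type) (s : seq I) (P : pred I)
    (F : I -> X -> k) : isopen U ->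
  (forall i, regular U (F i)) -> regular U (fun x => \sum_(i <- s | P i) F i x).
Proof.
move=> oU rF; elim: s => [|i s IHs].
  apply: (@regular_ext _ _ _ (fun=> 0)) => //; last exact: regular_cst.
  by move=> y _; rewrite big_nil.
apply: (@regular_ext _ _ _ (fun x => (if P i then F i x else 0) +
  \sum_(i <- s | P i) F i x)) => //.
  by move=> y _; rewrite big_cons; case: (P i) => //; rewrite add0r.
by apply: regularD => //; case: (P i) => //; apply: regular_cst.
Qed.

Lemma regular_prod X (U : set X) (I : Type) (s : seq I) (P : pred I)
    (F : I -> X -> k) : isopen U ->
  (forall i, regular U (F i)) -> regular U (fun x => \prod_(i <- s | P i) F i x).
Proof.
move=> oU rF; elim: s => [|i s IHs].
  apply: (@regular_ext _ _ _ (fun=> 1)) => //; last exact: regular_cst.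
  by move=> y _; rewrite big_nil.
apply: (@regular_ext _ _ _ (fun x => (if P i then F i x else 1) *
  \prod_(i <- s | P i) F i x)) => //.
  by move=> y _; rewrite big_cons; case: (P i) => //; rewrite mul1r.
by apply: regularM => //; case: (P i) => //; apply: regular_cst.
Qed.

Lemma regularX X (U : set X) f n : isopen U -> regular U f ->
  regular U (fun x => f x ^+ n).
Proof.
move=> oU rf; elim: n => [|n IHn].
  by apply: (@regular_ext _ _ _ (fun=> 1)) => //; apply: regular_cst.
apply: (@regular_ext _ _ _ (fun x => f x * f x ^+ n)) => //.
  by move=> y _; rewrite exprS.
exact: regularM.
Qed.

Lemma regular_meval X (U : set X) N (h : X -> 'I_N -> k) (p : {mpoly k[N]}) :
  isopen U -> (forall i, regular U (fun x => h x i)) ->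
  regular U (fun x => p.@[h x]).
Proof.
move=> oU rh.
apply: (@regular_ext _ _ _ (fun x => \sum_(m <- msupp p) p@_m * \prod_i h x i ^+ m i)) => //.
apply: regular_sum => // m; apply: regularM => //; first exact: regular_cst.
by apply: regular_prod => // i; apply: regularX.
Qed.

Lemma morphism_id X : morphism (@id X).
Proof. by move=> U oU; split. Qed.

Lemma morphism_comp X Y Z (f : X -> Y) (g : Y -> Z) :
  morphism f -> morphism g -> morphism (g \o f).
Proof.
move=> mf mg U oU; have [oV rV] := mg U oU; have [oW rW] := mf _ oV.
by split=> // h rh; exact: (rW (h \o g) (rV h rh)).
Qed.

Lemma morphism_open X Y (f : X -> Y) U : morphism f -> isopen U ->
  isopen (f @^-1` U).
Proof. by move=> mf /mf[]. Qed.

Lemma morphism_closed X Y (f : X -> Y) A : morphism f -> isclosed A ->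
  isclosed (f @^-1` A).
Proof. by move=> mf /mf[]; rewrite preimage_setC. Qed.

Lemma morphism_regular X Y (f : X -> Y) U g : morphism f -> isopen U ->
  regular U g -> regular (f @^-1` U) (g \o f).
Proof. by move=> mf /mf[_]; apply. Qed.

Lemma morphism_regularT X Y (f : X -> Y) (g : Y -> k) : morphism f ->
  regular setT g -> regular setT (g \o f).
Proof. by move=> mf; apply: (morphism_regular mf); apply: isopenT. Qed.

(** Serves maps defined by a pointwise choice, such as [frame_class], that agree near each point
    with an explicit formula. *)
Lemma morphism_local X Y (f : X -> Y) :
  (forall x, exists W, [/\ isopen W, W x &
     morphism (fun w : subspace W => f (val w))]) ->
  morphism f.
Proof.
move=> h U oU; have oV : isopen (f @^-1` U).
  apply: isopen_local => x Ux; have [W [oW Wx mW]] := h x.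
  have [[V oV VE] _] := mW U oU; exists (W `&` V); split.
  - exact: isopenI.
  - split=> //; have : ((fun w : W => f (val w)) @^-1` U) (SigSub (mem_set Wx)) by [].
    by rewrite VE.
  - move=> y [Wy Vy]; have : ((val : W -> X) @^-1` V) (SigSub (mem_set Wy)) by [].
    by rewrite -VE.
split=> // g rg; apply: regular_local => // x Ux; have [W [oW Wx mW]] := h x.
have [_ /(_ g rg)] := mW U oU; move=> /(_ (SigSub (mem_set Wx)) Ux).
move=> [V [g' [oV' Vx rg' e]]]; exists (W `&` V), g'; split.
- exact: isopenI.
- by split.
- by apply: regular_res rg' => //; exact: isopenI.
- by move=> y Uy [Wy Vy]; apply: (e (SigSub (mem_set Wy))).
Qed.

Lemma isomorphic_refl X : isomorphic X X.
Proof. by exists id, id; split=> //; apply: morphism_id. Qed.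

Lemma isomorphic_sym X Y : isomorphic X Y -> isomorphic Y X.
Proof. by move=> [f [g [mf mg fK gK]]]; exists g, f. Qed.

Lemma isomorphic_trans Y X Z :
  isomorphic X Y -> isomorphic Y Z -> isomorphic X Z.
Proof.
move=> [f [g [mf mg fK gK]]] [f' [g' [mf' mg' fK' gK']]].
exists (f' \o f), (g \o g'); split; try exact: morphism_comp.
  exact: can_comp.
exact: can_comp.
Qed.

Lemma induced_morphism X (T : Type) (phi : T -> X) :
  @morphism k (induced_space phi) X phi.
Proof.
move=> U oU; split=> [|f rf]; first by exists U.
by move=> t Ut; exists U, f.
Qed.

Lemma morphism_to_induced X (T : Type) (phi : T -> X) Z (h : Z -> induced_space phi) :
  morphism (phi \o h : Z -> X) -> morphism h.
Proof.
move=> m _ [U oU ->]; have [oh _] := m U oU; split=> // f rf.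
apply: regular_local => // z Uz; have [V [g [oV Vz rg e]]] := rf _ Uz.
have [oV' rV'] := m V oV; exists ((phi \o h : Z -> X) @^-1` V), (g \o (phi \o h)).
by split=> //; [apply: rV' | move=> y Uy Vy; apply: e].
Qed.

Lemma subspace_val_morphism X (A : set X) : @morphism k (subspace A) X val.
Proof. exact: induced_morphism. Qed.

Lemma morphism_to_subspace X (A : set X) Z (h : Z -> subspace A) :
  morphism (fun z => val (h z) : X) -> morphism h.
Proof. exact: (@morphism_to_induced X A val Z h). Qed.

Definition corestrict X (A : set X) Z (h : Z -> X) (hA : forall z, A (h z)) :
  Z -> subspace A := fun z => SigSub (mem_set (hA z)).

Lemma corestrict_morphism X (A : set X) Z (h : Z -> X) (hA : forall z, A (h z)) :
  morphism h -> morphism (corestrict hA).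
Proof. by move=> mh; apply: morphism_to_subspace. Qed.

Lemma subspace_open X (A U : set X) : isopen U ->
  isopen ((val : subspace A -> X) @^-1` U).
Proof. by move=> oU; exists U. Qed.

Lemma subspace_closed X (A U : set X) : isclosed U ->
  isclosed ((val : subspace A -> X) @^-1` U).
Proof. exact: (morphism_closed (@subspace_val_morphism X A)). Qed.

Lemma isomorphic_sub X Y (A : set X) (B : set Y) (f : X -> Y) (g : Y -> X) :
  (forall x, A x -> B (f x)) -> (forall y, B y -> A (g y)) ->
  (forall x, A x -> g (f x) = x) -> (forall y, B y -> f (g y) = y) ->
  morphism (f \o val : subspace A -> Y) -> morphism (g \o val : subspace B -> X) ->
  isomorphic (subspace A) (subspace B).
Proof.
move=> fAB gBA fK gK mf mg.
have hf (a : subspace A) : B (f (val a)) by apply: fAB; apply: set_valP.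
have hg (b : subspace B) : A (g (val b)) by apply: gBA; apply: set_valP.
exists (corestrict hf), (corestrict hg); split; try exact: corestrict_morphism.
  by move=> a; apply: val_inj => /=; apply: fK; apply: set_valP.
by move=> b; apply: val_inj => /=; apply: gK; apply: set_valP.
Qed.

Lemma isomorphic_subspace_subspace X (A : set X) (B : set (subspace A)) (C : set X) :
  C `<=` A -> (forall a : subspace A, B a <-> C (val a)) ->
  isomorphic (subspace B) (subspace C).
Proof.
move=> CA BC.
have hf (b : subspace B) : C (val (val b)).
  by apply/BC; apply: set_valP.
have hA (c : subspace C) : A (val c) by apply: CA; apply: set_valP.
have hg (c : subspace C) : B (corestrict hA c).
  by apply/BC => /=; apply: set_valP.
exists (corestrict hf), (corestrict hg); split.
- apply: corestrict_morphism.
  by apply: (@morphism_comp _ (subspace A)); apply: subspace_val_morphism.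
- apply: corestrict_morphism; apply: corestrict_morphism.
  exact: subspace_val_morphism.
- by move=> b; apply: val_inj; apply: val_inj.
- by move=> c; apply: val_inj.
Qed.

Lemma isomorphic_subspaceT X : isomorphic (subspace (@setT X)) X.
Proof.
exists val, (@corestrict X setT X id (fun=> I)); split=> //.
- exact: subspace_val_morphism.
- by apply: corestrict_morphism; apply: morphism_id.
- by move=> x; apply: val_inj.
Qed.

(* In an arbitrary space with functions the zero set of a regular function need
   not be closed, nor the inverse of a nonvanishing regular function regular. *)
Definition inverts_regular X : Prop := forall (U : set X) f,
  isopen U -> regular U f ->
  isopen (U `&` [set x | f x != 0]) /\
  regular (U `&` [set x | f x != 0]) (fun x => (f x)^-1).

Section InvertsRegular.
Variable X : fspace k.
Hypothesis X_inv : inverts_regular X.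

Lemma nonzero_open (f : X -> k) : regular setT f -> isopen [set x | f x != 0].
Proof. by move=> rf; have [] := X_inv (isopenT _) rf; rewrite setTI. Qed.

Lemma zero_closed (f : X -> k) : regular setT f -> isclosed [set x | f x = 0].
Proof.
move=> /nonzero_open; congr isopen; apply/seteqP.
by split=> x /=; [move/eqP|move=> h; apply/eqP].
Qed.

Lemma regularV (f : X -> k) : (forall x, f x != 0) -> regular setT f ->
  regular setT (fun x => (f x)^-1).
Proof.
move=> f0 rf; have [_] := X_inv (isopenT _) rf; congr regular.
by apply/seteqP; split=> // x _; split=> //=; apply: f0.
Qed.

End InvertsRegular.

Lemma affine_regular_meval N (U : set (affine_space k N)) (p : {mpoly k[N]}) :
  regular U (fun x => p.@[x]).
Proof.
move=> x Ux; exists p, 1; rewrite rmorph1 oner_neq0; split=> // y _ _.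
by rewrite rmorph1 divr1.
Qed.

Lemma affine_regular_coord N (i : 'I_N) : regular (@setT (affine_space k N)) (fun x => x i).
Proof.
apply: (@regular_ext _ _ _ (fun x : affine_space k N => ('X_i : {mpoly k[N]}).@[x])).
- exact: isopenT.
- by move=> y _; rewrite mevalXU.
- exact: affine_regular_meval.
Qed.

Lemma affine_nonzero_open N (p : {mpoly k[N]}) :
  @isopen k (affine_space k N) [set x | p.@[x] != 0].
Proof.
exists [set p]; apply/seteqP; split=> x /=; first by move=> px; exists p.
by move=> [_ -> ].
Qed.

Lemma affine_inverts_regular N : inverts_regular (affine_space k N).
Proof.
move=> U f oU rf.
have loc x : U x -> f x != 0 -> exists p q : {mpoly k[N]},
    (p * q).@[x] != 0 /\ forall y, U y -> (p * q).@[y] != 0 -> f y = p.@[y] / q.@[y].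
  move=> Ux fx; have [p [q [qx fE]]] := rf x Ux; exists p, q; split.
    move: fx; rewrite fE // rmorphM mulf_eq0 negb_or /= => /andP[px _].
    by rewrite mulf_neq0.
  by move=> y Uy; rewrite rmorphM mulf_eq0 negb_or => /andP[_]; apply: fE.
split.
  apply: isopen_local => x [Ux fx]; have [p [q [pqx fE]]] := loc x Ux fx.
  exists (U `&` [set x | (p * q).@[x] != 0]); split=> //.
    by apply: isopenI => //; apply: affine_nonzero_open.
  move=> y [Uy pqy]; split=> //=; rewrite fE //.
  by move: pqy => /=; rewrite rmorphM mulf_eq0 negb_or => /andP[py qy]; rewrite mulf_neq0 ?invr_eq0.
move=> x [Ux fx]; have [p [q [pqx fE]]] := loc x Ux fx.
exists (q * q), (p * q); split=> // y [Uy fy] pqy; rewrite fE // !rmorphM /=.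
move: pqy; rewrite rmorphM mulf_eq0 negb_or => /andP[py qy] /=.
by rewrite invf_div -mulf_div divff // mulr1.
Qed.

(** Where [f] is nonzero, its local extension is nonzero at the point; shrinking the ambient open
    set makes the extension invertible there. *)
Lemma induced_inverts_regular X (T : Type) (phi : T -> X) :
  inverts_regular X -> inverts_regular (induced_space phi).
Proof.
move=> nX V f oV rf.
have loc t : V t -> f t != 0 -> exists U g, [/\ isopen U, U (phi t), regular U g,
    (forall y, U y -> g y != 0) & forall s, V s -> U (phi s) -> f s = g (phi s)].
  move=> Vt ft; have [U [g [oU Ut rg fg]]] := rf t Vt; have [oU' rg'] := nX U g oU rg.
  exists (U `&` [set x | g x != 0]), g; split=> //.
  - by split=> //=; rewrite -fg.
  - by apply: regular_res rg => // y [].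
  - by move=> y [].
  - by move=> s Vs [Us _]; apply: fg.
split.
  apply: isopen_local => t [Vt ft]; have [U [g [oU Ut rg g0 fg]]] := loc t Vt ft.
  exists (V `&` phi @^-1` U); split=> //.
    by apply: isopenI => //; exists U.
  by move=> s [Vs Us]; split=> //=; rewrite fg //; apply: g0.
move=> t [Vt ft]; have [U [g [oU Ut rg g0 fg]]] := loc t Vt ft.
exists U, (fun y => (g y)^-1); split=> //; last by move=> s [Vs fs] Us; rewrite fg.
have [_] := nX U g oU rg; congr (regular _ _).
by apply/seteqP; split=> [y [] //|y Uy]; split=> //=; apply: g0.
Qed.

Lemma subspace_inverts_regular X (A : set X) :
  inverts_regular X -> inverts_regular (subspace A).
Proof. exact: induced_inverts_regular. Qed.

(** Open sets and regular functions of a quotient are both tested after pull-back to [X]. *)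
Lemma quot_inverts_regular X (E : X -> set X) :
  inverts_regular X -> inverts_regular (quot_space E).
Proof. by move=> nX U f oU rf; exact: (nX _ _ oU rf). Qed.

Lemma isomorphic_inverts_regular X Y : isomorphic X Y ->
  inverts_regular X -> inverts_regular Y.
Proof.
move=> [f [g [mf mg fK gK]]] nX U h oU rh.
have [oV rV] := nX _ _ (morphism_open mf oU) (morphism_regular mf oU rh).
have e : g @^-1` ((f @^-1` U) `&` [set x | (h \o f) x != 0]) =
   U `&` [set x | h x != 0].
  by apply/seteqP; split=> y /=; rewrite gK.
split; first by rewrite -e; apply: morphism_open.
have := morphism_regular mg oV rV; rewrite e; apply: regular_ext.
  by rewrite -e; apply: morphism_open.
by move=> y _ /=; rewrite gK.
Qed.

(** Lets the property pass from affine charts to prevarieties, hence to the test objects in the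
    definition of products. *)
Lemma open_cover_inverts_regular X :
  (forall x, exists W : set X, [/\ isopen W, W x & inverts_regular (subspace W)]) ->
  inverts_regular X.
Proof.
move=> h U f oU rf.
have loc x : U x -> f x != 0 -> exists W, [/\ isopen W, W x,
    W `<=` U `&` [set x | f x != 0] & regular W (fun y => (f y)^-1)].
  move=> Ux fx; have [W [oW Wx nW]] := h x.
  have oUW := isopenI oU oW.
  have mv := @subspace_val_morphism X W.
  have [oV rV] := nW _ _ (morphism_open mv oU) (morphism_regular mv oU rf).
  have [V' [g [oV' Vx rg e]]] := rV (SigSub (mem_set Wx)) (conj Ux fx).
  move: oV => [V'' oV'' Ve].
  have Vy y (Wy : W y) : V'' y -> U y /\ f y != 0.
    move=> Vy; have : ((val : subspace W -> X) @^-1` V'') (SigSub (mem_set Wy)) by [].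
    by rewrite -Ve.
  exists (W `&` V'' `&` V'); split.
  - by do !apply: isopenI.
  - split=> //; split=> //.
    have : ((val : subspace W -> X) @^-1` U `&` [set x0 | (f \o val) x0 != 0])
      (SigSub (mem_set Wx)) by [].
    by rewrite Ve.
  - by move=> y [[Wy /(Vy _ Wy)]].
  - apply: (@regular_ext _ _ _ g); first by do !apply: isopenI.
      move=> y [[Wy Vy'' Vy']].
      by apply: (e (SigSub (mem_set Wy)) _ Vy'); apply: (Vy _ Wy).
    by apply: regular_res rg => //; do !apply: isopenI.
split.
  apply: isopen_local => x [Ux fx]; have [W [oW Wx WU _]] := loc x Ux fx.
  by exists W.
apply: reg_glue.
  apply: isopen_local => x [Ux fx]; have [W [oW Wx WU _]] := loc x Ux fx.
  by exists W.
move=> x [Ux fx]; have [W [oW Wx WU rW]] := loc x Ux fx.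
by exists W, (fun y => (f y)^-1); split.
Qed.

(** Inverting polynomials in the coordinates makes preimages of principal open sets open and pulls
    back fractions [p / q]; hence regular coordinates suffice. *)
Lemma morphism_to_affine Z N (h : Z -> affine_space k N) : inverts_regular Z ->
  (forall i, regular setT (fun z => h z i)) -> morphism h.
Proof.
move=> nZ rh U oU.
have rp (p : {mpoly k[N]}) : regular setT (fun z => p.@[h z]).
  by apply: regular_meval => //; apply: isopenT.
have oV : isopen (h @^-1` U).
  move: oU => [P UE]; apply: isopen_local => z.
  rewrite -[_ z]/(U (h z)) UE => -[p Pp pz].
  exists [set z | p.@[h z] != 0]; split=> //; first exact: nonzero_open.
  by move=> y py; exists p.
split=> // f rf; apply: regular_local => // z Uz; have [p [q [qz fE]]] := rf _ Uz.
have [oq rq] := nZ _ _ (isopenT _) (rp q).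
exists (setT `&` [set z | q.@[h z] != 0]), (fun y => p.@[h y] * (q.@[h y])^-1); split=> //.
  apply: regularM => //; apply: regular_res (rp p) => //; exact: isopenT.
by move=> y Uy [_ qy] /=; rewrite fE.
Qed.

Lemma morphism_to_induced_affine Z N (T : Type) (phi : T -> affine_space k N)
    (h : Z -> induced_space phi) : inverts_regular Z ->
  (forall i, regular setT (fun z => phi (h z) i)) -> morphism h.
Proof. by move=> nZ rh; apply: morphism_to_induced; apply: morphism_to_affine. Qed.

(** For spaces tested against affine ones this implies separatedness and is easier to check; for the
    two quotients it is proved with explicit invariant functions. *)
Definition regular_separated X : Prop := forall x y : X,
  (forall f : X -> k, regular setT f -> f x = f y) -> x = y.

Lemma equalizer_closed X Z (f g : Z -> X) : inverts_regular Z ->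
  regular_separated X -> morphism f -> morphism g -> isclosed [set z | f z = g z].
Proof.
move=> nZ sX mf mg; apply: isopen_local => z /= fgz.
have [h [rh hz]] : exists h : X -> k, regular setT h /\ h (f z) <> h (g z).
  apply: contrapT => nh; apply: fgz; apply: sX => h rh; apply: contrapT => hz.
  by apply: nh; exists h.
exists [set y | h (f y) - h (g y) != 0]; split=> /=.
- apply: nonzero_open => //; apply: regularB; first exact: isopenT.
    exact: (morphism_regularT mf).
  exact: (morphism_regularT mg).
- by rewrite subr_eq0; apply/eqP.
- by move=> y /=; rewrite subr_eq0 => /eqP hy e; apply: hy; rewrite e.
Qed.

Lemma regular_separated_inj X Y (f : X -> Y) : morphism f -> injective f ->
  regular_separated Y -> regular_separated X.
Proof.
move=> mf injf sY x y h; apply: injf; apply: sY => g rg.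
exact: (h (g \o f) (morphism_regularT mf rg)).
Qed.

Lemma affine_regular_separated N : regular_separated (affine_space k N).
Proof.
by move=> x y h; apply/funext => i; apply: (h (fun x => x i)); apply: affine_regular_coord.
Qed.

Lemma subspace_regular_separated X (A : set X) :
  regular_separated X -> regular_separated (subspace A).
Proof.
by apply: regular_separated_inj; [apply: subspace_val_morphism | apply: val_inj].
Qed.

(** * Affine spaces with functions *)

Lemma isomorphic_affine X Y : isomorphic X Y -> is_affine X -> is_affine Y.
Proof.
move=> XY [N [P XP]]; exists N, P; apply: isomorphic_trans XP.
exact: isomorphic_sym.
Qed.

Lemma affine_space_affine N : is_affine (affine_space k N).
Proof.
exists N, set0; apply: isomorphic_sym.
have -> : [set x : affine_space k N | forall p : {mpoly k[N]}, set0 p -> p.@[x] = 0] = setT.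
  by apply/seteqP; split=> // x _ p [].
exact: isomorphic_subspaceT.
Qed.

Lemma closed_subset_affine N (Z : set (affine_space k N)) : isclosed Z ->
  is_affine (subspace Z).
Proof.
move=> [P ZE]; exists N, P.
have -> : [set x : affine_space k N | forall p : {mpoly k[N]}, P p -> p.@[x] = 0] = Z.
  apply/seteqP; split=> x /=.
    move=> h; apply: contrapT => nZ; have : (~` Z) x by [].
    by rewrite ZE => -[p /h ->]; rewrite eqxx.
  move=> Zx p Pp; apply/eqP; apply: contrapT => /negP px.
  by have : (~` Z) x by [rewrite ZE; exists p].
exact: isomorphic_refl.
Qed.

Lemma polynomial_set_closed N (P : set {mpoly k[N]}) :
  @isclosed k (affine_space k N) [set x | forall p, P p -> p.@[x] = 0].
Proof.
exists P; apply/seteqP; split=> x /=.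
  move=> h; apply: contrapT => nh; apply: h => p Pp; apply/eqP; apply: contrapT => /negP px.
  by apply: nh; exists p.
by move=> [p Pp px] /(_ p Pp) e; rewrite e eqxx in px.
Qed.

Lemma affine_inverts X : is_affine X -> inverts_regular X.
Proof.
move=> [N [P /isomorphic_sym /isomorphic_inverts_regular]]; apply.
by apply: subspace_inverts_regular; apply: affine_inverts_regular.
Qed.

Lemma affine_separated X : is_affine X -> regular_separated X.
Proof.
move=> [N [P [f [g [mf mg fK gK]]]]]; apply: (regular_separated_inj mf (can_inj fK)).
by apply: subspace_regular_separated; apply: affine_regular_separated.
Qed.

Lemma isclosedI X (A B : set X) : isclosed A -> isclosed B -> isclosed (A `&` B).
Proof. by move=> cA cB; rewrite /isclosed setCI; apply: isopenU. Qed.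

Lemma closed_subspace_affine X (A : set X) : is_affine X -> isclosed A ->
  is_affine (subspace A).
Proof.
move=> [N [P [f [g [mf mg fK gK]]]]] cA.
set Z := [set x : affine_space k N | _] in f g mf mg fK gK.
have [V oV VE] := morphism_open mg cA.
have VA (z : subspace Z) : V (val z) <-> ~ A (g z).
  by rewrite -[V _]/((val @^-1` V) z) -VE.
pose B := Z `&` ~` V.
have cB : isclosed B.
  apply: isclosedI; first exact: polynomial_set_closed.
  by rewrite /isclosed setCK.
apply: isomorphic_affine (closed_subset_affine cB).
have hA (b : subspace B) : Z (val b) by have [] := set_valP b.
have hA' (b : subspace B) : A (g (corestrict hA b)).
  have [_ nV] := set_valP b; apply: contrapT => nA; apply: nV.
  exact: (proj2 (VA (corestrict hA b)) nA).
have hB (a : subspace A) : B (val (f (val a))).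
  split; first exact: set_valP.
  move=> /VA; rewrite fK; apply; exact: set_valP.
exists (corestrict hA'), (corestrict hB); split.
- apply: corestrict_morphism; apply: (@morphism_comp _ (subspace Z)) => //.
  by apply: corestrict_morphism; apply: subspace_val_morphism.
- apply: corestrict_morphism; apply: (@morphism_comp _ (subspace Z)); last first.
    exact: subspace_val_morphism.
  by apply: (morphism_comp _ mf); apply: subspace_val_morphism.
- move=> b; apply: val_inj => /=.
  by rewrite gK.
- move=> a; apply: val_inj => /=.
  rewrite -[RHS]fK; congr g; exact: val_inj.
Qed.

(* Rabinowitsch's trick: the nonvanishing locus of [f] is the closed set
   [f x * y = 1] in [X * k]. *)
Lemma nonzero_subspace_affine X (f : X -> k) : is_affine X -> regular setT f ->
  is_affine (subspace [set x | f x != 0]).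
Proof.
move=> aX rf; have nX := affine_inverts aX.
move: (aX) => [N [P [a [b [ma mb aK bK]]]]].
set Z := [set x : affine_space k N | _] in a b ma mb aK bK.
pose pr (x : affine_space k N.+1) : affine_space k N := fun i => x (lift ord0 i).
have mpr : morphism pr.
  apply: morphism_to_affine => [|i]; first exact: affine_inverts_regular.
  exact: affine_regular_coord.
pose W := pr @^-1` Z.
have cW : isclosed W by exact: (morphism_closed mpr (@polynomial_set_closed _ _)).
have aW : is_affine (subspace W) by exact: closed_subset_affine.
have hW (w : subspace W) : Z (pr (val w)) by exact: (set_valP w).
have mW : morphism (corestrict hW).
  apply: corestrict_morphism; apply: (morphism_comp _ mpr).
  exact: subspace_val_morphism.
pose F (w : subspace W) := val w ord0 * f (b (corestrict hW w)) - 1.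
have rF : regular setT F.
  apply: regularB; [exact: isopenT| |apply: regular_cst; exact: isopenT].
  apply: regularM; first exact: isopenT.
    exact: (morphism_regularT (@subspace_val_morphism _ W) (affine_regular_coord ord0)).
  exact: (morphism_regularT (morphism_comp mW mb) rf).
have aG : is_affine (subspace [set w | F w = 0]).
  by apply: closed_subspace_affine => //; apply: zero_closed => //; apply: affine_inverts.
apply: isomorphic_affine aG.
have hf (g : subspace [set w | F w = 0]) : f (b (corestrict hW (val g))) != 0.
  have /eqP := set_valP g; rewrite subr_eq0; apply: contraTneq => ->.
  by rewrite mulr0 eq_sym oner_eq0.
pose D := subspace [set x | f x != 0].
pose c (d : D) : affine_space k N.+1 :=
  fun i => if unlift ord0 i is Some j then val (a (val d)) j else (f (val d))^-1.
have prc d : pr (c d) = val (a (val d)).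
  by apply/funext => i; rewrite /pr /c liftK.
have hc d : W (c d) by rewrite /W /= prc; apply: set_valP.
have bc d : b (corestrict hW (corestrict hc d)) = val d.
  by rewrite -[RHS]aK; congr b; apply: val_inj => /=; rewrite prc.
have hc' d : F (corestrict hc d) = 0.
  have fd : f (val d) != 0 by apply: (set_valP d).
  by rewrite /F bc /= /c unlift_none mulVf // subrr.
have nD : inverts_regular D by apply: subspace_inverts_regular.
exists (corestrict hf), (corestrict hc'); split.
- apply: corestrict_morphism; apply: (morphism_comp _ mb); apply: (morphism_comp _ mW).
  exact: subspace_val_morphism.
- apply: corestrict_morphism; apply: corestrict_morphism.
  apply: morphism_to_affine => // i; rewrite /c; case: (unlift ord0 i) => [j|].
    have m : @morphism k D (affine_space k N) (fun d => val (a (val d))).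
      apply: (@morphism_comp _ (subspace Z)); last exact: subspace_val_morphism.
      by apply: (morphism_comp _ ma); apply: subspace_val_morphism.
    exact: (morphism_regularT m (affine_regular_coord j)).
  apply: regularV => //; first by move=> d; apply: (set_valP d).
  exact: (morphism_regularT (@subspace_val_morphism _ _) rf).
- move=> g; apply: val_inj; apply: val_inj; apply/funext => i /=.
  rewrite /c; case: unliftP => [j ->|->] /=.
    by rewrite bK.
  have fg := hf g; have /eqP := set_valP g; rewrite subr_eq0 => /eqP e.
  by rewrite -[RHS](mulfK fg) e mul1r.
- by move=> d; apply: val_inj => /=; apply: bc.
Qed.

Lemma regular_separated_is_separated X : regular_separated X -> is_separated X.
Proof.
by move=> sX Z f g /affine_inverts nZ mf mg; apply: equalizer_closed.
Qed.

End SpacesWithFunctions.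

(** * Varieties *)

Section Varieties.
Variable k : fieldType.
Implicit Types X Y Z P : fspace k.

Lemma separated_inj X Y (f : X -> Y) : morphism f -> injective f ->
  is_separated Y -> is_separated X.
Proof.
move=> mf injf sY Z a b aZ ma mb.
have := sY Z (f \o a) (f \o b) aZ (morphism_comp ma mf) (morphism_comp mb mf).
congr isclosed; apply/seteqP; split=> z /=; first exact: injf.
by move=> ->.
Qed.

Lemma isomorphic_prevariety X Y : isomorphic X Y -> is_prevariety X -> is_prevariety Y.
Proof.
move=> [f [g [mf mg fK gK]]] [s [U [aU cU]]].
exists s, (fun i => g @^-1` U i); split=> [i|y]; last exact: (cU (g y)).
have [oU afU] := aU i; split; first exact: (morphism_open mg oU).
apply: isomorphic_affine afU; apply: (@isomorphic_sub _ _ _ _ _ f g) => //.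
- by move=> x Ux; rewrite /= fK.
- by apply: (morphism_comp _ mf); apply: subspace_val_morphism.
- by apply: (morphism_comp _ mg); apply: subspace_val_morphism.
Qed.

Lemma isomorphic_variety X Y : isomorphic X Y -> is_variety X -> is_variety Y.
Proof.
move=> XY [pX sX]; split; first exact: isomorphic_prevariety pX.
by have [f [g [mf mg fK gK]]] := XY; apply: (separated_inj mg (can_inj gK)).
Qed.

Lemma prevariety_inverts X : is_prevariety X -> inverts_regular X.
Proof.
move=> [s [U [aU cU]]]; apply: open_cover_inverts_regular => x.
have [i Ux] := cU x; have [oU afU] := aU i; exists (U i); split=> //.
exact: affine_inverts.
Qed.

Lemma prevariety_fin X (I : finType) (U : I -> set X) :
  (forall i, isopen (U i)) -> (forall i, is_affine (subspace (U i))) ->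
  (forall x, exists i, U i x) -> is_prevariety X.
Proof.
move=> oU aU cU; exists #|I|, (fun i => U (enum_val i)); split=> // x.
by have [i Ux] := cU x; exists (enum_rank i); rewrite enum_rankK.
Qed.

Lemma affine_variety X : is_affine X -> is_variety X.
Proof.
move=> aX; split; last by apply: regular_separated_is_separated; apply: affine_separated.
apply: (@prevariety_fin _ unit (fun=> setT)) => [_|_|x]; first exact: isopenT.
  by apply: isomorphic_affine aX; apply: isomorphic_sym; apply: isomorphic_subspaceT.
by exists tt.
Qed.

Lemma isomorphic_subspaceI X (A U : set X) :
  isomorphic (subspace ((val : subspace A -> X) @^-1` U)) (subspace (A `&` U)).
Proof.
apply: isomorphic_subspace_subspace => [x []|a] //.
split=> [Ua|[]//]; split=> //; exact: (set_valP a).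
Qed.

Lemma closed_open_affine X (A U : set X) : isclosed A -> is_affine (subspace U) ->
  is_affine (subspace (A `&` U)).
Proof.
move=> cA aU; rewrite setIC; apply: isomorphic_affine (isomorphic_subspaceI _ _) _.
by apply: closed_subspace_affine => //; apply: subspace_closed.
Qed.

Lemma closed_subspace_variety X (A : set X) : is_variety X -> isclosed A ->
  is_variety (subspace A).
Proof.
move=> [[s [U [aU cU]]] sX] cA; split; last first.
  by apply: separated_inj sX; [apply: subspace_val_morphism | apply: val_inj].
exists s, (fun i => (val : subspace A -> X) @^-1` U i); split=> [i|a]; last exact: (cU (val a)).
have [oU afU] := aU i; split; first exact: subspace_open.
apply: isomorphic_affine (closed_open_affine cA afU).
by apply: isomorphic_sym; apply: isomorphic_subspaceI.
Qed.

Lemma nonzero_subsetI_affine X (A : set X) (f : X -> k) : is_affine (subspace A) ->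
  regular setT (f \o val : subspace A -> k) ->
  is_affine (subspace (A `&` [set x | f x != 0])).
Proof.
move=> aA rf; apply: isomorphic_affine (isomorphic_subspaceI _ _) _.
exact: (nonzero_subspace_affine aA rf).
Qed.

(** The universal property quantifies over all varieties [Z]. As these invert regular functions, it
    reduces to one pairing [mk] that is inverse to the projections and preserves morphisms. *)
Lemma product_criterion X Y P (p1 : P -> X) (p2 : P -> Y) (mk : X -> Y -> P) :
  morphism p1 -> morphism p2 ->
  (forall x y, p1 (mk x y) = x) -> (forall x y, p2 (mk x y) = y) ->
  (forall z, mk (p1 z) (p2 z) = z) ->
  (forall Z (f : Z -> X) (g : Z -> Y), inverts_regular Z -> morphism f -> morphism g ->
     morphism (fun z => mk (f z) (g z))) ->
  is_product X Y P.
Proof.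
move=> m1 m2 K1 K2 K mmk; exists p1, p2; split=> // Z f g [pZ _] mf mg.
exists (fun z => mk (f z) (g z)); split.
  split; first by apply: mmk => //; apply: prevariety_inverts.
    by apply/funext => z /=; rewrite K1.
  by apply/funext => z /=; rewrite K2.
by move=> h [_ <- <-]; apply/funext => z /=; rewrite K.
Qed.

Lemma isomorphic_product X Y P X' Y' P' :
  isomorphic X X' -> isomorphic Y Y' -> isomorphic P P' ->
  is_product X Y P -> is_product X' Y' P'.
Proof.
move=> [f [f' [mf mf' fK fK']]] [g [g' [mg mg' gK gK']]] [h [h' [mh mh' hK hK']]].
move=> [p1 [p2 [m1 m2 univ]]]; exists (f \o p1 \o h'), (g \o p2 \o h'); split.
- exact: (morphism_comp (morphism_comp mh' m1) mf).
- exact: (morphism_comp (morphism_comp mh' m2) mg).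
move=> Z a b vZ ma mb.
have [u [[mu u1 u2] uu]] := univ Z (f' \o a) (g' \o b) vZ
  (morphism_comp ma mf') (morphism_comp mb mg').
exists (h \o u); split.
  split; first exact: morphism_comp.
    apply/funext => z /=; rewrite hK -[RHS]fK'; congr f.
    exact: (congr1 (fun F => F z) u1).
  apply/funext => z /=; rewrite hK -[RHS]gK'; congr g.
  exact: (congr1 (fun F => F z) u2).
move=> v [mv v1 v2].
have -> : u = h' \o v; last by apply/funext => z /=; rewrite hK'.
apply: uu; split; first exact: morphism_comp.
  by rewrite -v1; apply/funext => z /=; rewrite fK.
by rewrite -v2; apply/funext => z /=; rewrite gK.
Qed.

Definition seq_embeds X : Prop := exists f : X -> seq k, injective f.

Lemma seq_embeds_inj X Y (f : X -> Y) : injective f -> seq_embeds Y -> seq_embeds X.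
Proof. by move=> fI [g gI]; exists (g \o f); apply: inj_comp. Qed.

Lemma affine_space_seq_embeds N : seq_embeds (affine_space k N).
Proof.
exists (fun x => val [tuple x i | i < N]) => x y /val_inj e.
by apply/funext => i; rewrite -(tnth_mktuple x i) e tnth_mktuple.
Qed.

(** The embedding is carried along because the generators of [K0] have their points in [seq k]; the
    two conditions together produce a generator isomorphic to [X]. *)
Definition small_variety X : Prop := is_variety X /\ seq_embeds X.

Lemma affine_small_variety X : is_affine X -> small_variety X.
Proof.
move=> aX; split; first exact: affine_variety.
move: aX => [N [P [f [g [_ _ fK _]]]]]; apply: seq_embeds_inj (can_inj fK) _.
exact: (@seq_embeds_inj (subspace _) (affine_space k N) val val_inj (affine_space_seq_embeds N)).
Qed.

Lemma isomorphic_small X Y : isomorphic X Y -> small_variety X -> small_variety Y.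
Proof.
move=> XY [vX eX]; split; first exact: isomorphic_variety vX.
by have [f [g [_ _ _ gK]]] := XY; apply: seq_embeds_inj (can_inj gK) eX.
Qed.

Lemma closed_subspace_small X (A : set X) : small_variety X -> isclosed A ->
  small_variety (subspace A).
Proof.
move=> [vX eX] cA; split; first exact: closed_subspace_variety.
exact: (@seq_embeds_inj (subspace A) X val val_inj eX).
Qed.

Lemma small_variety_svariety X : small_variety X ->
  exists S : svariety k, isomorphic (sspace S) X.
Proof.
move=> [vX [f fI]].
(* The structure is transported along the bijection of [X] with the range of the injection [f]; [b]
   inverts [f] on that range. *)
have hb (s : range f) : exists x, f x = val s by have [x _ e] := set_valP s; exists x.
pose b (s : range f) : X := projT1 (cid (hb s)).
have bE s : f (b s) = val s by rewrite /b; case: cid.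
pose a (x : X) : range f := SigSub (mem_set (imageT f x)).
have aK : cancel a b by move=> x; apply: fI; rewrite bE.
have bK : cancel b a by move=> s; apply: val_inj; rewrite /= bE.
have ab : isomorphic (induced_space b) X.
  exists b, a; split=> //; first exact: induced_morphism.
  apply: morphism_to_induced; have -> : b \o a = id by apply/funext.
  exact: morphism_id.
have vS : is_variety (FSpace (induced_struct b)).
  by apply: isomorphic_variety vX; apply: isomorphic_sym.
by exists (SVariety vS).
Qed.

End Varieties.

(** * Classes in the Grothendieck ring *)

Section Classes.
Variable k : fieldType.
Implicit Types X Y Z P E M F : fspace k.

Local Notation cl := (\pi_{eq_quot (@K0eqb k)}%qT : K0term k -> K0 k).

Lemma K0class_iso X Y : isomorphic X Y -> K0class X = K0class Y.
Proof.
move=> XY; congr xget; apply/seteqP.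
split=> a [S SX ->]; exists S => //; first exact: isomorphic_trans XY.
by apply: isomorphic_trans SX (isomorphic_sym XY).
Qed.

(** [K0class] selects some generator, and isomorphic generators agree in [K0], so any model computes
    it. *)
Lemma K0class_gen X (S : svariety k) : isomorphic (sspace S) X ->
  K0class X = cl (KGen S).
Proof.
move=> SX; rewrite /K0class; case: xgetP => [_ -> [S' S'X ->]|/(_ (cl (KGen S)))[]].
  apply/K0P; apply: K0eq_iso; apply: isomorphic_trans S'X _.
  exact: isomorphic_sym.
by exists S.
Qed.

Lemma K0class_scissor X (A : set X) : small_variety X -> isclosed A ->
  small_variety (subspace A) -> small_variety (subspace (~` A)) ->
  K0class X = K0class (subspace A) + K0class (subspace (~` A)).
Proof.
move=> /small_variety_svariety[S SX] cA /small_variety_svariety[T TA].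
move=> /small_variety_svariety[V VA].
rewrite (K0class_gen SX) (K0class_gen TA) (K0class_gen VA).
transitivity (cl (KAdd (KGen T) (KGen V))); last exact/esym/K0addE.
have [f [g [mf mg fK gK]]] := SX.
apply/K0P; apply: (@K0eq_scissor _ _ _ _ (f @^-1` A)).
- exact: (morphism_closed mf).
- apply: (isomorphic_trans TA); apply: (@isomorphic_sub _ _ _ _ _ g f) => //.
  + by move=> x Ax; rewrite /= gK.
  + by apply: (morphism_comp _ mg); apply: subspace_val_morphism.
  + by apply: (morphism_comp _ mf); apply: subspace_val_morphism.
- apply: (isomorphic_trans VA); apply: (@isomorphic_sub _ _ _ _ _ g f) => //.
  + by move=> x Ax; rewrite /= gK.
  + by apply: (morphism_comp _ mg); apply: subspace_val_morphism.
  + by apply: (morphism_comp _ mf); apply: subspace_val_morphism.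
Qed.

Lemma K0class_product X Y P : small_variety X -> small_variety Y ->
  small_variety P -> is_product X Y P -> K0class P = K0class X * K0class Y.
Proof.
move=> /small_variety_svariety[S SX] /small_variety_svariety[T TY].
move=> /small_variety_svariety[V VP] pr.
rewrite (K0class_gen SX) (K0class_gen TY) (K0class_gen VP).
transitivity (cl (KMul (KGen S) (KGen T))); last exact/esym/K0mulE.
apply/K0P; apply: K0eq_prod.
by apply: isomorphic_product pr; apply: isomorphic_sym.
Qed.

Lemma K0class_point : K0class (affine_space k 0) = 1.
Proof.
have [S SX] := small_variety_svariety (affine_small_variety (affine_space_affine k 0)).
by rewrite (K0class_gen SX); apply/K0P; apply: K0eq_point.
Qed.

(** Both pieces of the scissor relation along the whole space are empty, hence isomorphic to [X]:
    [X] = [X] + [X]. *)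
Lemma K0class_empty X : small_variety X -> (X -> False) -> K0class X = 0.
Proof.
move=> sX nX.
have iX (A : set X) : isomorphic (subspace A) X.
  exists val, (@corestrict _ X A X id (fun x => False_ind _ (nX x))); split.
  - exact: subspace_val_morphism.
  - by apply: corestrict_morphism; apply: morphism_id.
  - by move=> x; case: (nX (val x)).
  - by move=> x; case: (nX x).
have := @K0class_scissor X setT sX; rewrite !(K0class_iso (iX _)).
have cT : isclosed (@setT X) by rewrite /isclosed setCT; apply: isopen0.
move=> /(_ cT (isomorphic_small (isomorphic_sym (iX _)) sX)
               (isomorphic_small (isomorphic_sym (iX _)) sX)).
by rewrite -[LHS]addr0 => /addrI.
Qed.

(** Removes one chart: the part of [A] outside [U] stays closed and the part inside is affine, so
    both pieces are varieties. *)
Lemma K0class_split X (A U : set X) : small_variety X -> isclosed A -> isopen U ->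
  is_affine (subspace U) ->
  K0class (subspace A) = K0class (subspace (A `&` ~` U)) + K0class (subspace (A `&` U)).
Proof.
move=> sX cA oU aU.
have sA := closed_subspace_small sX cA.
have cU : isclosed (~` U) by rewrite /isclosed setCK.
have sC : small_variety (subspace (A `&` ~` U)).
  by apply: closed_subspace_small => //; apply: isclosedI.
have sU : small_variety (subspace (A `&` U)).
  by apply: affine_small_variety; apply: closed_open_affine.
have i1 := isomorphic_subspaceI A (~` U); have i2 := isomorphic_subspaceI A U.
have e : (val : subspace A -> X) @^-1` U = ~` ((val : subspace A -> X) @^-1` (~` U)).
  by rewrite -preimage_setC setCK.
rewrite e in i2.
rewrite (K0class_scissor sA (subspace_closed A cU)).
- by rewrite (K0class_iso i1) (K0class_iso i2).
- exact: isomorphic_small (isomorphic_sym i1) sC.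
- exact: isomorphic_small (isomorphic_sym i2) sU.
Qed.

(* [p] restricted to the preimage of [U] is the projection of a product with
   fibre [F]; the values of [t] and [mk] off [U] are irrelevant. *)
Definition trivial_over E M F (p : E -> M) (U : set M) : Prop :=
  exists (t : E -> F) (mk : F -> M -> E),
  [/\ morphism (t \o val : subspace (p @^-1` U) -> F),
      forall e, U (p e) -> mk (t e) (p e) = e,
      forall a x, U x -> p (mk a x) = x,
      forall a x, U x -> t (mk a x) = a
    & forall Z (f : Z -> F) (g : Z -> M), inverts_regular Z -> morphism f ->
        morphism g -> (forall z, U (g z)) -> morphism (fun z => mk (f z) (g z))].

Lemma trivial_over_product E M F (p : E -> M) (U A : set M) :
  morphism p -> trivial_over F p U -> A `<=` U ->
  is_product F (subspace A) (subspace (p @^-1` A)).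
Proof.
move=> mp [t [mk [mt mkK pmk tmk mmk]]] AU.
have h2 (e : subspace (p @^-1` A)) : A (p (val e)) by exact: (set_valP e).
have hm (a : F) (x : subspace A) : A (p (mk a (val x))).
  have Ax := set_valP x; rewrite pmk; [exact: Ax | exact: AU].
apply: (@product_criterion k F (subspace A) (subspace (p @^-1` A)) (t \o val) (corestrict h2)
  (fun a x => SigSub (mem_set (hm a x)))).
- have hU (e : subspace (p @^-1` A)) : (p @^-1` U) (val e) by apply: AU; apply: h2.
  have mc : morphism (corestrict hU).
    by apply: corestrict_morphism; apply: subspace_val_morphism.
  exact: (morphism_comp mc mt).
- apply: corestrict_morphism; apply: (morphism_comp _ mp).
  exact: subspace_val_morphism.
- by move=> a x /=; apply: tmk; apply: AU; apply: (set_valP x).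
- by move=> a x; apply: val_inj => /=; apply: pmk; apply: AU; apply: (set_valP x).
- by move=> e; apply: val_inj => /=; apply: mkK; apply: AU; apply: h2.
- move=> Z f g nZ mf mg; apply: morphism_to_subspace => /=.
  apply: (mmk Z f (fun z => val (g z))) => //.
    by apply: (morphism_comp mg); apply: subspace_val_morphism.
  by move=> z; apply: AU; apply: (set_valP (g z)).
Qed.

Lemma K0class_fibration E M F (p : E -> M) (I : finType) (U : I -> set M) :
  small_variety E -> small_variety M -> small_variety F -> morphism p ->
  (forall x, exists i, U i x) -> (forall i, isopen (U i)) ->
  (forall i, is_affine (subspace (U i))) ->
  (forall i, is_affine (subspace (p @^-1` U i))) ->
  (forall i, trivial_over F p (U i)) ->
  K0class E = K0class F * K0class M.
Proof.
move=> sE sM sF mp cU oU aU aV tU.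
(* Induction on the charts that cover a closed [A]: over the first chart the preimage is a product,
   and the rest of [A] is closed and covered by the remaining charts. *)
have claim (l : seq I) : forall A : set M, isclosed A ->
    (forall x, A x -> exists2 i, i \in l & U i x) ->
    K0class (subspace (p @^-1` A)) = K0class F * K0class (subspace A).
  elim: l => [|i l IHl] A cA lA.
    have nA (x : subspace A) : False by have [] := lA _ (set_valP x).
    have nE (x : subspace (p @^-1` A)) : False.
      by have [] := lA (p (val x)) (set_valP x).
    rewrite (K0class_empty (closed_subspace_small sM cA) nA) mulr0.
    exact: (K0class_empty (closed_subspace_small sE (morphism_closed mp cA)) nE).
  rewrite (K0class_split sM cA (oU i) (aU i)).
  rewrite (K0class_split sE (morphism_closed mp cA) (morphism_open mp (oU i)) (aV i)).
  have eC : K0class (subspace (p @^-1` (A `&` ~` U i))) =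
      K0class F * K0class (subspace (A `&` ~` U i)).
    apply: IHl => [|x [Ax nUx]].
      by apply: isclosedI => //; rewrite /isclosed setCK.
    have [j] := lA x Ax; rewrite inE => /orP[/eqP -> //|jl Ux].
    by exists j.
  rewrite mulrDr -eC; congr (_ + _); apply: K0class_product => //.
  - by apply: affine_small_variety; apply: closed_open_affine.
  - apply: affine_small_variety; apply: closed_open_affine (aV i).
    exact: (morphism_closed mp).
  - by apply: (@trivial_over_product E M F p (U i) (A `&` U i)) => // x [].
have cT : isclosed (@setT M) by rewrite /isclosed setCT; apply: isopen0.
have := claim (enum I) setT cT.
rewrite preimage_setT !(K0class_iso (isomorphic_subspaceT _)); apply.
by move=> x _; have [i Ux] := cU x; exists i => //; rewrite mem_enum.
Qed.

End Classes.

(** * Regular matrix-valued functions *)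

Section RegularMatrices.
Variable k : fieldType.
Implicit Types X Y Z : fspace k.

Definition regular_mx X (m n : nat) (F : X -> 'M[k]_(m, n)) : Prop :=
  forall i j, regular setT (fun x => F x i j).

Lemma regular_eqT X (f g : X -> k) : (forall x, f x = g x) ->
  regular setT g -> regular setT f.
Proof. by move=> fg; apply: regular_ext => //; apply: isopenT. Qed.

Lemma regular_mx_eq X m n (F G : X -> 'M[k]_(m, n)) : (forall x, F x = G x) ->
  regular_mx G -> regular_mx F.
Proof. by move=> FG rG i j; apply: regular_eqT (rG i j) => x; rewrite FG. Qed.

Lemma regular_mx_cst X m n (A : 'M[k]_(m, n)) : regular_mx (fun _ : X => A).
Proof. by move=> i j; apply: regular_cst; apply: isopenT. Qed.

Lemma regular_mxD X m n (F G : X -> 'M[k]_(m, n)) : regular_mx F -> regular_mx G ->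
  regular_mx (fun x => F x + G x).
Proof.
move=> rF rG i j; apply: (@regular_eqT _ _ (fun x => F x i j + G x i j)).
  by move=> x; rewrite mxE.
by apply: regularD => //; apply: isopenT.
Qed.

Lemma regular_mxB X m n (F G : X -> 'M[k]_(m, n)) : regular_mx F -> regular_mx G ->
  regular_mx (fun x => F x - G x).
Proof.
move=> rF rG i j; apply: (@regular_eqT _ _ (fun x => F x i j - G x i j)).
  by move=> x; rewrite !mxE.
by apply: regularB => //; apply: isopenT.
Qed.

Lemma regular_mxZ X m n f (F : X -> 'M[k]_(m, n)) : regular setT f -> regular_mx F ->
  regular_mx (fun x => f x *: F x).
Proof.
move=> rf rF i j; apply: (@regular_eqT _ _ (fun x => f x * F x i j)).
  by move=> x; rewrite mxE.
by apply: regularM => //; apply: isopenT.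
Qed.

Lemma regular_mxM X m n p (F : X -> 'M[k]_(m, n)) (G : X -> 'M[k]_(n, p)) :
  regular_mx F -> regular_mx G -> regular_mx (fun x => F x *m G x).
Proof.
move=> rF rG i j; apply: (@regular_eqT _ _ (fun x => \sum_l F x i l * G x l j)).
  by move=> x; rewrite mxE.
apply: regular_sum => [|l]; first exact: isopenT.
by apply: regularM => //; apply: isopenT.
Qed.

Lemma regular_mx_sum X m n (I : Type) (s : seq I) (F : I -> X -> 'M[k]_(m, n)) :
  (forall i, regular_mx (F i)) -> regular_mx (fun x => \sum_(i <- s) F i x).
Proof.
move=> rF i j; apply: (@regular_eqT _ _ (fun x => \sum_(l <- s) F l x i j)).
  by move=> x; rewrite summxE.
by apply: regular_sum => [|l]; [exact: isopenT | apply: rF].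
Qed.

Lemma regular_mxX X n (F : X -> 'M[k]_n) e :
  regular_mx F -> regular_mx (fun x => F x ^+ e).
Proof.
move=> rF; elim: e => [|e IHe]; first exact: regular_mx_cst.
by apply: (@regular_mx_eq _ _ _ _ (fun x => F x *m F x ^+ e)) (regular_mxM rF IHe) => x; rewrite exprS.
Qed.

Lemma regular_trace X n (F : X -> 'M[k]_n) : regular_mx F ->
  regular setT (fun x => \tr (F x)).
Proof. by move=> rF; apply: regular_sum => [|i]; [exact: isopenT | apply: rF]. Qed.

Lemma regular_det X n (F : X -> 'M[k]_n) : regular_mx F ->
  regular setT (fun x => \det (F x)).
Proof.
move=> rF; have oT := isopenT X; apply: regular_sum => // s.
apply: regularM => //; first exact: regular_cst.
by apply: regular_prod.
Qed.

Lemma regular_invmx X n (F : X -> 'M[k]_n) : inverts_regular X ->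
  (forall x, F x \in unitmx) -> regular_mx F -> regular_mx (fun x => invmx (F x)).
Proof.
move=> nX uF rF.
apply: (@regular_mx_eq _ _ _ _ (fun x => (\det (F x))^-1 *: \adj (F x))).
  by move=> x; rewrite /invmx uF.
apply: regular_mxZ.
  apply: regularV => //; last exact: regular_det.
  by move=> x; have := uF x; rewrite unitmxE unitfE.
move=> i j; apply: (@regular_eqT _ _
  (fun x => (-1) ^+ (j + i) * \det (row' j (col' i (F x))))).
  by move=> x; rewrite mxE.
apply: regularM; [exact: isopenT|by apply: regular_cst; apply: isopenT|].
apply: regular_det => a b.
by apply: regular_eqT (rF (lift j a) (lift i b)) => x; rewrite !mxE.
Qed.

Lemma regular_mx_comp X Y m n (h : X -> Y) (F : Y -> 'M[k]_(m, n)) :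
  morphism h -> regular_mx F -> regular_mx (fun x => F (h x)).
Proof. by move=> mh rF i j; apply: (morphism_regularT mh (rF i j)). Qed.

Definition matrix_space (m n : nat) : fspace k :=
  @induced_space k (affine_space k (m * n)) 'M[k]_(m, n) (fun A i => mxvec A 0 i).

Lemma matrix_space_coord m n : regular_mx (fun A : matrix_space m n => (A : 'M[k]_(m, n))).
Proof.
move=> i j; have rc := @affine_regular_coord k _ (mxvec_index i j).
have := morphism_regularT (@induced_morphism k (affine_space k (m * n)) _ (fun (A : 'M[k]_(m, n)) i => mxvec A 0 i)) rc.
by apply: regular_eqT => A /=; rewrite mxvecE.
Qed.

Lemma morphism_to_matrix Z m n (h : Z -> matrix_space m n) : inverts_regular Z ->
  regular_mx (h : Z -> 'M[k]_(m, n)) -> morphism h.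
Proof.
move=> nZ rh; apply: morphism_to_induced_affine => // l.
case: (mxvec_indexP l) => i j; apply: regular_eqT (rh i j) => z.
by rewrite mxvecE.
Qed.

Lemma matrix_inverts m n : inverts_regular (matrix_space m n).
Proof. by apply: induced_inverts_regular; apply: affine_inverts_regular. Qed.

Lemma matrix_space_iso m n : isomorphic (matrix_space m n) (affine_space k (m * n)).
Proof.
exists (fun (A : 'M[k]_(m, n)) i => mxvec A 0 i), (fun x => vec_mx (\row_i x i)); split.
- exact: induced_morphism.
- apply: morphism_to_matrix => [|i j]; first exact: affine_inverts_regular.
  apply: regular_eqT (@affine_regular_coord k _ (mxvec_index i j)) => x.
  by rewrite mxE mxE.
- move=> A; rewrite -[RHS]mxvecK; congr vec_mx.
  by apply/rowP => i; rewrite mxE.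
- by move=> x; apply/funext => i; rewrite vec_mxK mxE.
Qed.

Lemma matrix_affine m n : is_affine (matrix_space m n).
Proof.
apply: isomorphic_affine (affine_space_affine k (m * n)).
by apply: isomorphic_sym; apply: matrix_space_iso.
Qed.

Lemma pair_space_coord r :
  regular_mx (fun x : mxpair_space k r => (x : 'M[k]_r * 'M[k]_r).1) /\
  regular_mx (fun x : mxpair_space k r => (x : 'M[k]_r * 'M[k]_r).2).
Proof.
pose phi (X : 'M[k]_r * 'M[k]_r) i := row_mx (mxvec X.1) (mxvec X.2) 0 i.
have mphi := @induced_morphism k (affine_space k (r * r + r * r)) _ phi.
split=> i j.
  have := morphism_regularT mphi (@affine_regular_coord k _ (lshift _ (mxvec_index i j))).
  by apply: regular_eqT => x; rewrite /= /phi row_mxEl mxvecE.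
have := morphism_regularT mphi (@affine_regular_coord k _ (rshift _ (mxvec_index i j))).
by apply: regular_eqT => x; rewrite /= /phi row_mxEr mxvecE.
Qed.

Lemma morphism_to_pair Z r (h : Z -> mxpair_space k r) : inverts_regular Z ->
  regular_mx (fun z => (h z : 'M[k]_r * 'M[k]_r).1) ->
  regular_mx (fun z => (h z : 'M[k]_r * 'M[k]_r).2) -> morphism h.
Proof.
move=> nZ r1 r2; apply: morphism_to_induced_affine => // l.
rewrite -[l]splitK; case: (split l) => /= {}l; case: (mxvec_indexP l) => i j.
  by apply: regular_eqT (r1 i j) => z; rewrite row_mxEl mxvecE.
by apply: regular_eqT (r2 i j) => z; rewrite row_mxEr mxvecE.
Qed.

Lemma pair_space_iso r : isomorphic (mxpair_space k r) (affine_space k (r * r + r * r)).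
Proof.
exists (fun (X : 'M[k]_r * 'M[k]_r) i => row_mx (mxvec X.1) (mxvec X.2) 0 i),
  (fun x => (vec_mx (\row_i x (lshift _ i)), vec_mx (\row_i x (rshift _ i)))); split.
- exact: induced_morphism.
- apply: morphism_to_pair => [|i j|i j]; first exact: affine_inverts_regular.
    apply: regular_eqT (@affine_regular_coord k _ (lshift _ (mxvec_index i j))) => x.
    by rewrite mxE mxE.
  apply: regular_eqT (@affine_regular_coord k _ (rshift _ (mxvec_index i j))) => x.
  by rewrite mxE mxE.
- move=> [A B] /=; congr pair.
    rewrite -[RHS]mxvecK; congr vec_mx.
    by apply/rowP => i; rewrite mxE row_mxEl.
  rewrite -[RHS]mxvecK; congr vec_mx.
  by apply/rowP => i; rewrite mxE row_mxEr.
- move=> x; apply/funext => l; rewrite /= !vec_mxK -[l]splitK.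
  by case: (split l) => i; rewrite ?row_mxEl ?row_mxEr mxE.
Qed.

Lemma pair_affine r : is_affine (mxpair_space k r).
Proof.
apply: isomorphic_affine (affine_space_affine k (r * r + r * r)).
by apply: isomorphic_sym; apply: pair_space_iso.
Qed.

Lemma pair_inverts r : inverts_regular (mxpair_space k r).
Proof. by apply: affine_inverts; apply: pair_affine. Qed.

(** [insubd] makes a formula with a membership condition into a total map to the subspace; as the
    condition holds everywhere, the default [a0] is never reached. *)
Lemma morphism_insubd X (A : set X) Z (a0 : A) (h : Z -> X) : (forall z, A (h z)) ->
  morphism h -> @morphism k Z (subspace A) (fun z => insubd a0 (h z)).
Proof.
move=> hA mh; apply: morphism_to_subspace; congr morphism: mh.
by apply/funext => z; rewrite insubdK //; apply: mem_set.
Qed.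

Lemma const_morphism X Z (x0 : X) : morphism (fun _ : Z => x0).
Proof.
move=> U oU; have e : (fun _ : Z => x0) @^-1` U = setT \/ (fun _ : Z => x0) @^-1` U = set0.
  case: (pselect (U x0)) => Ux; [left | right]; apply/seteqP; split=> //.
split=> [|f rf]; first by case: e => ->; [exact: isopenT | exact: isopen0].
by apply: regular_cst; case: e => ->; [exact: isopenT | exact: isopen0].
Qed.

Lemma K0class_singleton X (x0 : X) : inverts_regular X -> (forall x, x = x0) ->
  K0class X = 1.
Proof.
move=> nX X1; rewrite -K0class_point; apply: K0class_iso.
exists (fun=> (fun=> 0) : affine_space k 0), (fun=> x0); split.
- by apply: morphism_to_affine => // -[].
- exact: const_morphism.
- by move=> x; rewrite (X1 x).
- by move=> y; apply/funext => -[].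
Qed.

End RegularMatrices.

(** * Quotients with local slices *)

Section QuotientSlices.
Variable k : fieldType.
Implicit Types X Y Z : fspace k.

(** Phrased inside [X], a morphism on an open part can be compared with maps from the quotient,
    whose structure is also read in [X]. *)
Lemma morphism_on_open X Y (U : set X) (h : X -> Y) : isopen U ->
  morphism (h \o val : subspace U -> Y) <->
  (forall W, isopen W -> isopen (U `&` h @^-1` W) /\
     forall f, regular W f -> regular (U `&` h @^-1` W) (f \o h)).
Proof.
move=> oU; split=> [mh W oW|H W oW].
  have [[V oV VE] rV] := mh W oW.
  have VW x (Ux : U x) : V x <-> W (h x).
    rewrite -[V x]/((val @^-1` V) (SigSub (mem_set Ux) : subspace U)).
    by rewrite -VE.
  have oUW : isopen (U `&` h @^-1` W).
    rewrite (_ : _ `&` _ = U `&` V); first exact: isopenI.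
    by apply/seteqP; split=> x [Ux /(VW _ Ux)].
  split=> // f rf; apply: regular_local => // x [Ux Wx].
  have [V' [g [oV' Vx rg e]]] := rV f rf (SigSub (mem_set Ux)) Wx.
  by exists V', g; split=> // y [Uy Wy] Vy; apply: (e (SigSub (mem_set Uy))).
have [oV rV] := H W oW; split=> [|f rf t Wt].
  exists (U `&` h @^-1` W) => //; apply/seteqP; split=> t //=; last by case.
  by move=> Wt; split=> //; apply: (set_valP t).
exists (U `&` h @^-1` W), (f \o h); split=> //; last exact: rV.
by split=> //; apply: (set_valP t).
Qed.

Variables (X : fspace k) (E : X -> set X).
Hypothesis E_refl : forall x, E x x.
Hypothesis E_eq : forall x y, E x y -> E x = E y.

Lemma class_ofP x y : class_of E x = class_of E y <-> E x y.
Proof.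
split=> [/(congr1 val) /= e|/E_eq e]; first by rewrite e; apply: E_refl.
exact: val_inj.
Qed.

Lemma class_of_morphism : @morphism k X (quot_space E) (class_of E).
Proof. by move=> U oU; split. Qed.

Lemma class_repr_exists (c : classes E) : exists x, class_of E x = c.
Proof. by have [x _ e] := set_valP c; exists x; apply: val_inj. Qed.

Definition class_repr (c : quot_space E) : X := projT1 (cid (class_repr_exists c)).

Lemma class_reprK c : class_of E (class_repr c) = c.
Proof. by rewrite /class_repr; case: cid. Qed.

Lemma class_repr_rel x : E x (class_repr (class_of E x)).
Proof. by apply/class_ofP; rewrite class_reprK. Qed.

Lemma quot_seq_embeds : seq_embeds X -> seq_embeds (quot_space E).
Proof. by apply: seq_embeds_inj; apply: can_inj class_reprK. Qed.

(** [nu] is a normal form on the saturated open set [U]: constant on each orbit and staying in it.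
    Its fixed points form the slice and meet each orbit of [U] exactly once. *)
Definition local_slice (U : set X) (nu : X -> X) : Prop :=
  [/\ isopen U, forall x y, E x y -> U x -> U y,
      forall x, U x -> E x (nu x),
      forall x y, U x -> E x y -> nu x = nu y
    & morphism (nu \o val : subspace U -> X)].

Definition slice_image (U : set X) : set (quot_space E) :=
  [set c | U (class_repr c)].

Definition slice_section (nu : X -> X) (c : quot_space E) : X := nu (class_repr c).

Section Slice.
Variables (U : set X) (nu : X -> X).
Hypothesis sl : local_slice U nu.

Lemma slice_imageE x : slice_image U (class_of E x) <-> U x.
Proof.
have [_ sat _ _ _] := sl; split.
  by apply: sat; apply/class_ofP; rewrite class_reprK.
exact: (sat _ _ (class_repr_rel x)).
Qed.

Lemma preimage_slice_image : class_of E @^-1` slice_image U = U.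
Proof. by apply/seteqP; split=> x /slice_imageE. Qed.

Lemma slice_image_open : isopen (slice_image U).
Proof. by have [oU _ _ _ _] := sl; rewrite /isopen /= /quot_open /= preimage_slice_image. Qed.

Lemma slice_sectionE x : U x -> slice_section nu (class_of E x) = nu x.
Proof.
have [_ sat _ inv _] := sl => Ux; rewrite /slice_section.
by rewrite (inv x _ Ux (class_repr_rel x)).
Qed.

Lemma slice_sectionK c : slice_image U c -> class_of E (slice_section nu c) = c.
Proof.
have [_ sat rel inv _] := sl => Uc; rewrite -[RHS]class_reprK; apply/esym/class_ofP.
exact: rel.
Qed.

Lemma slice_section_in c : slice_image U c -> U (slice_section nu c).
Proof.
have [_ sat rel inv _] := sl => Uc; apply: (sat _ _ (rel _ Uc)).
exact: Uc.
Qed.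

(** Openness and regularity downstairs are tested on [X], where the section pulls back to [nu]. *)
Lemma slice_section_morphism :
  morphism (slice_section nu \o val : subspace (slice_image U) -> X).
Proof.
have [oU _ _ _ mnu] := sl; apply/(morphism_on_open _ slice_image_open) => W oW.
have [oV rV] := (proj1 (morphism_on_open nu oU) mnu) W oW.
have e : class_of E @^-1` (slice_image U `&` slice_section nu @^-1` W) = U `&` nu @^-1` W.
  apply/seteqP; split=> x.
    by move=> [/slice_imageE Ux]; rewrite /= slice_sectionE.
  by move=> [Ux Wx]; split; [apply/slice_imageE | rewrite /= slice_sectionE].
split; first by rewrite /isopen /= /quot_open /= e.
move=> f rf; rewrite /regular /= /quot_reg /= e.
apply: (regular_ext oV _ (rV f rf)) => x [Ux _] /=.
by rewrite slice_sectionE.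
Qed.

Lemma slice_section_comp Z (g : Z -> quot_space E) : morphism g ->
  (forall z, slice_image U (g z)) -> morphism (fun z => slice_section nu (g z)).
Proof.
move=> mg hg; have mc := @corestrict_morphism k _ _ _ g hg mg.
exact: (morphism_comp mc slice_section_morphism).
Qed.

(** The chart is isomorphic to the slice [nu x = x], an equalizer and therefore closed in the affine
    [U] by separatedness. *)
Lemma slice_image_affine : is_separated X -> is_affine (subspace U) ->
  is_affine (subspace (slice_image U)).
Proof.
have [oU sat rel inv mnu] := sl => sX aU.
pose S := U `&` [set x | nu x = x].
have aS : is_affine (subspace S).
  apply: isomorphic_affine (isomorphic_subspaceI _ _) _.
  apply: closed_subspace_affine => //.
  exact: (sX (subspace U) (nu \o val) val aU mnu (@subspace_val_morphism _ _ _)).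
apply: isomorphic_affine aS.
apply: (@isomorphic_sub k X (quot_space E) S (slice_image U) (class_of E) (slice_section nu)).
- by move=> x [Ux _]; apply/slice_imageE.
- move=> c Uc; split; first exact: slice_section_in.
  by apply/esym; apply: inv => //; apply: rel.
- by move=> x [Ux nux]; rewrite slice_sectionE.
- exact: slice_sectionK.
- by apply: morphism_comp class_of_morphism; apply: subspace_val_morphism.
- exact: slice_section_morphism.
Qed.

End Slice.

Lemma quot_small_variety (I : finType) (U : I -> set X) (nu : I -> X -> X) :
  regular_separated (quot_space E) -> small_variety X ->
  (forall i, local_slice (U i) (nu i)) -> (forall i, is_affine (subspace (U i))) ->
  (forall x, exists i, U i x) -> small_variety (quot_space E).
Proof.
move=> sQ [[_ sX] eX] sl aU cU; split; last exact: quot_seq_embeds.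
split; last exact: regular_separated_is_separated.
apply: (@prevariety_fin _ _ I (fun i => slice_image (U i))) => [i|i|c].
- exact: (slice_image_open (sl i)).
- exact: (slice_image_affine (sl i)).
- exact: cU.
Qed.

(* [t x] is the element of [G] that moves the slice point [nu x] to [x]. *)
Lemma trivial_over_slice (G : fspace k) (U : set X) (nu : X -> X) (t : X -> G)
    (act : G -> X -> X) : local_slice U nu ->
  morphism (t \o val : subspace U -> G) ->
  (forall x, U x -> act (t x) (nu x) = x) ->
  (forall a x, U x -> E x (act a x)) ->
  (forall a x, U x -> t (act a (nu x)) = a) ->
  (forall Z (f : Z -> G) (g : Z -> X), inverts_regular Z -> morphism f -> morphism g ->
     morphism (fun z => act (f z) (g z))) ->
  trivial_over G (class_of E : X -> quot_space E) (slice_image U).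
Proof.
move=> sl mt tK actE tact mact; have [oU sat rel inv mnu] := sl.
exists t, (fun a c => act a (slice_section nu c)); split.
- by rewrite (preimage_slice_image sl).
- by move=> x /(slice_imageE sl) Ux; rewrite (slice_sectionE sl) // tK.
- move=> a c Uc; rewrite -[RHS](slice_sectionK sl Uc); apply/esym/class_ofP.
  by apply: actE; apply: slice_section_in.
- by move=> a c Uc; rewrite /slice_section tact.
- move=> Z f g nZ mf mg Ug; apply: mact => //.
  exact: (slice_section_comp sl mg Ug).
Qed.

End QuotientSlices.

(** * Classes of the linear groups *)

Section LinearGroups.
Variable k : fieldType.
Implicit Types X Y Z : fspace k.

Local Notation q := (K0class (affine_space k 1)).

Lemma K0class_affine_space n : K0class (affine_space k n) = q ^+ n.
Proof.
elim: n => [|n IHn]; first by rewrite K0class_point.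
rewrite exprS -IHn; apply: K0class_product; try exact/affine_small_variety/affine_space_affine.
have nA N := @affine_inverts_regular k N.
pose p1 (x : affine_space k n.+1) : affine_space k 1 := fun=> x ord0.
pose p2 (x : affine_space k n.+1) : affine_space k n := fun i => x (lift ord0 i).
pose mk (a : affine_space k 1) (x : affine_space k n) : affine_space k n.+1 :=
  fun i => if unlift ord0 i is Some j then x j else a ord0.
apply: (@product_criterion k (affine_space k 1) (affine_space k n) (affine_space k n.+1) p1 p2 mk).
- by apply: morphism_to_affine => // i; apply: affine_regular_coord.
- by apply: morphism_to_affine => // i; apply: affine_regular_coord.
- by move=> a x; apply/funext => i; rewrite /p1 /mk unlift_none (ord1 i).
- by move=> a x; apply/funext => i; rewrite /p2 /mk liftK.
- by move=> x; apply/funext => i; rewrite /mk; case: unliftP => [j|] ->.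
- move=> Z f g nZ mf mg; apply: morphism_to_affine => // i; rewrite /mk.
  case: (unlift ord0 i) => [j|].
    exact: (morphism_regularT mg (affine_regular_coord j)).
  exact: (morphism_regularT mf (affine_regular_coord ord0)).
Qed.

Lemma K0class_matrix_space m n : K0class (matrix_space k m n) = q ^+ (m * n).
Proof. by rewrite (K0class_iso (matrix_space_iso k m n)) K0class_affine_space. Qed.

Definition nonzero_vectors n : fspace k :=
  @subspace k (matrix_space k n 1) [set c : 'cV[k]_n | c != 0].

Definition nonzero_coord n (i : 'I_n) : set (nonzero_vectors n) :=
  [set c | (val c : 'cV[k]_n) i 0 != 0].

Lemma matrix_coord_nonzero_affine m n (i : 'I_m) (j : 'I_n) :
  is_affine (subspace ([set c | (c : 'M[k]_(m, n)) i j != 0] : set (matrix_space k m n))).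
Proof.
apply: nonzero_subspace_affine; first exact: matrix_affine.
exact: (@matrix_space_coord k m n i j).
Qed.

Lemma cV_neq0P n (c : 'cV[k]_n) : reflect (exists i, c i 0 != 0) (c != 0).
Proof.
apply: (iffP idP) => [c0|[i ci]]; last by apply: contraNneq ci => ->; rewrite mxE.
apply: contrapT => nc; case/eqP: c0; apply/colP => i; rewrite mxE; apply/eqP.
by apply: contrapT => /negP ci; apply: nc; exists i.
Qed.

Lemma nonzero_coord_open n (i : 'I_n) : isopen (nonzero_coord i).
Proof.
apply: (@subspace_open k (matrix_space k n 1) _ [set c | (c : 'cV[k]_n) i 0 != 0]).
by apply: nonzero_open; [exact: matrix_inverts | exact: (@matrix_space_coord k n 1 i 0)].
Qed.

Lemma nonzero_coord_affine n (i : 'I_n) : is_affine (subspace (nonzero_coord i)).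
Proof.
apply: isomorphic_affine (matrix_coord_nonzero_affine i 0); apply: isomorphic_sym.
apply: isomorphic_subspace_subspace => // c ci; apply/cV_neq0P; by exists i.
Qed.

Lemma nonzero_vectors_small n : small_variety (nonzero_vectors n).
Proof.
have am := matrix_affine k n 1.
split; last first.
  apply: (@seq_embeds_inj k (nonzero_vectors n) (matrix_space k n 1) val val_inj).
  by have [] := affine_small_variety am.
split; last first.
  by apply: regular_separated_is_separated; apply: subspace_regular_separated; apply: affine_separated.
apply: (prevariety_fin (@nonzero_coord_open n) (@nonzero_coord_affine n)) => c.
by have /cV_neq0P := set_valP c.
Qed.

Lemma K0class_nonzero_vectors n : K0class (nonzero_vectors n) = q ^+ n - 1.
Proof.
have am := matrix_affine k n 1; have sm := affine_small_variety am.
pose A : set (matrix_space k n 1) := [set c : 'cV[k]_n | c = 0].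
have eA : ~` A = [set c : 'cV[k]_n | c != 0].
  by apply/seteqP; split=> c /=; [move/eqP | move=> /eqP].
have cA : isclosed A.
  apply: (@equalizer_closed k (matrix_space k n 1) (matrix_space k n 1) id (fun=> 0)).
  - exact: matrix_inverts.
  - exact: affine_separated.
  - exact: morphism_id.
  - exact: const_morphism.
have := K0class_scissor sm cA (closed_subspace_small sm cA).
rewrite eA => /(_ (nonzero_vectors_small n)).
rewrite K0class_matrix_space muln1.
rewrite (@K0class_singleton _ (subspace A) (SigSub (mem_set (erefl : A 0)))).
- by move=> ->; rewrite addrC addKr.
- by apply: subspace_inverts_regular; apply: matrix_inverts.
- by move=> x; apply: val_inj; apply: (set_valP x).
Qed.

Lemma GL_space_affine r : is_affine (GL_space k r).
Proof.
have -> : GL_space k r =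
    @subspace k (matrix_space k r r) [set A : 'M[k]_r | \det A != 0].
  congr subspace; apply/seteqP; split=> A /=.
    by rewrite unitmxE unitfE.
  by rewrite unitmxE unitfE.
apply: nonzero_subspace_affine; first exact: matrix_affine.
by apply: regular_det; apply: matrix_space_coord.
Qed.

Lemma GL_space_inverts r : inverts_regular (GL_space k r).
Proof. by apply: affine_inverts; apply: GL_space_affine. Qed.

Lemma GL_space_coord r : regular_mx (fun A : GL_space k r => (val A : 'M[k]_r)).
Proof.
exact: (regular_mx_comp (@subspace_val_morphism k (matrix_space k r r) _)
  (@matrix_space_coord k r r)).
Qed.

Lemma GL_space_unit r (A : GL_space k r) : (val A : 'M[k]_r) \in unitmx.
Proof. exact: (set_valP A). Qed.

Definition GL_space_one r : GL_space k r :=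
  SigSub (mem_set (unitmx1 k r : [set A : 'M[k]_r | A \in unitmx] 1%:M)).

Lemma morphism_to_GL Z r (h : Z -> 'M[k]_r) : inverts_regular Z ->
  (forall z, h z \in unitmx) -> regular_mx h ->
  @morphism k Z (GL_space k r) (fun z => insubd (GL_space_one r) (h z)).
Proof.
move=> nZ uh rh.
apply: (@morphism_insubd k (matrix_space k r r) [set A : 'M[k]_r | A \in unitmx]) => //.
exact: morphism_to_matrix.
Qed.

Lemma val_GL r (A : 'M[k]_r) : A \in unitmx -> val (insubd (GL_space_one r) A) = A.
Proof. by move=> uA; rewrite insubdK //; apply: mem_set. Qed.

Section FirstColumn.
Variable r : nat.

Definition first_vector : 'cV[k]_(1 + r) := delta_mx 0 0.

(** The stabiliser of the first basis vector, which is the fibre of the first-column map. Its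
    elements are the block matrices with rows [1, d] and [0, S], so as a variety it is [k^r] times
    [GL_r]. *)
Definition affine_group_set : set (matrix_space k (1 + r) (1 + r)) :=
  [set A : 'M[k]_(1 + r) | A \in unitmx /\ lsubmx A = first_vector].

Definition affine_group : fspace k := subspace affine_group_set.

(* The permutation maps the first vector to the [i]-th one, which the other factor
   maps to [c]; the latter is invertible as soon as [c i 0 != 0]. *)
Definition column_section (i : 'I_(1 + r)) (c : 'cV[k]_(1 + r)) : 'M[k]_(1 + r) :=
  (1%:M + (c - delta_mx i 0) *m delta_mx 0 i) *m perm_mx (tperm 0 i).

Lemma column_section_first i c : column_section i c *m first_vector = c.
Proof.
rewrite /column_section /first_vector -mulmxA.
have -> : perm_mx (tperm 0 i) *m delta_mx 0 0 = delta_mx i 0 :> 'cV[k]_(1 + r).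
  rewrite -row_permE; apply/colP => a; rewrite !mxE eqxx !andbT.
  by rewrite -(inj_eq (@perm_inj _ (tperm 0 i)) a i) tpermR.
by rewrite mulmxDl mul1mx -mulmxA mul_delta_mx (mx11_scalar (delta_mx 0 0)) mxE /= mulmx1 addrC subrK.
Qed.

(** The first factor is a rank-one perturbation of the identity: as [e *m u] is the scalar
    [c i 0 - 1], the inverse of [1 + u e] is [1 - u e / c i 0]. *)
Lemma column_section_unit i (c : 'cV[k]_(1 + r)) : c i 0 != 0 ->
  column_section i c \in unitmx.
Proof.
move=> ci; rewrite unitmx_mul unitmx_perm andbT.
set u := c - delta_mx i 0; set e := delta_mx 0 i.
have eu : e *m u = (c i 0 - 1)%:M.
  rewrite [LHS]mx11_scalar; congr _%:M; rewrite /e -rowE !mxE.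
  by rewrite !eqxx.
have /mulmx1_unit[] // :
  (1%:M + u *m e) *m (1%:M - (c i 0)^-1 *: (u *m e)) = 1%:M.
rewrite mulmxDl !mulmxBr !mul1mx !mulmx1 -scalemxAr mulmxA -(mulmxA u e u) eu.
rewrite mul_mx_scalar -scalemxAl scalerA -addrA addrA.
rewrite -[X in _ + (X - _)]scale1r -scalerBl.
rewrite -scaleNr -[RHS]addr0 -addrA -scalerDl; congr (_ + _).
have -> : - (c i 0)^-1 + (1 - (c i 0)^-1 * (c i 0 - 1)) = 0.
  by rewrite mulrBr mulVf // mulr1; ring.
by rewrite scale0r.
Qed.

Lemma column_section_regular Z i (h : Z -> 'cV[k]_(1 + r)) :
  regular_mx h -> regular_mx (fun z => column_section i (h z)).
Proof.
move=> rh; apply: regular_mxM; last exact: regular_mx_cst.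
apply: regular_mxD; first exact: regular_mx_cst.
apply: regular_mxM; last exact: regular_mx_cst.
by apply: regular_mxB => //; apply: regular_mx_cst.
Qed.

Lemma affine_group_affine : is_affine affine_group.
Proof.
pose f (A : GL_space k (1 + r)) : matrix_space k (1 + r) 1 := lsubmx (val A : 'M[k]_(1 + r)).
have cS : isclosed [set A | f A = first_vector].
  apply: equalizer_closed; first exact: GL_space_inverts.
  - exact: affine_separated (matrix_affine k (1 + r) 1).
  - apply: morphism_to_matrix => [|i j]; first exact: GL_space_inverts.
    by apply: regular_eqT (@GL_space_coord (1 + r) i (lshift r j)) => A; rewrite mxE.
  - exact: const_morphism.
apply: isomorphic_affine (closed_subspace_affine (GL_space_affine _) cS).
apply: isomorphic_subspace_subspace => [A []|A] //.
by split=> [eA|[]//]; split=> //; exact: GL_space_unit.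
Qed.

Lemma affine_group_coord : regular_mx (fun A : affine_group => (val A : 'M[k]_(1 + r))).
Proof.
exact: (regular_mx_comp (@subspace_val_morphism k (matrix_space k (1 + r) (1 + r)) _)
  (@matrix_space_coord k (1 + r) (1 + r))).
Qed.

Lemma first_vectorE : first_vector = col_mx 1%:M 0.
Proof.
apply/colP => i; rewrite !mxE; case: splitP => j ij; rewrite !mxE.
  by rewrite ord1 eqxx /= andbT -val_eqE /= ij ord1.
by rewrite andbT -val_eqE /= ij.
Qed.

Lemma affine_group_block (d : 'rV[k]_r) (S : 'M[k]_r) : S \in unitmx ->
  affine_group_set (block_mx 1%:M d 0 S).
Proof.
move=> uS; split; first by rewrite unitmxE det_ublock det1 mul1r -unitmxE.
by rewrite block_mxEv; rewrite first_vectorE -block_mxEv block_mxEh row_mxKl.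
Qed.

Lemma affine_group_blockE (A : affine_group) :
  val A = block_mx 1%:M (ursubmx (val A : 'M[k]_(1 + r))) 0 (drsubmx (val A : 'M[k]_(1 + r))).
Proof.
have [_ lA] := set_valP A; apply/matrixP => i j.
case: (split_ordP j) => b ->.
  have := congr1 (fun M : 'cV_(1 + r) => M i b) lA; rewrite mxE first_vectorE => ->.
  by case: (split_ordP i) => a ->; rewrite ?col_mxEu ?col_mxEd ?row_mxEl.
by case: (split_ordP i) => a ->; rewrite ?block_mxEur ?block_mxEdr !mxE.
Qed.

Lemma affine_group_dr (A : affine_group) : drsubmx (val A : 'M[k]_(1 + r)) \in unitmx.
Proof.
have [uA _] := set_valP A; move: uA; rewrite affine_group_blockE unitmxE det_ublock.
by rewrite det1 mul1r -unitmxE block_mxKdr.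
Qed.

Lemma K0class_affine_group :
  K0class affine_group = q ^+ r * K0class (GL_space k r).
Proof.
rewrite -[in q ^+ r](mul1n r) -K0class_matrix_space.
have a0 : affine_group := SigSub (mem_set (affine_group_block 0 (unitmx1 k r))).
have nA : inverts_regular affine_group by apply: affine_inverts; apply: affine_group_affine.
apply: K0class_product.
- by apply: affine_small_variety; apply: matrix_affine.
- by apply: affine_small_variety; apply: GL_space_affine.
- by apply: affine_small_variety; apply: affine_group_affine.
apply: (@product_criterion k (matrix_space k 1 r) (GL_space k r) affine_group
  (fun A => ursubmx (val A : 'M[k]_(1 + r)))
  (fun A => insubd (GL_space_one r) (drsubmx (val A : 'M[k]_(1 + r))))
  (fun d S => insubd a0 (block_mx 1%:M (d : 'rV[k]_r) 0 (val S)))).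
- apply: morphism_to_matrix => // i j.
  by apply: regular_eqT (affine_group_coord (lshift r i) (rshift 1 j)) => A; rewrite !mxE.
- apply: morphism_to_GL => // [A|i j]; first exact: affine_group_dr.
  by apply: regular_eqT (affine_group_coord (rshift 1 i) (rshift 1 j)) => A; rewrite !mxE.
- move=> d S; rewrite insubdK; first by rewrite block_mxKur.
  by apply: mem_set; apply: affine_group_block; apply: GL_space_unit.
- move=> d S; rewrite insubdK; last first.
    by apply: mem_set; apply: affine_group_block; apply: GL_space_unit.
  by apply: val_inj; rewrite block_mxKdr val_GL //; apply: GL_space_unit.
- move=> A; apply: val_inj; rewrite val_GL ?affine_group_dr // -affine_group_blockE.
  by rewrite insubdK //; apply: valP.
- move=> Z f g nZ mf mg.
  apply: (@morphism_insubd k (matrix_space k (1 + r) (1 + r)) affine_group_set) => [z|].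
    by apply: affine_group_block; apply: GL_space_unit.
  apply: morphism_to_matrix => // i j.
  have rf := regular_mx_comp mf (@matrix_space_coord k 1 r).
  have rg := regular_mx_comp mg (@GL_space_coord r).
  case: (split_ordP i) => a ->; case: (split_ordP j) => b ->.
  + apply: (@regular_eqT _ _ _ (fun=> (1%:M : 'M[k]_1) a b)) => [z|].
      by rewrite block_mxEul.
    by apply: regular_cst; apply: isopenT.
  + by apply: regular_eqT (rf a b) => z; rewrite block_mxEur.
  + apply: (@regular_eqT _ _ _ (fun=> 0)) => [z|]; first by rewrite block_mxEdl mxE.
    by apply: regular_cst; apply: isopenT.
  + by apply: regular_eqT (rg a b) => z; rewrite block_mxEdr.
Qed.

Lemma lsubmx_neq0 (A : GL_space k (1 + r)) : lsubmx (val A : 'M[k]_(1 + r)) != 0.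
Proof.
apply: contraTneq (GL_space_unit A) => A0; rewrite unitmxE unitfE negbK.
rewrite -det_tr (expand_det_row _ (lshift r 0)) big1 // => j _.
have := congr1 (fun M : 'cV_(1 + r) => M j 0) A0; rewrite !mxE => ->.
by rewrite mul0r.
Qed.

Definition first_column (A : GL_space k (1 + r)) : nonzero_vectors (1 + r) :=
  SigSub (mem_set (lsubmx_neq0 A : [set c : 'cV[k]_(1 + r) | c != 0] (lsubmx _))).

Lemma first_column_morphism : morphism first_column.
Proof.
apply: morphism_to_subspace; apply: morphism_to_matrix => [|i j]; first exact: GL_space_inverts.
by apply: regular_eqT (@GL_space_coord (1 + r) i (lshift r j)) => A; rewrite mxE.
Qed.

(** Left multiplication by the inverse of the section moves a matrix into the stabiliser, and
    multiplication by the section undoes this. *)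
Lemma first_column_trivial i :
  trivial_over affine_group first_column (@nonzero_coord (1 + r) i).
Proof.
have a0 : affine_group := SigSub (mem_set (affine_group_block 0 (unitmx1 k r))).
have uS (c : nonzero_vectors (1 + r)) : nonzero_coord i c ->
  column_section i (val c) \in unitmx by apply: column_section_unit.
have tA (A : GL_space k (1 + r)) : nonzero_coord i (first_column A) ->
    affine_group_set (invmx (column_section i (lsubmx (val A : 'M[k]_(1 + r)))) *m val A).
  move=> Ai; have uA := uS _ Ai; split.
    by rewrite unitmx_mul unitmx_inv uA GL_space_unit.
  by rewrite -mulmx_lsub -[in X in _ *m X](column_section_first i (lsubmx _)) mulKmx.
have vt (A : GL_space k (1 + r)) (Ai : nonzero_coord i (first_column A)) :=
  insubdK a0 (mem_set (tA A Ai)).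
have mU (b : affine_group) (c : nonzero_vectors (1 + r)) : nonzero_coord i c ->
    column_section i (val c) *m (val b) \in unitmx.
  by move=> ci; rewrite unitmx_mul uS //=; have [] := set_valP b.
have fmk (b : affine_group) (c : nonzero_vectors (1 + r)) : nonzero_coord i c ->
    first_column (insubd (GL_space_one (1 + r)) (column_section i (val c) *m val b)) = c.
  move=> ci; apply: val_inj => /=; rewrite val_GL ?mU // -mulmx_lsub.
  by have [_ ->] := set_valP b; rewrite column_section_first.
exists (fun A => insubd a0 (invmx (column_section i (lsubmx (val A : 'M[k]_(1 + r)))) *m val A)),
  (fun b c => insubd (GL_space_one (1 + r)) (column_section i (val c) *m val b)); split.
- set W := first_column @^-1` _.
  have nW : inverts_regular (subspace W) by apply: subspace_inverts_regular; apply: GL_space_inverts.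
  have rc : regular_mx (fun w : subspace W => (val (val w) : 'M[k]_(1 + r))).
    exact: (regular_mx_comp (@subspace_val_morphism k _ W) (@GL_space_coord (1 + r))).
  apply: (@morphism_insubd k (matrix_space k (1 + r) (1 + r)) affine_group_set) => [w|].
    by apply: tA; apply: (set_valP w).
  apply: morphism_to_matrix => //; apply: regular_mxM => //; apply: regular_invmx => //.
    by move=> w; apply: (uS (first_column (val w))); apply: (set_valP w).
  apply: column_section_regular => a b.
  by apply: regular_eqT (rc a (lshift r b)) => A; rewrite mxE.
- move=> A Ai; apply: val_inj; rewrite (vt A Ai) mulKVmx; last exact: (uS (first_column A)).
  by rewrite val_GL //; apply: GL_space_unit.
- exact: fmk.
- move=> b c ci; apply: val_inj => /=.
  have e := congr1 val (fmk b c ci); rewrite /= in e; rewrite e val_GL ?mU // mulKmx ?uS //.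
  by rewrite insubdK //; apply: valP.
- move=> Z f g nZ mf mg Ug; apply: morphism_to_GL => // [z|]; first exact: mU.
  apply: regular_mxM; last exact: (regular_mx_comp mf affine_group_coord).
  apply: column_section_regular.
  exact: (regular_mx_comp (morphism_comp mg (@subspace_val_morphism k (matrix_space k (1 + r) 1) _))
    (@matrix_space_coord k (1 + r) 1)).
Qed.

Lemma K0class_GL_succ :
  K0class (GL_space k r.+1) = (q ^+ r.+1 - 1) * (q ^+ r * K0class (GL_space k r)).
Proof.
rewrite -[q ^+ r.+1 - 1]K0class_nonzero_vectors -K0class_affine_group mulrC.
apply: (K0class_fibration (p := first_column) (U := @nonzero_coord (1 + r))).
- by apply: affine_small_variety; apply: GL_space_affine.
- exact: nonzero_vectors_small.
- by apply: affine_small_variety; apply: affine_group_affine.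
- exact: first_column_morphism.
- by move=> c; have /cV_neq0P := set_valP c.
- exact: nonzero_coord_open.
- exact: nonzero_coord_affine.
- move=> i.
  have -> : first_column @^-1` nonzero_coord i =
      [set A : GL_space k (1 + r) | (val A : 'M[k]_(1 + r)) i (lshift r 0) != 0].
    by apply/seteqP; split=> A; rewrite /nonzero_coord /= mxE.
  by apply: nonzero_subspace_affine; [exact: GL_space_affine | exact: GL_space_coord].
- exact: first_column_trivial.
Qed.

End FirstColumn.

Lemma K0class_GL r : K0class (GL_space k r) = \prod_(i < r) (q ^+ r - q ^+ i).
Proof.
have GL0 : K0class (GL_space k 0) = 1.
  apply: (@K0class_singleton k _ (GL_space_one 0)); first exact: GL_space_inverts.
  by move=> A; apply: val_inj; apply/matrixP => -[[]].
elim: r => [|r IHr]; first by rewrite big_ord0.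
rewrite K0class_GL_succ IHr big_ord_recl expr0; congr (_ * _).
(* Each factor after the first is [q] times a factor for size [r]; the [r] copies of [q] make up
   [q ^+ r]. *)
rewrite [RHS](eq_bigr (fun i : 'I_r => q * (q ^+ r - q ^+ i))) => [|i _].
  by rewrite big_split /= prodr_const card_ord.
by rewrite mulrBr -!exprS.
Qed.

End LinearGroups.

(** * The projective linear group *)

Section ProjectiveLinearGroup.
Variables (k : fieldType) (r' : nat).
Implicit Types X Y Z : fspace k.

Local Notation r := r'.+1.
Local Notation q := (K0class (affine_space k 1)).
Local Notation GL := (GL_space k r).
Local Notation PGL := (PGL_space k r).

Definition scalar_orbit (A : GL) : set GL :=
  [set B | exists2 c : k, c != 0 & val B = c *: (val A : 'M[k]_r)].

Lemma scalar_orbit_refl A : scalar_orbit A A.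
Proof. by exists 1; rewrite ?oner_neq0 // scale1r. Qed.

Lemma scalar_orbit_eq A B : scalar_orbit A B -> scalar_orbit A = scalar_orbit B.
Proof.
move=> [c c0 AB]; apply/seteqP; split=> D [d d0 DE].
  exists (d / c); first by rewrite mulf_neq0 ?invr_eq0.
  by rewrite AB scalerA divfK.
by exists (d * c); rewrite ?mulf_neq0 // DE AB scalerA.
Qed.

Local Notation repr_PGL := (@class_repr k GL scalar_orbit).

Lemma GL_entry_neq0 (A : GL) : exists ij : 'I_r * 'I_r, (val A : 'M[k]_r) ij.1 ij.2 != 0.
Proof.
apply: contrapT => nA; have A0 : val A = 0 :> 'M[k]_r.
  apply/matrixP => i j; rewrite mxE; apply/eqP; apply: contrapT => /negP h.
  by apply: nA; exists (i, j).
by have := GL_space_unit A; rewrite A0 unitr0.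
Qed.

Lemma conj_PGL (A : GL) (N : 'M[k]_r) :
  val (repr_PGL (class_of scalar_orbit A)) *m N *m
    invmx (val (repr_PGL (class_of scalar_orbit A))) = val A *m N *m invmx (val A).
Proof.
have [c c0 ->] := class_repr_rel scalar_orbit_refl scalar_orbit_eq A.
rewrite invmxZ; last by rewrite unitmxZ ?GL_space_unit // unitfE.
by rewrite -!scalemxAl -scalemxAr scalerA mulfV // scale1r.
Qed.

(** Conjugation is linear in [N], and its coefficients, the entries of [g E_lm g^-1], descend from
    GL to PGL because scalars cancel. So the action is regular without any section of GL over
    PGL. *)
Lemma regular_conj_PGL Z (f : Z -> PGL) (N : Z -> 'M[k]_r) : inverts_regular Z ->
  morphism f -> regular_mx N ->
  regular_mx (fun z => val (repr_PGL (f z)) *m N z *m invmx (val (repr_PGL (f z)))).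
Proof.
move=> nZ mf rN.
pose D l m (c : PGL) : 'M[k]_r :=
  val (repr_PGL c) *m delta_mx l m *m invmx (val (repr_PGL c)).
have rD l m : regular_mx (D l m).
  move=> i j.
  have h : regular_mx (fun A : GL => val A *m (delta_mx l m : 'M[k]_r) *m invmx (val A)).
    have rG := @GL_space_coord k r.
    apply: regular_mxM; first by apply: regular_mxM => //; apply: regular_mx_cst.
    by apply: regular_invmx => //; [exact: GL_space_inverts | exact: GL_space_unit].
  have e : (fun c => D l m c i j) \o class_of scalar_orbit =
      (fun A : GL => (val A *m (delta_mx l m : 'M[k]_r) *m invmx (val A)) i j).
    by apply/funext => A; rewrite /= /D conj_PGL.
  by have := h i j; rewrite -e.
apply: (@regular_mx_eq _ _ _ _ _ (fun z => \sum_l \sum_m N z l m *: D l m (f z))).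
  move=> z; rewrite {1}[N z]matrix_sum_delta mulmx_sumr mulmx_suml.
  apply: eq_bigr => l _; rewrite mulmx_sumr mulmx_suml; apply: eq_bigr => m _.
  by rewrite -scalemxAr -scalemxAl.
apply: regular_mx_sum => l; apply: regular_mx_sum => m; apply: regular_mxZ; first exact: rN.
exact: regular_mx_comp.
Qed.

(** If [g N g^-1 = h N h^-1] for all [N], then [h^-1 g] commutes with every matrix and is therefore
    scalar. *)
Lemma PGL_separated : regular_separated PGL.
Proof.
move=> a b ab; pose g := val (repr_PGL a); pose h := val (repr_PGL b).
have ug : g \in unitmx by apply: GL_space_unit.
have uh : h \in unitmx by apply: GL_space_unit.
have e N : g *m N *m invmx g = h *m N *m invmx h.
  apply/matrixP => i j.
  have nP : inverts_regular PGL by apply: quot_inverts_regular; apply: GL_space_inverts.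
  have rN := regular_conj_PGL nP (@morphism_id k PGL) (@regular_mx_cst k PGL r r N).
  exact: (ab _ (rN i j)).
pose u := invmx h *m g.
have uN N : u *m N = N *m u.
  have := congr1 (fun M => invmx h *m M *m g) (e N).
  by rewrite !mulmxA (mulVmx uh) mul1mx !mulmxKV // -!mulmxA.
(* Right multiplication by the matrix unit [delta_mx p 0] moves column [p] to column 0, so comparing
   columns 0 of the two products determines every entry of [u]. *)
have mulr_delta (M : 'M[k]_r) (p : 'I_r) i : (M *m (delta_mx p 0 : 'M[k]_r)) i 0 = M i p.
  rewrite mxE (bigD1 p) //= mxE !eqxx mulr1 big1 ?addr0 // => s sp.
  by rewrite mxE (negPf sp) mulr0.
have mull_delta (M : 'M[k]_r) (p : 'I_r) i : ((delta_mx p 0 : 'M[k]_r) *m M) i 0 = (i == p)%:R * M 0 0.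
  rewrite mxE (bigD1 0) //= mxE eqxx andbT big1 ?addr0 // => s s0.
  by rewrite mxE (negPf s0) andbF mul0r.
have uE : u = (u 0 0)%:M.
  apply/matrixP => i p; rewrite -[LHS]mulr_delta uN mull_delta !mxE.
  by case: (i == p); rewrite ?mul1r ?mul0r.
have gE : g = u 0 0 *: h by rewrite -mul_mx_scalar -uE mulKVmx.
have u0 : u 0 0 != 0.
  by apply: contraTneq ug => u0; rewrite gE u0 scale0r unitr0.
rewrite -[a]class_reprK -[b]class_reprK.
by apply/esym/(class_ofP scalar_orbit_refl scalar_orbit_eq); exists (u 0 0).
Qed.

Definition entry_nonzero (ij : 'I_r * 'I_r) : set GL :=
  [set A | (val A : 'M[k]_r) ij.1 ij.2 != 0].

Definition normalize_entry (ij : 'I_r * 'I_r) (A : GL) : GL :=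
  insubd (GL_space_one k r) (((val A : 'M[k]_r) ij.1 ij.2)^-1 *: val A).

Lemma val_normalize_entry ij A : entry_nonzero ij A ->
  val (normalize_entry ij A) = ((val A : 'M[k]_r) ij.1 ij.2)^-1 *: (val A : 'M[k]_r).
Proof.
move=> Aij; rewrite val_GL // unitmxZ ?GL_space_unit //.
by rewrite unitfE invr_eq0.
Qed.

Lemma entry_nonzero_affine ij : is_affine (subspace (entry_nonzero ij)).
Proof. by apply: nonzero_subspace_affine; [exact: GL_space_affine | exact: GL_space_coord]. Qed.

Lemma normalize_entry_slice ij :
  local_slice scalar_orbit (entry_nonzero ij) (normalize_entry ij).
Proof.
split.
- by apply: nonzero_open; [exact: GL_space_inverts | exact: GL_space_coord].
- by move=> A B [c c0 AB] Aij; rewrite /entry_nonzero /= AB mxE mulf_neq0.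
- move=> A Aij; exists ((val A : 'M[k]_r) ij.1 ij.2)^-1; first by rewrite invr_eq0.
  exact: val_normalize_entry.
- move=> A B Aij [c c0 AB]; apply: val_inj.
  have Bij : entry_nonzero ij B by rewrite /entry_nonzero /= AB mxE mulf_neq0.
  rewrite !val_normalize_entry // AB mxE scalerA invfM mulrAC mulVf ?mul1r //.
- have nU : inverts_regular (subspace (entry_nonzero ij)).
    by apply: subspace_inverts_regular; apply: GL_space_inverts.
  have rU := regular_mx_comp (@subspace_val_morphism k _ (entry_nonzero ij)) (@GL_space_coord k r).
  have Uij (x : subspace (entry_nonzero ij)) : entry_nonzero ij (val x) by exact: (set_valP x).
  apply: morphism_to_GL => // [x|].
    by rewrite unitmxZ ?GL_space_unit // unitfE invr_eq0; apply: Uij.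
  apply: regular_mxZ => //; apply: regularV => //; exact: rU.
Qed.

Lemma PGL_small : small_variety PGL.
Proof.
apply: (quot_small_variety scalar_orbit_refl scalar_orbit_eq PGL_separated _
  normalize_entry_slice entry_nonzero_affine).
  by apply: affine_small_variety; apply: GL_space_affine.
exact: GL_entry_neq0.
Qed.

(** The fibre, the multiplicative group, is encoded as the nonzero vectors of [k^1], whose class
    [q - 1] is known. The entry that the slice normalises to 1 is the fibre coordinate. *)
Lemma K0class_GL_PGL : K0class GL = (q - 1) * K0class PGL.
Proof.
rewrite -[q in q - 1]expr1 -K0class_nonzero_vectors.
have sl := normalize_entry_slice.
have aU := entry_nonzero_affine.
have sGL : is_separated GL by apply: regular_separated_is_separated; apply: affine_separated; apply: GL_space_affine.
have oR := scalar_orbit_refl; have oE := scalar_orbit_eq.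
apply: (@K0class_fibration k GL PGL (nonzero_vectors k 1) (class_of scalar_orbit) _
  (fun ij => @slice_image k GL scalar_orbit (entry_nonzero ij))).
- by apply: affine_small_variety; apply: GL_space_affine.
- exact: PGL_small.
- exact: nonzero_vectors_small.
- exact: class_of_morphism.
- by move=> c; apply: GL_entry_neq0.
- by move=> ij; apply: (slice_image_open oR oE (sl ij)).
- by move=> ij; apply: (slice_image_affine oR oE (sl ij)).
- by move=> ij; rewrite (preimage_slice_image oR oE (sl ij)).
move=> ij.
have c1P : [set c : 'cV[k]_1 | c != 0] 1%:M by rewrite /= oner_neq0.
pose c1 : nonzero_vectors k 1 := SigSub (mem_set c1P).
have cV1 (c : nonzero_vectors k 1) : (val c : 'cV[k]_1) 0 0 != 0.
  have := set_valP c; rewrite /=; apply: contraNneq => c0.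
  by apply/eqP/colP => i; rewrite ord1 c0 mxE.
have uact (c : nonzero_vectors k 1) (A : GL) :
    (val c : 'cV[k]_1) 0 0 *: (val A : 'M[k]_r) \in unitmx.
  by rewrite unitmxZ ?GL_space_unit // unitfE.
have tP (A : GL) : entry_nonzero ij A ->
    [set c : 'cV[k]_1 | c != 0] ((val A : 'M[k]_r) ij.1 ij.2)%:M.
  by move=> Aij; apply/cV_neq0P; exists 0; rewrite mxE.
pose t (A : GL) : nonzero_vectors k 1 := insubd c1 (((val A : 'M[k]_r) ij.1 ij.2)%:M : 'cV[k]_1).
have vt A : entry_nonzero ij A -> val (t A) = ((val A : 'M[k]_r) ij.1 ij.2)%:M :> 'cV[k]_1.
  by move=> Aij; rewrite insubdK //; apply: mem_set; apply: tP.
pose act (c : nonzero_vectors k 1) (A : GL) : GL :=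
  insubd (GL_space_one k r) ((val c : 'cV[k]_1) 0 0 *: (val A : 'M[k]_r)).
have vact c A : val (act c A) = (val c : 'cV[k]_1) 0 0 *: (val A : 'M[k]_r).
  exact: val_GL.
apply: (trivial_over_slice oR oE (sl ij) (t := t) (act := act)).
- have rU := regular_mx_comp (@subspace_val_morphism k _ (entry_nonzero ij)) (@GL_space_coord k r).
  apply: (@morphism_insubd k (matrix_space k 1 1)) => [x|].
    by apply: tP; apply: (set_valP x).
  apply: morphism_to_matrix => [|i j].
    by apply: subspace_inverts_regular; apply: GL_space_inverts.
  by apply: regular_eqT (rU ij.1 ij.2) => x; rewrite !ord1 mxE.
- move=> A Aij; apply: val_inj; rewrite vact vt // val_normalize_entry // mxE scalerA.
  by rewrite mulfV ?scale1r.
- by move=> c A Aij; exists ((val c : 'cV[k]_1) 0 0).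
- move=> c A Aij; apply: val_inj.
  have nAij : (val (normalize_entry ij A) : 'M[k]_r) ij.1 ij.2 = 1.
    by rewrite val_normalize_entry // mxE mulVf.
  have cA : entry_nonzero ij (act c (normalize_entry ij A)).
    by rewrite /entry_nonzero /= vact mxE nAij mulr1.
  rewrite vt // vact mxE nAij mulr1; apply/colP => i; rewrite mxE !ord1 //.
- move=> Z f g nZ mf mg; apply: morphism_to_GL => //.
  apply: regular_mxZ; last exact: (regular_mx_comp mg (@GL_space_coord k r)).
  have rf := regular_mx_comp (morphism_comp mf (@subspace_val_morphism k (matrix_space k 1 1) _))
    (@matrix_space_coord k 1 1).
  exact: rf.
Qed.

End ProjectiveLinearGroup.

(** * Pairs of matrices *)

Section MatrixPairs.
Variables (k : fieldType) (r' : nat).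
Local Notation r := r'.+1.
Local Notation pair := ('M[k]_r * 'M[k]_r)%type.
Implicit Types (x y : pair) (P : 'M[k]_r).

Definition conj_pair P x : pair := (P *m x.1 *m invmx P, P *m x.2 *m invmx P).

Lemma conj_pair1 x : conj_pair 1%:M x = x.
Proof. by rewrite /conj_pair invmx1 !mulmx1 !mul1mx; case: x. Qed.

Lemma invmxM P Q : P \in unitmx -> Q \in unitmx ->
  invmx (P *m Q) = invmx Q *m invmx P.
Proof. by move=> uP uQ; apply: invrM. Qed.

Lemma conj_pairM P Q x : P \in unitmx -> Q \in unitmx ->
  conj_pair (P *m Q) x = conj_pair P (conj_pair Q x).
Proof. by move=> uP uQ; rewrite /conj_pair invmxM // !mulmxA. Qed.

Lemma conj_pairK P x : P \in unitmx -> conj_pair (invmx P) (conj_pair P x) = x.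
Proof. by move=> uP; rewrite -conj_pairM ?unitmx_inv // mulVmx // conj_pair1. Qed.

Lemma conj_pairVK P x : P \in unitmx -> conj_pair P (conj_pair (invmx P) x) = x.
Proof. by move=> uP; rewrite -conj_pairM ?unitmx_inv // mulmxV // conj_pair1. Qed.

Definition letter x (b : bool) := if b then x.1 else x.2.

Fixpoint word x (w : seq bool) : 'M[k]_r :=
  if w is b :: w' then letter x b *m word x w' else 1%:M.

(** The letters are multiplied in reverse order, so that transposition turns [coword] into [word]
    and covectors can be treated like vectors. *)
Fixpoint coword x (w : seq bool) : 'M[k]_r :=
  if w is b :: w' then coword x w' *m letter x b else 1%:M.

Lemma word_conj P x w : P \in unitmx -> word (conj_pair P x) w = P *m word x w *m invmx P.
Proof.
move=> uP; elim: w => [|b w IHw] /=; first by rewrite mulmx1 mulmxV.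
by rewrite IHw; case: b; rewrite /= -!mulmxA mulKmx.
Qed.

Lemma coword_conj P x w : P \in unitmx ->
  coword (conj_pair P x) w = P *m coword x w *m invmx P.
Proof.
move=> uP; elim: w => [|b w IHw] /=; first by rewrite mulmx1 mulmxV.
by rewrite IHw; case: b; rewrite /= -!mulmxA mulKmx.
Qed.

Definition tr_pair x : pair := (x.1^T, x.2^T).

Lemma word_tr x w : word (tr_pair x) w = (coword x w)^T.
Proof.
elim: w => [|b w IHw] /=; first by rewrite trmx1.
by rewrite IHw trmx_mul; case: b.
Qed.

(** Words of length at most [r] suffice, and the bound makes the type of indices finite, as a finite
    cover requires. *)
Local Notation words := (r.-tuple {bseq r of bool}).

(* The columns are the vectors [word x w_b *m p *m u]; when [p] has rank one,
   changing [u] only rescales this matrix. *)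
Definition frame (p : 'M[k]_r) x (w : words) (u : 'cV[k]_r) : 'M[k]_r :=
  \matrix_(i, b) (word x (tnth w b) *m p *m u) i 0.

Definition coframe (f : 'rV[k]_r) x (w : words) : 'M[k]_r :=
  \matrix_(a, j) (f *m coword x (tnth w a)) 0 j.

(** A Gram matrix of traces: for [p = v *m f] it pairs the covectors [f *m coword] with the vectors
    [word *m v] through [X], but it needs no choice of [v] and [f] and is invariant under
    conjugation. *)
Definition hankel (p : 'M[k]_r) x (w w' : words) (X : 'M[k]_r) : 'M[k]_r :=
  \matrix_(a, b) \tr (p *m coword x (tnth w' a) *m X *m word x (tnth w b)).

Definition normal_form p x w w' : pair :=
  (invmx (hankel p x w w' 1%:M) *m hankel p x w w' x.1,
   invmx (hankel p x w w' 1%:M) *m hankel p x w w' x.2).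

Lemma eq_from_cols (A B : 'M[k]_r) : (forall b, col b A = col b B) -> A = B.
Proof.
move=> AB; apply/matrixP => i b; have := congr1 (fun M : 'cV_r => M i 0) (AB b).
by rewrite !mxE.
Qed.

Lemma col_mulmx (A B : 'M[k]_r) b : col b (A *m B) = A *m col b B.
Proof. by rewrite !colE mulmxA. Qed.

Lemma col_frame p x w u b : col b (frame p x w u) = word x (tnth w b) *m p *m u.
Proof. by apply/colP => i; rewrite mxE mxE. Qed.

Lemma frame_conj P p x w u : P \in unitmx ->
  frame (P *m p *m invmx P) (conj_pair P x) w u = P *m frame p x w (invmx P *m u).
Proof.
move=> uP; apply: eq_from_cols => b; rewrite col_frame col_mulmx col_frame word_conj //.
by rewrite -!mulmxA mulKmx.
Qed.

Lemma hankel_conj P p x w w' X : P \in unitmx ->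
  hankel (P *m p *m invmx P) (conj_pair P x) w w' (P *m X *m invmx P) = hankel p x w w' X.
Proof.
move=> uP; apply/matrixP => a b; rewrite !mxE word_conj // coword_conj //.
rewrite -!mulmxA !mulKmx // mxtrace_mulC -!mulmxA mulVmx // mulmx1.
by rewrite !mulmxA.
Qed.

Lemma normal_form_conj P p x w w' : P \in unitmx ->
  normal_form (P *m p *m invmx P) (conj_pair P x) w w' = normal_form p x w w'.
Proof.
move=> uP; rewrite /normal_form /= !hankel_conj //.
by rewrite -(hankel_conj p x w w' 1%:M uP) mulmx1 mulmxV.
Qed.

Section RankOne.
Variables (v : 'cV[k]_r) (f : 'rV[k]_r) (x : pair) (w w' : words).
Local Notation p := (v *m f).

Definition vector_frame : 'M[k]_r := \matrix_(i, b) (word x (tnth w b) *m v) i 0.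

Lemma frame_rank1 u : frame p x w u = (f *m u) 0 0 *: vector_frame.
Proof.
apply: eq_from_cols => b; rewrite col_frame -!mulmxA [f *m u]mx11_scalar mul_mx_scalar.
by rewrite -scalemxAr; apply/colP => i; rewrite !mxE eqxx mulr1n.
Qed.

(** By cyclicity the trace of [v f w' X w] is the scalar [f w' X w v]. *)
Lemma hankel_rank1 X : hankel p x w w' X = coframe f x w' *m X *m vector_frame.
Proof.
apply/matrixP => a b; rewrite mxE -!mulmxA mxtrace_mulC /mxtrace big_ord1.
rewrite !mulmxA -[_ *m v]mulmxA.
have E (A B : 'M[k]_r) : (A *m B) a b = (row a A *m col b B) 0 0.
  by rewrite !mxE; apply: eq_bigr => j _; rewrite !mxE.
rewrite E row_mul; congr ((_ *m _ *m _) 0 0).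
  by apply/rowP => j; rewrite !mxE.
by apply/colP => j; rewrite !mxE.
Qed.

Hypothesis hankel_unit : hankel p x w w' 1%:M \in unitmx.

Lemma rank1_frames_unit : coframe f x w' \in unitmx /\ vector_frame \in unitmx.
Proof.
by move: hankel_unit; rewrite hankel_rank1 mulmx1 unitmx_mul => /andP.
Qed.

(** The coframe cancels: [(C V)^-1 (C A V) = V^-1 A V]. *)
Lemma normal_form_rank1 :
  normal_form p x w w' = conj_pair (invmx vector_frame) x.
Proof.
have [uc uv] := rank1_frames_unit.
rewrite /normal_form /conj_pair !hankel_rank1 mulmx1 invmxM // invmxK.
by congr (_, _); rewrite -!mulmxA; congr (_ *m _); rewrite mulKmx // !mulmxA.
Qed.

End RankOne.

Lemma rank1_outer (p : 'M[k]_r) : \rank p = 1%N -> exists (v : 'cV[k]_r) (f : 'rV[k]_r), p = v *m f.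
Proof.
move=> p1; have := mulmx_base p; move: (col_base p) (row_base p); rewrite p1.
by move=> v f <-; exists v, f.
Qed.

(** Hides the factorisation [p = v *m f], unique only up to a scalar. The frame at [u] is [f *m u]
    times [V], so a basis vector on which [f] does not vanish gives an invertible frame. *)
Lemma rank_eq_frames (p : 'M[k]_r) x w w' : \rank p = 1%N ->
  hankel p x w w' 1%:M \in unitmx ->
  exists V, [/\ V \in unitmx, normal_form p x w w' = conj_pair (invmx V) x,
    forall u, exists c, frame p x w u = c *: V
    & exists j, frame p x w (delta_mx j 0) \in unitmx].
Proof.
move=> /rank1_outer[v [f pE]]; rewrite pE => uH.
have [uc uv] := rank1_frames_unit uH.
exists (vector_frame v x w); split=> //; first exact: normal_form_rank1.
  by move=> u; exists ((f *m u) 0 0); apply: frame_rank1.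
have f0 : f != 0.
  apply: contraTneq uc => ->; rewrite (_ : coframe _ _ _ = 0) ?unitr0 //.
  by apply/matrixP => i j; rewrite mxE mul0mx !mxE.
have [j fj] : exists j, f 0 j != 0.
  apply: contrapT => nf; case/eqP: f0; apply/rowP => j; rewrite mxE; apply/eqP.
  by apply: contrapT => /negP fj; apply: nf; exists j.
exists j; rewrite frame_rank1 unitmxZ // unitfE.
by rewrite -colE mxE.
Qed.

Lemma frame_unit_scale p x w w' u u' : \rank p = 1%N ->
  hankel p x w w' 1%:M \in unitmx ->
  frame p x w u \in unitmx -> frame p x w u' \in unitmx ->
  exists2 c : k, c != 0 & frame p x w u' = c *: frame p x w u.
Proof.
move=> p1 uH uF uF'; have [V [uV _ FV _]] := rank_eq_frames p1 uH.
have [c cE] := FV u; have [c' cE'] := FV u'.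
have c0 : c != 0 by apply: contraTneq uF => c0; rewrite cE c0 scale0r unitr0.
have c'0 : c' != 0 by apply: contraTneq uF' => c0'; rewrite cE' c0' scale0r unitr0.
exists (c' / c); first by rewrite mulf_neq0 ?invr_eq0.
by rewrite cE' cE scalerA divfK.
Qed.

Lemma conj_pairZ c P x : c != 0 -> P \in unitmx -> conj_pair (c *: P) x = conj_pair P x.
Proof.
move=> c0 uP; rewrite /conj_pair invmxZ ?unitmxZ ?unitfE //.
by rewrite -!scalemxAl -!scalemxAr !scalerA mulfV // !scale1r.
Qed.

Lemma normal_form_frame p x w w' u : \rank p = 1%N ->
  hankel p x w w' 1%:M \in unitmx -> frame p x w u \in unitmx ->
  normal_form p x w w' = conj_pair (invmx (frame p x w u)) x.
Proof.
move=> p1 uH uF; have [V [uV -> FV _]] := rank_eq_frames p1 uH.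
have [c cE] := FV u.
have c0 : c != 0 by apply: contraTneq uF => c0; rewrite cE c0 scale0r unitr0.
by rewrite cE invmxZ ?unitmxZ ?unitfE // conj_pairZ ?invr_eq0 // unitmx_inv.
Qed.

(** In a rank factorisation [p = C S], idempotence forces [S C = 1]. In characteristic zero the rank
    can thus be read off a regular function. *)
Lemma idempotent_trace n (p : 'M[k]_n) : p *m p = p -> \tr p = (\rank p)%:R.
Proof.
move=> pp.
move: (row_fullP (col_base_full p)) (row_freeP (row_base_free p)) (mulmx_base p).
move: (col_base p) (row_base p); move: (\rank p) => rho C S [B BC] [D SD] e.
suff SC : S *m C = 1%:M by rewrite -e mxtrace_mulC SC mxtrace1.
have := congr1 (fun M => B *m M *m D) pp.
by rewrite -e -!mulmxA SD mulmx1 [B *m (C *m _)]mulmxA BC mul1mx.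
Qed.

Definition stable_space x (U : {vspace 'cV[k]_r}) : Prop :=
  (forall v, v \in U -> x.1 *m v \in U) /\ (forall v, v \in U -> x.2 *m v \in U).

Lemma letter_stable x U b v : stable_space x U -> v \in U -> letter x b *m v \in U.
Proof. by move=> [s1 s2]; case: b; [apply: s1 | apply: s2]. Qed.

Lemma word_stable x U w v : stable_space x U -> v \in U -> word x w *m v \in U.
Proof.
move=> sU vU; elim: w => [|b w IHw] /=; first by rewrite mul1mx.
by rewrite -mulmxA; apply: letter_stable.
Qed.

Lemma coword_stable x U w v : stable_space x U -> v \in U -> coword x w *m v \in U.
Proof.
move=> sU; elim: w v => [|b w IHw] v vU /=; first by rewrite mul1mx.
by rewrite -mulmxA; apply: IHw; apply: letter_stable.
Qed.

Lemma unit_columns_full (U : {vspace 'cV[k]_r}) (M : 'M[k]_r) : M \in unitmx ->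
  (forall j, col j M \in U) -> U = fullv.
Proof.
move=> uM cM; apply/eqP; rewrite eqEsubv subvf; apply/subvP => v _.
rewrite -(mulKVmx uM v); move: (invmx M *m v) => u.
have -> : M *m u = \sum_j u j 0 *: col j M.
  apply/colP => i; rewrite mxE summxE; apply: eq_bigr => j _.
  by rewrite !mxE mulrC.
by apply: memv_suml => j _; apply: memvZ.
Qed.

(** A stable [U] containing [v] contains the basis of words applied to [v]. Otherwise stability
    under [p] forces [f] to vanish on [U]; then all [f *m coword] vanish there, and since they form
    a basis of covectors [U] is zero. *)
Lemma hankel_irreducible p x w w' : \rank p = 1%N -> hankel p x w w' 1%:M \in unitmx ->
  (forall U, stable_space x U -> forall u, u \in U -> p *m u \in U) ->
  irreducible_pair x.
Proof.
move=> /rank1_outer[v [f pE]]; rewrite pE => uH pst U s1 s2.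
have sU : stable_space x U by [].
have [uc uv] := rank1_frames_unit uH.
have [vU|vU] := boolP (v \in U).
  right; apply: (unit_columns_full uv) => j.
  rewrite (_ : col j _ = word x (tnth w j) *m v); first exact: word_stable.
  by apply/colP => i; rewrite !mxE.
have fU u : u \in U -> f *m u = 0.
  move=> uU; rewrite [LHS]mx11_scalar; set c := (f *m u) 0 0.
  suff -> : c = 0 by rewrite raddf0.
  apply/eqP; apply: contraNT vU => c0.
  have := pst U sU u uU; rewrite -mulmxA [f *m u]mx11_scalar mul_mx_scalar => h.
  by rewrite -(scalerK c0 v); apply: memvZ.
left; apply/eqP; rewrite -subv0; apply/subvP => u uU; rewrite memv0.
rewrite -(mulKmx uc u) (_ : coframe f x w' *m u = 0) ?mulmx0 //.
apply/colP => a; rewrite mxE [RHS]mxE.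
have := fU _ (coword_stable (tnth w' a) sU uU); move=> /(congr1 (fun M : 'M[k]_1 => M 0 0)).
rewrite mulmxA mxE [RHS]mxE => e; rewrite -[RHS]e; apply: eq_bigr => j _.
by rewrite mxE.
Qed.

Lemma irreducible_conj P x : P \in unitmx -> irreducible_pair x ->
  irreducible_pair (conj_pair P x).
Proof.
move=> uP irr U s1 s2; pose g : 'End('cV[k]_r) := linfun (mulmx (invmx P)).
have gE u : g u = invmx P *m u by rewrite lfunE.
have gU u : u \in (g @: U)%VS <-> P *m u \in U.
  split=> [/memv_imgP[z zU ->]|PuU]; first by rewrite gE mulKVmx.
  by rewrite -(mulKmx uP u) -gE; apply: memv_img.
have [] := irr (g @: U)%VS.
- move=> v /gU vU; apply/gU; have := s1 _ vU.
  by rewrite /= -!mulmxA mulKmx.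
- move=> v /gU vU; apply/gU; have := s2 _ vU.
  by rewrite /= -!mulmxA mulKmx.
- move=> g0; left; apply/eqP; rewrite -subv0; apply/subvP => u uU.
  have : invmx P *m u \in (g @: U)%VS by apply/gU; rewrite mulKVmx.
  rewrite g0 !memv0 => /eqP e; apply/eqP.
  by rewrite -(mulKVmx uP u) e mulmx0.
- move=> gf; right; apply/eqP; rewrite eqEsubv subvf; apply/subvP => u _.
  have : invmx P *m u \in (g @: U)%VS by rewrite gf memvf.
  by move=> /gU; rewrite mulKVmx.
Qed.

(** The annihilator of a subspace stable under the transposes is stable under [x]; it is realised as
    the kernel of the matrix whose rows are a basis. *)
Lemma irreducible_tr x : irreducible_pair x -> irreducible_pair (tr_pair x).
Proof.
move=> irr U s1 s2; pose b := vbasis U.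
pose M : 'M[k]_(\dim U, r) := \matrix_(i, j) (tnth b i) j 0.
have ME i : row i M = (tnth b i)^T by apply/rowP => j; rewrite !mxE.
pose g : 'Hom('cV[k]_r, 'cV[k]_(\dim U)) := linfun (mulmx M).
have gE u : g u = M *m u by rewrite lfunE.
have kerP u : u \in lker g <-> forall z, z \in U -> z^T *m u = 0.
  rewrite memv_ker gE; split=> [/eqP Mu z zU|h].
    rewrite (coord_vbasis zU) raddf_sum mulmx_suml big1 //= => i _.
    rewrite linearZ /= -scalemxAl -tnth_nth -ME -row_mul Mu.
    by rewrite row0 scaler0.
  apply/eqP/row_matrixP => i; rewrite row_mul ME row0; apply: h.
  by apply: vbasis_mem; apply: mem_tnth.
have [] := irr (lker g).
- move=> v /kerP h; apply/kerP => z zU; rewrite mulmxA.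
  by have := h _ (s1 z zU); rewrite /= trmx_mul trmxK.
- move=> v /kerP h; apply/kerP => z zU; rewrite mulmxA.
  by have := h _ (s2 z zU); rewrite /= trmx_mul trmxK.
(* A trivial annihilator makes [g] injective, so the dimension of [U] is at least [r] by
   rank-nullity. *)
- move=> k0; right; apply/eqP; rewrite eqEdim subvf /=.
  have := limg_ker_dim g fullv; rewrite capfv k0 dimv0 add0n => <-.
  apply: leq_trans (dimvS (subvf _)) _.
  by rewrite dimvf /dim /= muln1.
- move=> kf; left; apply/eqP; rewrite -subv0; apply/subvP => z zU.
  rewrite memv0; apply/eqP/colP => i; rewrite mxE.
  have : (delta_mx i 0 : 'cV[k]_r) \in lker g by rewrite kf memvf.
  move=> /kerP/(_ z zU)/(congr1 (fun N : 'M[k]_1 => N 0 0)).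
  by rewrite -colE !mxE.
Qed.

(** If prefixing one letter to the chosen words never leaves their span, that span is stable of
    dimension [l] with [0 < l < r], against irreducibility. Each step lengthens the words by at most
    one letter. *)
Lemma irreducible_free x (v : 'cV[k]_r) l : irreducible_pair x -> v != 0 -> (l <= r)%N ->
  exists s : seq (seq bool), [/\ size s = l, all (fun w => (size w <= l)%N) s
    & free [seq word x w *m v | w <- s]].
Proof.
move=> irr v0; elim: l => [|l IHl] lr; first by exists [::]; split=> //; apply: nil_free.
have [s [sl ls fs]] := IHl (ltnW lr).
pose U := <<[seq word x w *m v | w <- s]>>%VS.
have dU : \dim U = l by move: fs; rewrite /free => /eqP ->; rewrite size_map.
have ls' : all (fun w => (size w <= l.+1)%N) s.
  by apply: sub_all ls => w; apply: leqW.
have done_if w : (size w <= l.+1)%N -> word x w *m v \notin U ->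
    exists s, [/\ size s = l.+1, all (fun w => (size w <= l.+1)%N) s
      & free [seq word x w *m v | w <- s]].
  move=> wl wU; exists (w :: s); split=> /=; first by rewrite sl.
    by rewrite wl.
  by rewrite free_cons wU.
(* The zero span is stable, so stability gives no contradiction here; the first vector is [v]
   itself, from the empty word. *)
have [l0|l_gt0] := posnP l.
  apply: (done_if [::]) => //=; rewrite mul1mx.
  have -> : U = 0%VS by apply/eqP; rewrite -dimv_eq0 dU l0.
  by rewrite memv0.
apply: contrapT => nex.
have sU b u : u \in U -> letter x b *m u \in U.
  pose g : 'End('cV[k]_r) := linfun (mulmx (letter x b)).
  have gE z : g z = letter x b *m z by rewrite lfunE.
  move=> uU; rewrite -gE.
  suff : (g @: U <= U)%VS by move/subvP; apply; apply: memv_img.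
  rewrite limg_span; apply/span_subvP => z /mapP[z' /mapP[w ws ->] ->].
  rewrite gE mulmxA; apply: contrapT => /negP zU; apply: nex.
  by apply: (done_if (b :: w)) => //=; rewrite ltnS; apply: (allP ls).
have [U0|Uf] := irr U (sU true) (sU false).
  by move: dU l_gt0; rewrite U0 dimv0 => <-.
by move: dU; rewrite Uf dimvf /dim /= muln1 => e; rewrite -e ltnn in lr.
Qed.

Lemma irreducible_cyclic x (v : 'cV[k]_r) : irreducible_pair x -> v != 0 ->
  exists w : words, vector_frame v x w \in unitmx.
Proof.
move=> irr v0; have [s [sr ls fs]] := irreducible_free irr v0 (leqnn r).
have hs i : (size (nth [::] s i) <= r)%N.
  have [si|si] := ltnP i (size s); last by rewrite nth_default.
  by apply: (allP ls); apply: mem_nth.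
exists [tuple Bseq (hs i) | i < r].
set F := vector_frame _ _ _.
have cF j : col j F = word x (nth [::] s j) *m v.
  by apply/colP => i; rewrite !mxE tnth_mktuple.
have Uf : <<[seq word x w *m v | w <- s]>>%VS = fullv.
  apply/eqP; rewrite eqEdim subvf /= dimvf /dim /= muln1.
  by move: fs; rewrite /free => /eqP ->; rewrite size_map sr.
have sp (u : 'cV[k]_r) : exists a : 'cV[k]_r, F *m a = u.
  have : u \in <<[seq word x w *m v | w <- s]>>%VS by rewrite Uf memvf.
  have szm : size [seq word x w *m v | w <- s] == r by rewrite size_map sr.
  move=> /(@coord_span _ _ _ (Tuple szm)) ->.
  exists (\col_j coord (Tuple szm) j u).
  have -> (a : 'cV[k]_r) : F *m a = \sum_j a j 0 *: col j F.
    apply/colP => i; rewrite mxE summxE; apply: eq_bigr => j _.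
    by rewrite !mxE mulrC.
  apply: eq_bigr => j _; rewrite mxE cF; congr (_ *: _).
  by rewrite /= (nth_map [::]) // sr.
(* Preimages of the basis vectors assemble to a right inverse of [F]. *)
have [A hA] := choice (fun j => sp (delta_mx j 0)).
have FA : F *m (\matrix_(i, j) A j i 0) = 1%:M.
  apply/matrixP => i j; rewrite -[RHS](_ : (delta_mx j 0 : 'cV[k]_r) i 0 = _); last first.
    by rewrite !mxE eqxx andbT.
  rewrite -hA mxE [RHS]mxE; apply: eq_bigr => l _; congr (_ * _).
  by rewrite mxE.
by have [] := mulmx1_unit FA.
Qed.

(** Cyclicity is applied to [v] for [x], and to the transpose of [f] for the transposed pair, which
    is again irreducible. *)
Lemma irreducible_hankel x p : irreducible_pair x -> \rank p = 1%N ->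
  exists w w', hankel p x w w' 1%:M \in unitmx.
Proof.
move=> irr p1; have [v [f pE]] := rank1_outer p1.
have p0 : p != 0 by rewrite -mxrank_eq0 p1.
have v0 : v != 0 by apply: contraNneq p0 => v0; rewrite pE v0 mul0mx.
have f0 : f^T != 0.
  by apply: contraNneq p0 => f0; rewrite pE -[f]trmxK f0 trmx0 mulmx0.
have [w uw] := irreducible_cyclic irr v0.
have [w' uw'] := irreducible_cyclic (irreducible_tr irr) f0.
exists w, w'; rewrite pE hankel_rank1 mulmx1 unitmx_mul uw andbT -unitmx_tr.
rewrite (_ : _^T = vector_frame f^T (tr_pair x) w') //.
apply/matrixP => i j; rewrite [LHS]mxE [LHS]mxE [RHS]mxE word_tr -trmx_mul.
by rewrite [RHS]mxE.
Qed.

End MatrixPairs.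

(** * Slices for conjugation from equivariant idempotents *)

Section RegularWords.
Variables (k : fieldType) (r' : nat) (Z : fspace k).
Local Notation r := r'.+1.
Variable h : Z -> 'M[k]_r * 'M[k]_r.
Hypotheses (r1 : regular_mx (fun z => (h z).1)) (r2 : regular_mx (fun z => (h z).2)).

Lemma regular_word w : regular_mx (fun z => word (h z) w).
Proof.
elim: w => [|b w IHw] /=; first exact: regular_mx_cst.
by apply: regular_mxM => //; case: b.
Qed.

Lemma regular_coword w : regular_mx (fun z => coword (h z) w).
Proof.
elim: w => [|b w IHw] /=; first exact: regular_mx_cst.
by apply: regular_mxM => //; case: b.
Qed.

Lemma regular_hankel (p : Z -> 'M[k]_r) w w' (X : Z -> 'M[k]_r) :
  regular_mx p -> regular_mx X -> regular_mx (fun z => hankel (p z) (h z) w w' (X z)).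
Proof.
move=> rp rX a b; apply: (@regular_eqT _ _ _ (fun z => \tr (p z *m
  coword (h z) (tnth w' a) *m X z *m word (h z) (tnth w b)))) => [z|]; first by rewrite mxE.
by apply: regular_trace; do !apply: regular_mxM => //; [apply: regular_coword | apply: regular_word].
Qed.

Lemma regular_frame (p : Z -> 'M[k]_r) w u :
  regular_mx p -> regular_mx (fun z => frame (p z) (h z) w u).
Proof.
move=> rp a b.
have := regular_mxM (regular_mxM (regular_word (tnth w b)) rp) (@regular_mx_cst _ Z _ _ u).
by move=> /(_ a 0); apply: regular_eqT => z; rewrite mxE.
Qed.

End RegularWords.

Section EquivariantIdempotents.
Variables (k : fieldType) (r' : nat).
Local Notation r := r'.+1.
Local Notation pair := ('M[k]_r * 'M[k]_r)%type.
Local Notation pairs := (mxpair_space k r).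
Local Notation GL := (GL_space k r).
Local Notation PGL := (PGL_space k r).
Local Notation words := (r.-tuple {bseq r of bool}).

Variables (Y : set pairs) (J : finType) (E : J -> pair -> 'M[k]_r).
Hypothesis natr_eq0 : forall n, (n%:R == 0 :> k) = (n == 0)%N.
Hypothesis Y_affine : is_affine (subspace Y).
Hypothesis Y_conj : forall P x, P \in unitmx -> Y x -> Y (conj_pair P x).
Hypothesis E_regular : forall j, regular_mx (fun y : subspace Y => E j (val y)).
Hypothesis E_conj : forall j P x, P \in unitmx -> Y x ->
  E j (conj_pair P x) = P *m E j x *m invmx P.
Hypothesis E_idem : forall j x, Y x -> E j x *m E j x = E j x.
Hypothesis E_stable : forall j x (U : {vspace 'cV[k]_r}) u, Y x ->
  stable_space x U -> u \in U -> E j x *m u \in U.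
Hypothesis E_rank1 : forall x, Y x -> irreducible_pair x -> exists j, \rank (E j x) = 1%N.

Definition irreducible_set : set pairs := Y `&` @irreducible_pair k r.

Definition irreducible_space : fspace k := subspace irreducible_set.
Local Notation X := irreducible_space.
Implicit Types x y : X.

Definition conj_orbit (x : X) : set X :=
  [set y | exists2 P : 'M[k]_r, P \in unitmx & val y = conj_pair P (val x)].

Definition conj_space : fspace k := quot_space conj_orbit.
Local Notation M := conj_space.

Lemma conj_orbit_refl x : conj_orbit x x.
Proof. by exists 1%:M; rewrite ?unitmx1 // conj_pair1. Qed.

Lemma conj_orbit_sym x y : conj_orbit x y -> conj_orbit y x.
Proof.
move=> [P uP xy]; exists (invmx P); rewrite ?unitmx_inv //.
by rewrite xy conj_pairK.
Qed.

Lemma conj_orbit_trans y x z : conj_orbit x y -> conj_orbit y z -> conj_orbit x z.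
Proof.
move=> [P uP xy] [Q uQ yz]; exists (Q *m P); first by rewrite unitmx_mul uQ.
by rewrite conj_pairM // -xy.
Qed.

Lemma conj_orbit_eq x y : conj_orbit x y -> conj_orbit x = conj_orbit y.
Proof.
move=> xy; apply/seteqP; split=> z; last exact: conj_orbit_trans.
by apply: conj_orbit_trans; apply: conj_orbit_sym.
Qed.

Lemma irreducible_setP x : Y (val x) /\ irreducible_pair (val x : pair).
Proof. exact: (set_valP x). Qed.

Lemma irreducible_set_conj P (x : pair) : P \in unitmx -> irreducible_set x ->
  irreducible_set (conj_pair P x).
Proof. by move=> uP [Yx ix]; split; [apply: Y_conj | apply: irreducible_conj]. Qed.

Lemma natr_inj m n : (m%:R == n%:R :> k) = (m == n).
Proof.
wlog mn : m n / (m <= n)%N => [H|].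
  by have [/H //|/ltnW/H e] := leqP m n; rewrite eq_sym e eq_sym.
by rewrite eq_sym -subr_eq0 -natrB // natr_eq0 subn_eq0 eqn_leq mn.
Qed.

Local Notation index := (J * words * words)%type.
Implicit Types i : index.

Definition good_index i (x : pair) : Prop :=
  \rank (E i.1.1 x) = 1%N /\ hankel (E i.1.1 x) x i.1.2 i.2 1%:M \in unitmx.

(** The trace of an idempotent is its rank, one of [0, ..., r], and the product vanishes at every
    such value except 1. Rank one and invertibility of the Hankel matrix thus become the
    nonvanishing of one regular function. *)
Definition good_function i (x : pair) : k :=
  (\prod_(t < r.+1 | t != 1%N :> nat) (\tr (E i.1.1 x) - t%:R)) *
  \det (hankel (E i.1.1 x) x i.1.2 i.2 1%:M).

Lemma good_functionP i (x : pair) : Y x -> (good_function i x != 0) <-> good_index i x.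
Proof.
move=> Yx; rewrite /good_function mulf_eq0 negb_or /good_index unitmxE unitfE.
have -> : (\prod_(t < r.+1 | t != 1%N :> nat) (\tr (E i.1.1 x) - t%:R) != 0) =
    (\rank (E i.1.1 x) == 1)%N.
  rewrite (idempotent_trace (E_idem _ Yx)); apply/idP/idP.
    apply: contraTT => r1; have rr : (\rank (E i.1.1 x) < r.+1)%N.
      by rewrite ltnS rank_leq_row.
    by rewrite (bigD1 (Ordinal rr)) //= subrr mul0r eqxx.
  move=> /eqP ->; apply/prodf_neq0 => t t1.
  by rewrite subr_eq0 natr_inj eq_sym.
by split=> [/andP[/eqP]|[-> ->]].
Qed.

Lemma good_index_irreducible i (x : pair) : Y x -> good_index i x -> irreducible_pair x.
Proof.
move=> Yx [p1 uH]; apply: (hankel_irreducible p1 uH) => U sU u.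
exact: E_stable.
Qed.

Lemma good_index_exists (x : pair) : Y x -> irreducible_pair x -> exists i, good_index i x.
Proof.
move=> Yx ix; have [j p1] := E_rank1 Yx ix.
by have [w [w' uH]] := irreducible_hankel ix p1; exists (j, w, w').
Qed.

Lemma good_index_conj i P (x : pair) : P \in unitmx -> Y x -> good_index i x ->
  good_index i (conj_pair P x).
Proof.
move=> uP Yx [p1 uH]; rewrite /good_index E_conj //; split.
  rewrite mxrankMfree ?row_free_unit ?unitmx_inv // -[RHS]p1.
  by rewrite eqmxMfull ?row_full_unit.
by have := hankel_conj (E i.1.1 x) x i.1.2 i.2 1%:M uP; rewrite mulmx1 mulmxV // => ->.
Qed.

Lemma pairs_coord1 (T : set pairs) : regular_mx (fun t : subspace T => (val t : pair).1).
Proof.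
exact: (regular_mx_comp (@subspace_val_morphism k pairs T) (proj1 (pair_space_coord k r))).
Qed.

Lemma pairs_coord2 (T : set pairs) : regular_mx (fun t : subspace T => (val t : pair).2).
Proof.
exact: (regular_mx_comp (@subspace_val_morphism k pairs T) (proj2 (pair_space_coord k r))).
Qed.

Lemma irreducible_inverts : inverts_regular X.
Proof. by apply: subspace_inverts_regular; apply: pair_inverts. Qed.

Lemma E_regularX j : regular_mx (fun x : X => E j (val x)).
Proof.
have hY x : Y (val x) by have [] := irreducible_setP x.
have mY : @morphism k X (subspace Y) (@corestrict k pairs Y X val hY).
  by apply: corestrict_morphism; apply: subspace_val_morphism.
exact: (regular_mx_comp mY (@E_regular j)).
Qed.

Lemma good_function_regularY i : regular setT (fun y : subspace Y => good_function i (val y)).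
Proof.
have oT := isopenT (subspace Y).
apply: regularM => //.
  apply: regular_prod => // t; apply: regularB => //; last exact: regular_cst.
  by apply: regular_trace; apply: E_regular.
apply: regular_det; apply: regular_hankel; first exact: pairs_coord1.
- exact: pairs_coord2.
- exact: E_regular.
- exact: regular_mx_cst.
Qed.

Lemma good_function_regularX i : regular setT (fun x : X => good_function i (val x)).
Proof.
have hY x : Y (val x) by have [] := irreducible_setP x.
have mY : @morphism k X (subspace Y) (@corestrict k pairs Y X val hY).
  by apply: corestrict_morphism; apply: subspace_val_morphism.
exact: (morphism_regularT mY (good_function_regularY i)).
Qed.

Definition good_set i : set X := [set x | good_index i (val x)].

Lemma good_setE i : good_set i = [set x : X | good_function i (val x) != 0].
Proof.
by apply/seteqP; split=> x /=; have [Yx _] := irreducible_setP x; move/(good_functionP i Yx).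
Qed.

Lemma good_set_open i : isopen (good_set i).
Proof.
rewrite good_setE; apply: nonzero_open; [exact: irreducible_inverts | exact: good_function_regularX].
Qed.

(** Within [Y] a good index already implies irreducibility, so the set is a principal open subset of
    the affine [Y]. *)
Lemma good_set_affine i : is_affine (subspace (good_set i)).
Proof.
have := @nonzero_subsetI_affine k pairs Y (good_function i) Y_affine (good_function_regularY i).
apply: isomorphic_affine; apply: isomorphic_sym.
apply: isomorphic_subspace_subspace => [x [Yx]|x].
  by move=> /(good_functionP i Yx) gx; split=> //; apply: good_index_irreducible gx.
have [Yx _] := irreducible_setP x.
by split=> [/(good_functionP i Yx)|[_ /(good_functionP i Yx)]].
Qed.

Lemma good_set_cover x : exists i, good_set i x.
Proof. by have [Yx ix] := irreducible_setP x; apply: good_index_exists. Qed.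

Lemma irreducible_regular_separated : regular_separated X.
Proof. by apply: subspace_regular_separated; apply: affine_separated; apply: pair_affine. Qed.

Lemma irreducible_small : small_variety X.
Proof.
split; last first.
  apply: (@seq_embeds_inj k X pairs val val_inj).
  by have [] := affine_small_variety (pair_affine k r).
split; last by apply: regular_separated_is_separated; apply: irreducible_regular_separated.
exact: (prevariety_fin good_set_open good_set_affine good_set_cover).
Qed.

Definition slice_map i (x : X) : X :=
  insubd x (normal_form (E i.1.1 (val x)) (val x) i.1.2 i.2).

Lemma slice_map_conj i x : good_set i x -> exists2 V, V \in unitmx &
  normal_form (E i.1.1 (val x)) (val x) i.1.2 i.2 = conj_pair (invmx V) (val x).
Proof.
move=> [p1 uH]; have [V [uV VE _ _]] := rank_eq_frames p1 uH.
by exists V.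
Qed.

Lemma val_slice_map i x : good_set i x ->
  val (slice_map i x) = normal_form (E i.1.1 (val x)) (val x) i.1.2 i.2.
Proof.
move=> ix; rewrite insubdK //; apply: mem_set.
have [V uV ->] := slice_map_conj ix; apply: irreducible_set_conj; first by rewrite unitmx_inv.
exact: irreducible_setP.
Qed.

Lemma slice_map_slice i : local_slice conj_orbit (good_set i) (slice_map i).
Proof.
split.
- exact: good_set_open.
- move=> x y [P uP xy] ix; rewrite /good_set /= xy; apply: good_index_conj => //.
  by have [] := irreducible_setP x.
- move=> x ix; have [V uV VE] := slice_map_conj ix.
  by exists (invmx V); rewrite ?unitmx_inv // val_slice_map.
- move=> x y ix [P uP xy]; have [Yx _] := irreducible_setP x.
  have iy : good_set i y by rewrite /good_set /= xy; apply: good_index_conj.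
  apply: val_inj; rewrite !val_slice_map // xy E_conj //.
  by rewrite normal_form_conj.
- have rU := @subspace_val_morphism k X (good_set i).
  have r1 := regular_mx_comp rU (@pairs_coord1 irreducible_set).
  have r2 := regular_mx_comp rU (@pairs_coord2 irreducible_set).
  have rE := regular_mx_comp rU (@E_regularX i.1.1).
  have nU : inverts_regular (subspace (good_set i)).
    by apply: subspace_inverts_regular; apply: irreducible_inverts.
  have iU (u : subspace (good_set i)) : good_set i (val u) by exact: (set_valP u).
  have rH (T : subspace (good_set i) -> 'M[k]_r) : regular_mx T ->
      regular_mx (fun u : subspace (good_set i) => invmx (hankel (E i.1.1 (val (val u))) (val (val u)) i.1.2 i.2 1%:M) *m
        hankel (E i.1.1 (val (val u))) (val (val u)) i.1.2 i.2 (T u)).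
    move=> rT; apply: regular_mxM; last exact: (regular_hankel r1 r2).
    apply: regular_invmx => // [u|]; first by have [] := iU u.
    by apply: (regular_hankel r1 r2) => //; apply: regular_mx_cst.
  apply: morphism_to_subspace; apply: morphism_to_pair => //.
    by apply: regular_mx_eq (rH _ r1) => u; rewrite [val _](val_slice_map (iU u)).
  by apply: regular_mx_eq (rH _ r2) => u; rewrite [val _](val_slice_map (iU u)).
Qed.

(** These include the entries of the three Hankel matrices, [None] standing for the identity; with
    empty words and [None] they give the trace of the idempotent. *)
Definition moment j (w w' : seq bool) (b : option bool) (x : pair) : k :=
  \tr (E j x *m coword x w' *m (if b is Some b then letter x b else 1%:M) *m word x w).

Lemma moment_conj j w w' b P (x : pair) : P \in unitmx -> Y x ->
  moment j w w' b (conj_pair P x) = moment j w w' b x.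
Proof.
move=> uP Yx; rewrite /moment E_conj // word_conj // coword_conj //.
have -> : (if b is Some b0 then letter (conj_pair P x) b0 else 1%:M) =
    P *m (if b is Some b0 then letter x b0 else 1%:M) *m invmx P.
  by case: b => [[]|] //; rewrite mulmx1 mulmxV.
rewrite -!mulmxA !mulKmx // mxtrace_mulC -!mulmxA mulVmx // mulmx1.
by rewrite !mulmxA.
Qed.

Lemma moment_regular j w w' b : regular setT (fun x : X => moment j w w' b (val x)).
Proof.
have r1 := @pairs_coord1 irreducible_set; have r2 := @pairs_coord2 irreducible_set.
apply: regular_trace; apply: regular_mxM; last exact: (regular_word r1 r2).
apply: regular_mxM; last by case: b => [[]|] //; apply: regular_mx_cst.
apply: regular_mxM; [exact: E_regularX | exact: (regular_coword r1 r2)].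
Qed.

(** Equal moments give a common good index and equal Hankel matrices, hence the same normal form,
    which lies in both orbits. *)
Lemma conj_space_separated : regular_separated M.
Proof.
move=> c d cd; pose x := class_repr c; pose y := class_repr d.
have mom j w w' b : moment j w w' b (val x) = moment j w w' b (val y).
  apply: (cd (fun c => moment j w w' b (val (class_repr c)))).
  have e : (fun c : M => moment j w w' b (val (class_repr c))) \o class_of conj_orbit =
      (fun x : X => moment j w w' b (val x)).
    apply/funext => z /=.
    have [P uP ->] := class_repr_rel conj_orbit_refl conj_orbit_eq z.
    by apply: moment_conj => //; have [] := irreducible_setP z.
  by have := moment_regular j w w' b; rewrite -e.
have [i ix] := good_set_cover x.
have hE (T : pair -> 'M[k]_r) (b : option bool) :
    (forall x : pair, T x = if b is Some b then letter x b else 1%:M) ->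
    hankel (E i.1.1 (val x)) (val x) i.1.2 i.2 (T (val x)) =
    hankel (E i.1.1 (val y)) (val y) i.1.2 i.2 (T (val y)).
  by move=> TE; apply/matrixP => a e; rewrite !mxE !TE; apply: mom.
have h0 := hE (fun=> 1%:M) None (fun=> erefl).
have h1 := hE (fun z => z.1) (Some true) (fun=> erefl).
have h2 := hE (fun z => z.2) (Some false) (fun=> erefl).
have iy : good_set i y.
  have [p1 uH] := ix; split; last by rewrite -h0.
  have [Yx _] := irreducible_setP x; have [Yy _] := irreducible_setP y.
  (* The traces of the two idempotents agree, hence so do their ranks. *)
  have := mom i.1.1 [::] [::] None; rewrite /moment /= !mulmx1.
  rewrite !idempotent_trace ?E_idem // => /eqP; rewrite natr_inj => /eqP <-.
  exact: p1.
rewrite -[c]class_reprK -[d]class_reprK.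
have sl := slice_map_slice i; have [_ _ rel _ _] := sl.
have := rel _ ix; have -> : slice_map i x = slice_map i y.
  by apply: val_inj; rewrite !val_slice_map // /normal_form h0 h1 h2.
move=> /conj_orbit_trans/(_ (conj_orbit_sym (rel _ iy))).
by move/(class_ofP conj_orbit_refl conj_orbit_eq).
Qed.

Lemma conj_space_small : small_variety M.
Proof.
exact: (quot_small_variety conj_orbit_refl conj_orbit_eq conj_space_separated
  irreducible_small slice_map_slice good_set_affine good_set_cover).
Qed.

(** The class acts through a chosen representative; the choice is irrelevant since scalars cancel in
    a conjugation. *)
Definition conj_act (G : PGL) (x : X) : X :=
  insubd x (conj_pair (val (@class_repr k GL (@scalar_orbit k r') G)) (val x)).

Lemma val_conj_act G x :
  val (conj_act G x) = conj_pair (val (@class_repr k GL (@scalar_orbit k r') G)) (val x).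
Proof.
rewrite insubdK //; apply: mem_set; apply: irreducible_set_conj; first exact: GL_space_unit.
exact: irreducible_setP.
Qed.

Lemma conj_pair_class (A : GL) (x : pair) :
  conj_pair (val (@class_repr k GL (@scalar_orbit k r') (class_of (@scalar_orbit k r') A))) x =
  conj_pair (val A) x.
Proof. by rewrite /conj_pair !conj_PGL. Qed.

Definition frame_at i (a : 'I_r) (x : X) : 'M[k]_r :=
  frame (E i.1.1 (val x)) (val x) i.1.2 (delta_mx a 0).

Definition frame_index i (x : X) : 'I_r :=
  odflt ord0 [pick a | frame_at i a x \in unitmx].

Definition frame_class i (x : X) : PGL :=
  class_of (@scalar_orbit k r') (insubd (GL_space_one k r) (frame_at i (frame_index i x) x)).

Lemma frame_index_unit i x : good_set i x -> frame_at i (frame_index i x) x \in unitmx.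
Proof.
move=> [p1 uH]; have [V [_ _ _ [a ua]]] := rank_eq_frames p1 uH.
by rewrite /frame_index; case: pickP => [//|/(_ a)]; rewrite /frame_at ua.
Qed.

Lemma frame_classE i x a : good_set i x -> frame_at i a x \in unitmx ->
  frame_class i x = class_of (@scalar_orbit k r') (insubd (GL_space_one k r) (frame_at i a x)).
Proof.
move=> ix ua; have ub := frame_index_unit ix; have [p1 uH] := ix.
apply/(class_ofP (@scalar_orbit_refl k r') (@scalar_orbit_eq k r')).
have [c c0 cE] := frame_unit_scale p1 uH ub ua.
by exists c; rewrite ?val_GL.
Qed.

(** The index chosen at [u] still gives an invertible frame on a neighbourhood of [u], and by
    independence of the index it computes the class on that whole neighbourhood. *)
Lemma frame_class_morphism i :
  morphism (frame_class i \o val : subspace (good_set i) -> PGL).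
Proof.
apply: morphism_local => u; have iU (z : subspace (good_set i)) : good_set i (val z).
  exact: (set_valP z).
pose a := frame_index i (val u).
have nU : inverts_regular (subspace (good_set i)).
  by apply: subspace_inverts_regular; apply: irreducible_inverts.
have rF : regular_mx (fun z : subspace (good_set i) => frame_at i a (val z)).
  have rU := @subspace_val_morphism k X (good_set i).
  exact: (regular_frame (regular_mx_comp rU (@pairs_coord1 irreducible_set))
    (regular_mx_comp rU (@pairs_coord2 irreducible_set)) _ _
    (regular_mx_comp rU (@E_regularX i.1.1))).
pose W : set (subspace (good_set i)) := [set z | \det (frame_at i a (val z)) != 0].
exists W; split.
- by apply: nonzero_open => //; apply: regular_det.
- by rewrite /W /= -unitfE -unitmxE; apply: frame_index_unit.
have uW (z : subspace W) : frame_at i a (val (val z)) \in unitmx.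
  by rewrite unitmxE unitfE; apply: (set_valP z).
have -> : (fun w : subspace W => (frame_class i \o val) (val w)) =
    class_of (@scalar_orbit k r') \o
    (fun w : subspace W => insubd (GL_space_one k r) (frame_at i a (val (val w)))).
  by apply/funext => w; apply: (frame_classE (iU (val w)) (uW w)).
apply: (@morphism_comp k _ GL PGL); last exact: class_of_morphism.
apply: morphism_to_GL => //; first exact: subspace_inverts_regular.
exact: (regular_mx_comp (@subspace_val_morphism k _ W) rF).
Qed.

Lemma conj_trivial i :
  trivial_over PGL (class_of conj_orbit : X -> M) (@slice_image k X conj_orbit (good_set i)).
Proof.
have sl := slice_map_slice i; have [_ sat rel _ _] := sl.
apply: (trivial_over_slice conj_orbit_refl conj_orbit_eq sl (t := frame_class i)
  (act := conj_act)).
- exact: frame_class_morphism.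
- move=> x ix; have uF := frame_index_unit ix; have [p1 uH] := ix.
  apply: val_inj; rewrite val_conj_act val_slice_map // conj_pair_class val_GL //.
  by rewrite (normal_form_frame p1 uH uF) conj_pairVK.
- move=> G x _; exists (val (@class_repr k GL (@scalar_orbit k r') G)); first exact: GL_space_unit.
  exact: val_conj_act.
- move=> G x ix; set y := conj_act G _.
  have uF := frame_index_unit ix; have [p1 uH] := ix; have [Yx _] := irreducible_setP x.
  pose g := val (@class_repr k GL (@scalar_orbit k r') G).
  have ug : g \in unitmx by exact: GL_space_unit.
  (* [Q] moves [x] to [y]: it first brings [x] to its normal form and then applies [g]. *)
  pose Q := g *m invmx (frame_at i (frame_index i x) x).
  have uQ : Q \in unitmx by rewrite unitmx_mul ug unitmx_inv.
  have yE : val y = conj_pair Q (val x).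
    rewrite val_conj_act val_slice_map // (normal_form_frame p1 uH uF) -conj_pairM //.
    by rewrite unitmx_inv.
  have iy : good_set i y by rewrite /good_set /= yE; apply: good_index_conj.
  have uFy := frame_index_unit iy.
  have FyE : frame_at i (frame_index i y) y =
      Q *m frame (E i.1.1 (val x)) (val x) i.1.2 (invmx Q *m delta_mx (frame_index i y) 0).
    by rewrite /frame_at yE E_conj // frame_conj.
  have uFx : frame (E i.1.1 (val x)) (val x) i.1.2
      (invmx Q *m delta_mx (frame_index i y) 0) \in unitmx.
    by move: uFy; rewrite FyE unitmx_mul uQ.
  (* By equivariance the frame of [y] is [Q] times a frame of [x] at another vector, that is, [Q]
     times a multiple of the original frame: a multiple of [g]. *)
  have [c c0 cE] := frame_unit_scale p1 uH uF uFx.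
  rewrite -[RHS]class_reprK; apply/esym.
  apply/(class_ofP (@scalar_orbit_refl k r') (@scalar_orbit_eq k r')).
  exists c => //; rewrite val_GL // FyE cE -scalemxAr /Q -/(frame_at i _ x).
  by rewrite mulmxKV.
- move=> Z f g nZ mf mg; apply: morphism_to_subspace.
  have rg1 := regular_mx_comp mg (@pairs_coord1 irreducible_set).
  have rg2 := regular_mx_comp mg (@pairs_coord2 irreducible_set).
  apply: morphism_to_pair => //.
    by apply: regular_mx_eq (regular_conj_PGL nZ mf rg1) => z; rewrite val_conj_act.
  by apply: regular_mx_eq (regular_conj_PGL nZ mf rg2) => z; rewrite val_conj_act.
Qed.

Lemma K0class_conj_space : K0class X = K0class PGL * K0class M.
Proof.
have sl := slice_map_slice; have oR := conj_orbit_refl; have oE := conj_orbit_eq.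
have sX : is_separated X.
  by apply: regular_separated_is_separated; apply: irreducible_regular_separated.
apply: (@K0class_fibration k X M PGL (class_of conj_orbit) _
  (fun i => @slice_image k X conj_orbit (good_set i))).
- exact: irreducible_small.
- exact: conj_space_small.
- exact: PGL_small.
- exact: class_of_morphism.
- by move=> c; apply: good_set_cover.
- by move=> i; apply: (slice_image_open oR oE (sl i)).
- by move=> i; apply: (slice_image_affine oR oE (sl i)) => //; apply: good_set_affine.
- by move=> i; rewrite (preimage_slice_image oR oE (sl i)); apply: good_set_affine.
- exact: conj_trivial.
Qed.

End EquivariantIdempotents.

(** * Idempotents attached to eigenvalues *)

Section Averages.
Variables (k : fieldType) (r' : nat) (e : nat).
Local Notation r := r'.+1.
Implicit Types N P : 'M[k]_r.
Hypothesis e_neq0 : e%:R != 0 :> k.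

(** When [N ^+ e = 1] this is the projector onto the fixed vectors of [N], written as a polynomial
    in [N]. *)
Definition average N : 'M[k]_r := e%:R^-1 *: \sum_(j < e) N ^+ j.

Lemma conjmxX P N j : P \in unitmx -> (P *m N *m invmx P) ^+ j = P *m N ^+ j *m invmx P.
Proof.
move=> uP; elim: j => [|j IHj]; first by rewrite !expr0 mulmx1 mulmxV.
by rewrite exprS IHj -mulmxE exprS -mulmxE -!mulmxA mulKmx.
Qed.

Lemma average_conj P N : P \in unitmx ->
  average (P *m N *m invmx P) = P *m average N *m invmx P.
Proof.
move=> uP; rewrite /average -scalemxAr -scalemxAl mulmx_sumr mulmx_suml.
by congr (_ *: _); apply: eq_bigr => j _; rewrite conjmxX.
Qed.

Lemma mul_average N : N ^+ e = 1 -> N *m average N = average N.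
Proof.
move=> Ne; rewrite /average -scalemxAr mulmx_sumr; congr (_ *: _).
rewrite (eq_bigr (fun j : 'I_e => N ^+ j.+1)) => [|j _]; last by rewrite exprS.
case: e Ne => [|e'] Ne; first by rewrite !big_ord0.
(* Multiplication by [N] permutes the powers cyclically, since [N ^+ e] is again [N ^+ 0]. *)
by rewrite big_ord_recr big_ord_recl /= Ne expr0 addrC.
Qed.

Lemma fixed_average N m (v : 'M[k]_(r, m)) : N *m v = v -> average N *m v = v.
Proof.
move=> Nv; rewrite /average -scalemxAl mulmx_suml.
have NX j : N ^+ j *m v = v.
  by elim: j => [|j IHj]; [rewrite expr0 mul1mx | rewrite exprS -mulmxE -mulmxA IHj].
rewrite (eq_bigr (fun=> v)) => [|j _]; last exact: NX.
by rewrite sumr_const card_ord -scaler_nat scalerA mulVf // scale1r.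
Qed.

Lemma average_idem N : N ^+ e = 1 -> average N *m average N = average N.
Proof. by move=> Ne; apply: fixed_average; apply: mul_average. Qed.

Lemma average_stable N (U : {vspace 'cV[k]_r}) u :
  (forall v, v \in U -> N *m v \in U) -> u \in U -> average N *m u \in U.
Proof.
move=> sU uU; rewrite /average -scalemxAl mulmx_suml; apply: memvZ.
apply: memv_suml => -[j _] _ /=; elim: j => [|j IHj]; first by rewrite expr0 mul1mx.
by rewrite exprS -mulmxE -mulmxA; apply: sU.
Qed.

Lemma regular_average (Z : fspace k) (F : Z -> 'M[k]_r) :
  regular_mx F -> regular_mx (fun z => average (F z)).
Proof.
move=> rF; apply: regular_mxZ; first by apply: regular_cst; apply: isopenT.
by apply: regular_mx_sum => j; apply: regular_mxX.
Qed.

End Averages.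

(** * Schur's lemma and roots of unity *)

Section ClosedField.
Variables (k : fieldType) (r' : nat).
Local Notation r := r'.+1.
Local Notation pair := ('M[k]_r * 'M[k]_r)%type.
Implicit Types (x : pair) (T : 'M[k]_r).
Hypothesis k_closed : forall p : {poly k}, (1 < size p)%N -> exists z, root p z.

Lemma column_eigenvector T : exists z (v : 'cV[k]_r), v != 0 /\ T *m v = z *: v.
Proof.
have [|z] := k_closed (p := char_poly T^T); first by rewrite size_char_poly.
rewrite -eigenvalue_root_char => /eigenvalueP[v vT v0].
exists z, v^T; split; first by rewrite -[0]trmx0 (inj_eq trmx_inj).
by apply: trmx_inj; rewrite trmx_mul trmxK vT linearZ /= trmxK.
Qed.

(** An eigenspace of [T] is nonzero and stable under both matrices, as they commute with [T]. *)
Lemma schur x T : irreducible_pair x -> T *m x.1 = x.1 *m T -> T *m x.2 = x.2 *m T ->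
  exists z, T = z%:M.
Proof.
move=> irr T1 T2; have [z [v [v0 Tv]]] := column_eigenvector T; exists z.
pose g : 'End('cV[k]_r) := linfun (mulmx (T - z%:M)).
have kerP u : u \in lker g <-> T *m u = z *: u.
  rewrite memv_ker lfunE /= mulmxBl mul_scalar_mx subr_eq0.
  by split=> /eqP.
have [|||kf] := irr (lker g).
- by move=> u /kerP Tu; apply/kerP; rewrite mulmxA T1 -mulmxA Tu -scalemxAr.
- by move=> u /kerP Tu; apply/kerP; rewrite mulmxA T2 -mulmxA Tu -scalemxAr.
- move=> k0; have : v \in lker g by apply/kerP.
  by rewrite k0 memv0 (negPf v0).
apply: eq_from_cols => j; rewrite !colE mul_scalar_mx; apply/kerP.
by rewrite kf memvf.
Qed.

(** An eigenvector of the other letter would span a stable line, which is proper since [r > 1]. *)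
Lemma irreducible_letter_nonscalar x b z : (1 < r)%N -> irreducible_pair x ->
  letter x b = z%:M -> False.
Proof.
move=> r1 irr bz; have [z' [v [v0 bv]]] := column_eigenvector (letter x (~~ b)).
have sv b' u : u \in <[v]>%VS -> letter x b' *m u \in <[v]>%VS.
  move=> /vlineP[c ->]; have [->|] := eqVneq b' b.
    by rewrite bz mul_scalar_mx; do 2!apply: memvZ; apply: memv_line.
  rewrite -scalemxAr; case: b b' {bz} bv => [] [] //= bv _; rewrite bv;
  by do 2!apply: memvZ; apply: memv_line.
have dv : \dim <[v]>%VS = 1%N by rewrite dim_vline v0.
have [e|e] := irr <[v]>%VS (sv true) (sv false); move: dv; rewrite e ?dimv0 //.
by rewrite dimvf /dim /= muln1 => re; rewrite -re ltnn in r1.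
Qed.

Lemma poly_roots_finite (p : {poly k}) : p != 0 ->
  exists s : seq k, forall z, root p z -> z \in s.
Proof.
have [d] := ubnP (size p); elim: d p => // d IHd p sp p0.
have [[z /factor_theorem[h hE]]|np] := pselect (exists z, root p z); last first.
  by exists [::] => z rz; case: np; exists z.
have h0 : h != 0 by apply: contraNneq p0 => h0; rewrite hE h0 mul0r.
have [|s hs] := IHd h _ h0.
  by move: sp; rewrite hE size_Mmonic ?monicXsubC // size_XsubC addn2.
exists (z :: s) => z'; rewrite hE rootM root_XsubC inE orbC => /orP[->//|/hs ->].
by rewrite orbT.
Qed.

Lemma roots_of_unity e : (0 < e)%N ->
  exists s : seq k, forall z, (z \in s) = (z ^+ e == 1).
Proof.
move=> e0; have [|s hs] := @poly_roots_finite ('X^e - 1).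
  by rewrite -size_poly_gt0 size_XnsubC.
exists [seq z <- s | z ^+ e == 1] => z; rewrite mem_filter.
have [ze|//] := eqVneq (z ^+ e) 1; apply: hs.
by rewrite rootE !hornerE ze subrr.
Qed.

End ClosedField.

(** * Pairs whose common power is scalar *)

Section PowerRelation.
Variables (k : fieldType) (r' n m : nat).
Local Notation r := r'.+1.
Local Notation pair := ('M[k]_r * 'M[k]_r)%type.
Local Notation pairs := (mxpair_space k r).
Hypothesis k_closed : forall p : {poly k}, (1 < size p)%N -> exists z, root p z.
Hypothesis natr_eq0 : forall n, (n%:R == 0 :> k) = (n == 0)%N.
Hypotheses (n_gt0 : (0 < n)%N) (m_gt0 : (0 < m)%N).

(** The scalar omega; taking a matrix entry makes it a polynomial function on all pairs. *)
Definition central_scalar (x : pair) : k := (x.1 ^+ n) 0 0.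

(** By Schur's lemma it contains all irreducible pairs satisfying the relation; unlike
    irreducibility, being scalar is a closed condition, which makes this set affine. *)
Definition scalar_power_set : set pairs :=
  [set x : pair | [/\ x.1 \in unitmx, x.2 \in unitmx, x.1 ^+ n = x.2 ^+ m
                    & x.1 ^+ n = (central_scalar x)%:M]].

Local Notation Y := scalar_power_set.
Implicit Types x : pair.

Lemma rep_variety_irreducible :
  rep_variety n m `&` @irreducible_pair k r = irreducible_set Y.
Proof.
apply/seteqP; split=> x [].
  move=> [u1 u2 e] irr; split=> //; split=> //.
  have [||z zE] := schur k_closed irr (T := x.1 ^+ n).
  - by rewrite mulmxE -exprSr -exprS.
  - by rewrite e mulmxE -exprSr -exprS.
  - by rewrite /central_scalar zE mxE.
by move=> [u1 u2 e _] irr.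
Qed.

Lemma scalar_power_affine : is_affine (subspace Y).
Proof.
have [c1 c2] := pair_space_coord k r; have nP := @pair_inverts k r.
have oT := isopenT pairs.
pose D : set pairs := [set x : pair | \det x.1 * \det x.2 != 0].
pose F1 (x : pairs) : matrix_space k r r := (x : pair).1 ^+ n.
pose F2 (x : pairs) : matrix_space k r r := (x : pair).2 ^+ m.
pose F3 (x : pairs) : matrix_space k r r := (central_scalar x)%:M.
have r1 := regular_mxX n c1; have r2 := regular_mxX m c2.
have m1 : morphism F1 by apply: morphism_to_matrix.
have m2 : morphism F2 by apply: morphism_to_matrix.
have m3 : morphism F3.
  apply: morphism_to_matrix => //.
  apply: (@regular_mx_eq _ _ _ _ _ (fun x : pairs => central_scalar x *: (1%:M : 'M[k]_r))).
    by move=> x; rewrite /F3 scalemx1.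
  by apply: regular_mxZ; [apply: r1 | apply: regular_mx_cst].
have sM := affine_separated (matrix_affine k r r).
have cZ : isclosed ([set x | F1 x = F2 x] `&` [set x | F1 x = F3 x]).
  by apply: isclosedI; apply: equalizer_closed.
have aD : is_affine (subspace D).
  apply: nonzero_subspace_affine; first exact: pair_affine.
  by apply: regularM => //; apply: regular_det.
have := closed_open_affine cZ aD; congr (is_affine (subspace _)).
apply/seteqP; split=> x.
  move=> [[e1 e2]]; rewrite /D /= mulf_eq0 negb_or => /andP[d1 d2].
  by split; rewrite ?unitmxE ?unitfE.
move=> [u1 u2 e1 e2]; split; first by split.
by rewrite /D /= mulf_neq0 // -unitfE -unitmxE.
Qed.

Lemma scalar_power_conj P x : P \in unitmx -> Y x ->
  Y (conj_pair P x) /\ central_scalar (conj_pair P x) = central_scalar x.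
Proof.
move=> uP [u1 u2 e1 e2].
have c1 : (conj_pair P x).1 ^+ n = (central_scalar x)%:M.
  by rewrite conjmxX // e2 scalar_mxC mulmxK.
have cE : central_scalar (conj_pair P x) = central_scalar x.
  by rewrite /central_scalar c1 mxE.
split=> //; split; rewrite ?cE //=.
- by rewrite !unitmx_mul uP u1 unitmx_inv.
- by rewrite !unitmx_mul uP u2 unitmx_inv.
- by rewrite !conjmxX // e1.
Qed.

Variables (b : bool) (u v : nat).
Local Notation e := (if b then n else m).
Hypothesis uv : (u * r = v * e + 1)%N.

Lemma exponent_gt0 : (0 < e)%N. Proof. by case: b. Qed.

Lemma letter_power x : Y x -> letter x b ^+ e = (central_scalar x)%:M.
Proof. by move=> [_ _ e1 <-]; case: b => //=; rewrite e1. Qed.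

Lemma letter_det x : Y x -> \det (letter x b) != 0.
Proof. by move=> [u1 u2 _ _]; rewrite -unitfE -unitmxE; case: b. Qed.

Lemma det_power x : Y x -> \det (letter x b) ^+ e = central_scalar x ^+ r.
Proof.
move=> Yx; rewrite -[RHS]det_scalar -letter_power //.
by elim: (e) => [|j IHj]; [rewrite !expr0 det1 | rewrite !exprS det_mulmx IHj].
Qed.

Lemma central_scalar_neq0 x : Y x -> central_scalar x != 0.
Proof.
move=> Yx; have := det_power Yx; apply: contra_eq_neq => ->.
by rewrite expr0n /= expf_neq0 // letter_det.
Qed.

(* [s = det(a)^u / omega^v] is an [e]-th root of [omega = a^e], because
   [u r = v e + 1]; hence the eigenvalues of [a / s] are [e]-th roots of unity. *)
Definition normalized (z : k) x : 'M[k]_r :=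
  (z^-1 * (central_scalar x ^+ v / \det (letter x b) ^+ u)) *: letter x b.

Lemma normalized_power z x : z ^+ e = 1 -> Y x -> normalized z x ^+ e = 1.
Proof.
move=> ze Yx; have c0 := central_scalar_neq0 Yx.
have key : (central_scalar x ^+ v / \det (letter x b) ^+ u) ^+ e * central_scalar x = 1.
  rewrite exprMn exprVn -!exprM [(u * _)%N]mulnC [\det _ ^+ _]exprM det_power // -exprM.
  by rewrite [(r * u)%N]mulnC uv addn1 mulrAC -exprSr divff ?expf_neq0.
rewrite /normalized exprZn letter_power // [in X in X *: _]exprMn exprVn ze invr1 mul1r.
by rewrite scale_scalar_mx key.
Qed.

Lemma normalized_conj z P x : P \in unitmx -> Y x ->
  normalized z (conj_pair P x) = P *m normalized z x *m invmx P.
Proof.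
move=> uP Yx; have [_ cE] := scalar_power_conj uP Yx.
rewrite /normalized cE -scalemxAr -scalemxAl.
have -> : letter (conj_pair P x) b = P *m letter x b *m invmx P by case: b.
rewrite !det_mulmx det_inv mulrAC mulfV ?mul1r //.
by rewrite -unitfE -unitmxE.
Qed.

Lemma normalized_regular z : regular_mx (fun y : subspace Y => normalized z (val y)).
Proof.
have oT := isopenT (subspace Y).
have nY : inverts_regular (subspace Y) by apply: affine_inverts; apply: scalar_power_affine.
have c1 := @pairs_coord1 k r' Y; have c2 := @pairs_coord2 k r' Y.
have rl : regular_mx (fun y : subspace Y => letter (val y) b) by case: b.
apply: regular_mxZ => //; apply: regularM => //; first exact: regular_cst.
apply: regularM => //.
  by apply: regularX => //; apply: (regular_mxX n c1).
apply: regularV => // [y|]; last by apply: regularX => //; apply: regular_det.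
by rewrite expf_neq0 // letter_det //; apply: (set_valP y).
Qed.

Variable s : seq k.
Hypothesis sE : forall z, (z \in s) = (z ^+ e == 1).

Local Notation J := ('I_(size s) * bool)%type.

(** For [z] the root of unity numbered [j.1], the average projects onto the [z]-eigenspace of
    [normalized 1 x]; the flag [false] selects the complementary projector. *)
Definition eigen_idempotent (j : J) x : 'M[k]_r :=
  let p := average e (normalized (nth 1 s j.1) x) in if j.2 then p else 1%:M - p.

Lemma nth_root_of_unity (i : 'I_(size s)) : nth 1 s i ^+ e = 1.
Proof. by apply/eqP; rewrite -sE mem_nth. Qed.

Lemma exponent_neq0 : e%:R != 0 :> k.
Proof. by rewrite natr_eq0 -lt0n exponent_gt0. Qed.

Lemma eigen_idempotent_idem j x : Y x ->
  eigen_idempotent j x *m eigen_idempotent j x = eigen_idempotent j x.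
Proof.
move=> Yx; rewrite /eigen_idempotent.
have pp := average_idem exponent_neq0 (normalized_power (nth_root_of_unity j.1) Yx).
case: j.2 => //; rewrite mulmxBl mul1mx mulmxBr mulmx1 pp subrr subr0 //.
Qed.

Lemma eigen_idempotent_conj j P x : P \in unitmx -> Y x ->
  eigen_idempotent j (conj_pair P x) = P *m eigen_idempotent j x *m invmx P.
Proof.
move=> uP Yx; rewrite /eigen_idempotent normalized_conj // average_conj //.
by case: j.2 => //; rewrite mulmxBr mulmxBl mulmx1 mulmxV.
Qed.

Lemma eigen_idempotent_regular j :
  regular_mx (fun y : subspace Y => eigen_idempotent j (val y)).
Proof.
rewrite /eigen_idempotent; have rp := regular_average e (normalized_regular (nth 1 s j.1)).
by case: j.2 => //; apply: regular_mxB => //; apply: regular_mx_cst.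
Qed.

Lemma eigen_idempotent_stable j x (U : {vspace 'cV[k]_r}) w : Y x ->
  stable_space x U -> w \in U -> eigen_idempotent j x *m w \in U.
Proof.
move=> Yx sU wU.
have h : average e (normalized (nth 1 s j.1) x) *m w \in U.
  apply: average_stable => // w' w'U; rewrite -scalemxAl; apply: memvZ.
  exact: letter_stable.
by rewrite /eigen_idempotent; case: j.2 => //; rewrite mulmxBl mul1mx rpredB.
Qed.

(* For [r <= 3] a nonscalar idempotent or its complement has rank one. *)
Lemma eigen_idempotent_rank1 x : (r <= 3)%N -> Y x -> irreducible_pair x ->
  exists j, \rank (eigen_idempotent j x) = 1%N.
Proof.
(* The eigenvalue [z] found here is an [e]-th root of unity and selects the idempotent, which fixes
   [w] and is therefore nonzero. *)
move=> r3 Yx irr; have [z [w [w0 Nw]]] := column_eigenvector k_closed (normalized 1 x).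
have NX i : normalized 1 x ^+ i *m w = z ^+ i *: w.
  elim: i => [|i IHi]; first by rewrite !expr0 mul1mx scale1r.
  by rewrite exprSr -mulmxE -mulmxA Nw -scalemxAr IHi scalerA -exprS.
have ze : z ^+ e = 1.
  have := NX e; rewrite normalized_power ?expr1n // mul1mx => /eqP.
  rewrite -[X in X == _]scale1r -subr_eq0 -scalerBl scaler_eq0 (negPf w0) orbF subr_eq0.
  by move=> /eqP.
have z0 : z != 0.
  by apply: contra_eq_neq ze => ->; rewrite expr0n gtn_eqF ?exponent_gt0 // eq_sym oner_eq0.
have zs : (index z s < size s)%N by rewrite index_mem sE ze.
pose j := Ordinal zs; have jz : nth 1 s j = z by rewrite nth_index // sE ze.
have nz : normalized z x = z^-1 *: normalized 1 x.
  by rewrite /normalized invr1 mul1r scalerA.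
pose p := average e (normalized z x).
have pE : eigen_idempotent (j, true) x = p by rewrite /eigen_idempotent /= jz.
have qE : eigen_idempotent (j, false) x = 1%:M - p by rewrite /eigen_idempotent /= jz.
have Np := normalized_power ze Yx.
have pp : p *m p = p := average_idem exponent_neq0 Np.
have pw : p *m w = w.
  by apply: (fixed_average exponent_neq0); rewrite nz -scalemxAl Nw scalerA mulVf // scale1r.
have p0 : (0 < \rank p)%N.
  rewrite lt0n mxrank_eq0; apply: contraNneq w0 => p0.
  by rewrite -pw p0 mul0mx.
have [p1|p1] := eqVneq (\rank p) 1%N; first by exists (j, true); rewrite pE.
have rp : (\rank p <= r)%N := rank_leq_row p.
have r1 : (1 < r)%N by apply: leq_trans rp; rewrite ltn_neqAle eq_sym p1.
(* An idempotent of full rank is the identity; the letter would then be scalar, which is excluded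
   for [r > 1]. *)
have pr : (\rank p < r)%N.
  rewrite ltn_neqAle rp andbT; apply/eqP => pr.
  have up : p \in unitmx by rewrite -row_free_unit /row_free pr.
  have p1' : p = 1%:M by rewrite -(mulmxK up p) pp mulmxV.
  have N1 : normalized z x = 1%:M.
    by have := mul_average Np; rewrite -/p p1' mulmx1.
  have [c cE] : exists c, letter x b = c%:M.
    move: N1; rewrite /normalized; set d := _ * _ => N1; exists d^-1.
    have d0 : d != 0.
      apply: contra_eq_neq N1 => ->; rewrite scale0r eq_sym.
      by rewrite -[1%:M]/(1 : 'M[k]_r) oner_eq0.
    by rewrite -scalemx1 -N1 scalerA mulVf // scale1r.
  exact: (irreducible_letter_nonscalar k_closed r1 irr cE).
(* What remains is [1 < \rank p < r <= 3], that is rank 2 with [r = 3], so the complement has trace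
   1 and hence rank 1. *)
exists (j, false); have qq := eigen_idempotent_idem (j, false) Yx.
apply/eqP; rewrite -(natr_inj natr_eq0) -(idempotent_trace qq) qE raddfB /= mxtrace1.
rewrite (idempotent_trace pp) -natrB ?(ltnW pr) // (natr_inj natr_eq0).
by move: r3 pr p0 p1; case: (\rank p) => [|[|[|?]]] //; case: r' => [|[|[|?]]].
Qed.

End PowerRelation.

(** * The character variety *)

(** [r] is 1 or one of the primes 2 and 3, and a prime dividing both exponents would divide their
    gcd. *)
Lemma coprime_le3 (n m r : nat) : coprime n m -> (0 < r <= 3)%N ->
  coprime r n || coprime r m.
Proof.
move=> nm /andP[r0 r3].
have [->|r1] := eqVneq r 1%N; first by rewrite coprime1n.
have pr : prime r by move: r r0 r3 r1 => [|[|[|[|r]]]].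
rewrite !prime_coprime // -negb_and; apply/negP => rnm.
have : (r %| gcdn n m)%N by rewrite dvdn_gcd.
by rewrite (eqP nm) dvdn1 (negPf r1).
Qed.

Lemma character_variety_class (k : fieldType) (n m r' : nat) :
  (forall p : {poly k}, (1 < size p)%N -> exists z, root p z) ->
  (forall n, (n%:R == 0 :> k) = (n == 0)%N) ->
  (0 < n)%N -> (0 < m)%N -> coprime n m -> (r'.+1 <= 3)%N ->
  [/\ small_variety (Rirr k r'.+1 n m), small_variety (Mirr k r'.+1 n m)
    & K0class (Rirr k r'.+1 n m) =
      K0class (PGL_space k r'.+1) * K0class (Mirr k r'.+1 n m)].
Proof.
move=> k_closed natr0 n0 m0 nm r3.
pose Y := @scalar_power_set k r' n m.
have [RE ME] : Rirr k r'.+1 n m = irreducible_space Y /\ Mirr k r'.+1 n m = conj_space Y.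
  have e := rep_variety_irreducible r' n m k_closed.
  (* The orbit relation is typed by the subspace; abstracting the set lets the equality of sets be
     rewritten in type and relation together. *)
  pose Q (A : set (mxpair_space k r'.+1)) : fspace k := @quot_space k (subspace A)
    (fun X => [set Z | exists2 P : 'M[k]_r'.+1, P \in unitmx
       & val Z = (P *m (val X).1 *m invmx P, P *m (val X).2 *m invmx P)]).
  split; first by rewrite /Rirr e.
  by rewrite -[LHS]/(Q (rep_variety n m `&` @irreducible_pair k r'.+1)) e.
rewrite {}RE {}ME.
have [b cb] : exists b : bool, coprime r'.+1 (if b then n else m).
  by have /orP[c|c] := coprime_le3 nm (r3 : (0 < r'.+1 <= 3)%N); [exists true | exists false].
(* Bezout over the naturals: [u r = v e + gcd(r, e)], the gcd being 1 by the choice of [b]. *)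
have [u v uv _] := egcdnP (if b then n else m) (ltn0Sn r').
rewrite (eqP cb) in uv.
have [s sE] := @roots_of_unity k (if b then n else m) (exponent_gt0 n0 m0 b).
have Yaff := scalar_power_affine k r' n m.
have Yconj (P : 'M[k]_r'.+1) x : P \in unitmx -> Y x -> Y (conj_pair P x).
  by move=> uP /(scalar_power_conj uP)[].
pose E := @eigen_idempotent k r' n m b u v s.
have Ereg j : regular_mx (fun y : subspace Y => E j (val y)).
  exact: (eigen_idempotent_regular b u v j).
have Econj j P x : P \in unitmx -> Y x -> E j (conj_pair P x) = P *m E j x *m invmx P.
  exact: eigen_idempotent_conj.
have Eid := eigen_idempotent_idem natr0 n0 m0 uv sE.
have Est j x (U : {vspace 'cV[k]_r'.+1}) w : Y x -> stable_space x U -> w \in U -> E j x *m w \in U.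
  exact: eigen_idempotent_stable.
have Er x : Y x -> irreducible_pair x -> exists j, \rank (E j x) = 1%N.
  exact: (eigen_idempotent_rank1 k_closed natr0 n0 m0 uv sE r3).
split.
- exact: (irreducible_small natr0 Yaff Ereg Eid Est Er).
- exact: (conj_space_small natr0 Yaff Yconj Ereg Econj Eid Est Er).
- exact: (K0class_conj_space natr0 Yaff Yconj Ereg Econj Eid Est Er).
Qed.

(** * Cancellation in the localization *)

Section LocalizationUnits.
Variables (A : comPzRingType) (S : set A).
Local Notation loc := (localization S).
Local Notation cl := (\pi_{eq_quot (@fraceq A S)}%qT : fracpair S -> loc).

Lemma to_locM (a c : A) : to_loc S (a * c) = to_loc S a * to_loc S c.
Proof.
rewrite -[RHS]/(loc_mul _ _) /to_loc loc_mulE; apply: loc_eq.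
by rewrite /fmul !fnum_mkfrac !fden_mkfrac !mulr1.
Qed.

Lemma to_loc_invertible (a : A) : mult_closure S a -> invertible (to_loc S a).
Proof.
move=> Sa; exists (cl (mkfrac 1 Sa)).
rewrite -[LHS]/(loc_mul _ _) /to_loc loc_mulE; apply: loc_eq.
by rewrite /fmul !fnum_mkfrac !fden_mkfrac !mulr1 !mul1r.
Qed.

(** Equality of fractions is tested up to a denominator factor, so [t] cancels even if it is a zero
    divisor in [A]. *)
Lemma to_loc_cancel (t a c : A) : S t -> t * a = t * c -> to_loc S a = to_loc S c.
Proof.
move=> St e; apply/locP; exists t.
  by rewrite -[t]mulr1; apply: mult_closureM => //; apply: mult_closure1.
by rewrite !fnum_mkfrac !fden_mkfrac !mulr1.
Qed.

Lemma mult_closureX (t : A) n : S t -> mult_closure S (t ^+ n).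
Proof.
by move=> St; elim: n => [|n IHn]; [exact: mult_closure1 | rewrite exprS; apply: mult_closureM].
Qed.

(** Any element that [xget] may choose is an inverse of [y], which is all the cancellation needs. *)
Lemma ring_div_mull (x y : A) : invertible y -> ring_div (y * x) y = x.
Proof.
move=> [z yz]; rewrite /ring_div; case: xgetP => [w _ yw|/(_ z)//].
by rewrite mulrAC yw mul1r.
Qed.

End LocalizationUnits.

Theorem mainTheorem4 (R : realType) (n m r : nat)
    (n_gt0 : (0 < n)%N) (m_gt0 : (0 < m)%N) (nm_coprime : coprime n m)
    (r_gt0 : (0 < r)%N) (r_le3 : (r <= 3)%N) :
  let C : fieldType := R[i] in
  let q : K0 C := K0class (affine_space C 1) in
  let S : set (K0 C) :=
    [set s | s = q \/ exists2 i : nat, (1 <= i <= r)%N & s = q ^+ i - 1] in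
  let den : K0 C := q ^+ r.-1 * \prod_(i < r.-1) (q ^+ r - q ^+ i) in
  let M : localization S := to_loc S (K0class (Mirr C r n m)) in
  let Rr : localization S := to_loc S (K0class (Rirr C r n m)) in
  let G : localization S := to_loc S (K0class (PGL_space C r)) in
  let D : localization S := to_loc S den in
  [/\ is_variety (Mirr C r n m), is_variety (Rirr C r n m)
    & is_variety (PGL_space C r)] /\
  [/\ invertible G, invertible D,
      M = ring_div Rr G
    & ring_div Rr G = ring_div Rr D].
Proof.
move=> C q S den M Rr G D.
have C_closed (p : {poly C}) : (1 < size p)%N -> exists z, root p z.
  by move=> sp; apply: (@closed_rootP R[i] p _); rewrite gtn_eqF.
have C_char0 j : (j%:R == 0 :> C) = (j == 0)%N by apply: (@Num.Theory.pnatr_eq0 R[i]).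
case: r r_gt0 r_le3 @S @den @M @Rr @G @D => // r' _ r_le3 S den M Rr G D.
have [sR sM RE] := character_variety_class C_closed C_char0 n_gt0 m_gt0 nm_coprime r_le3.
have sP := PGL_small C r'.
have Sq1 : S (q - 1) by right; exists 1%N; rewrite ?expr1.
(* Both sides times [q - 1] equal [GL]: the last factor of its product formula is
   [q^r - q^(r-1) = q^(r-1) (q - 1)]. *)
have GD : G = D.
  apply: (@to_loc_cancel _ _ (q - 1)) => //; rewrite -K0class_GL_PGL K0class_GL.
  rewrite big_ord_recr /= mulrC /den -/q exprS; ring.
have Dinv : invertible D.
  apply: to_loc_invertible; apply: mult_closure_mul.
    by apply: mult_closureX; left.
  apply: big_ind => [||i _]; [exact: mult_closure1 | exact: mult_closure_mul |].
  have ir : (i <= r'.+1)%N by apply: leqW; apply: ltnW.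
  (* Both factors are products of allowed denominators, since [1 <= r - i <= r]. *)
  rewrite (_ : _ - _ = q ^+ i * (q ^+ (r'.+1 - i) - 1)); last first.
    by rewrite mulrBr mulr1 -exprD subnKC.
  apply: mult_closure_mul; first by apply: mult_closureX; left.
  rewrite -[_ - 1]expr1; apply: mult_closureX; right; exists (r'.+1 - i)%N => //.
  by rewrite subn_gt0 ltnS (ltnW (ltn_ord i)) leq_subr.
have Ginv : invertible G by rewrite GD.
have ME : M = ring_div Rr G by rewrite /Rr RE to_locM (ring_div_mull M Ginv).
split; first by split; [have [] := sM | have [] := sR | have [] := sP].
by split=> //; rewrite GD.
Qed.
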